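(* Let $k$ be a commutative ring, $\mathcal{C}$ a poset, and $\mathbb{A}$ a presheaf of $k$-algebras over $\mathcal{C}$, with associated algebra $\mathbb{A}!$. The functor $$!:\mathcal{D}_k^{-}(\mathbb{A}\text{-bimod})\longrightarrow \mathcal{D}_k^{-}(\mathbb{A}!\text{-bimod})$$ induced on relative derived categories by $!:\mathbb{A}\text{-bimod}\to\mathbb{A}!\text{-bimod}$ is full and faithful. That is, for all $\mathbb{M}_\bullet,\mathbb{N}_\bullet\in\mathcal{D}_k^{-}(\mathbb{A}\text{-bimod})$ the map $$!:\mathrm{Mor}_{\mathcal{D}_k^{-}(\mathbb{A}\text{-bimod})}(\mathbb{M}_\bullet,\mathbb{N}_\bullet)\longrightarrow \mathrm{Mor}_{\mathcal{D}_k^{-}(\mathbb{A}!\text{-bimod})}(\mathbb{M}_\bullet!,\mathbb{N}_\bullet!)$$ is a bijection.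
   Context: **Presheaves and bimodules.** $k$ is a commutative ring; $k$-algebras are associative and unital; bimodules over a $k$-algebra are symmetric over $k$ (so a $k$-bimodule is just a $k$-module). A poset $\mathcal{C}$ is viewed as a category with a unique map $i\to j$ for each $i\le j$. A presheaf of $k$-algebras over $\mathcal{C}$ is a functor $\mathbb{A}:\mathcal{C}^{op}\to k\text{-}\mathbf{alg}$; write $\mathbb{A}^i=\mathbb{A}(i)$ and $\varphi^{ij}:\mathbb{A}^j\to\mathbb{A}^i$ for the structure map, $i\le j$. An $\mathbb{A}$-bimodule $\mathbb{M}$ is a presheaf of abelian groups on $\mathcal{C}$ such that each $\mathbb{M}^i$ is an $\mathbb{A}^i$-bimodule and for $i\le j$ the structure map $T_{\mathbb{M}}^{ij}:\mathbb{M}^j\to\mathbb{M}^i$ is an $\mathbb{A}^j$-bimodule map (with $\mathbb{M}^i$ an $\mathbb{A}^j$-bimodule via $\varphi^{ij}$). A map of $\mathbb{A}$-bimodules is a natural transformation $\eta$ with each $\eta^i$ an $\mathbb{A}^i$-bimodule map. This gives the category $\mathbb{A}$-bimod. **The algebra $\mathbb{A}!$ and the functor $!$.** $\mathbb{A}!=\prod_{i\in\mathcal{C}}\coprod_{j\ge i}\mathbb{A}^i\varphi^{ij}$, i.e. row-finite $\mathcal{C}\times\mathcal{C}$ matrices $(a_{ij})$ with $a_{ij}\in\mathbb{A}^i$ if $i\le j$ and $a_{ij}=0$ otherwise (here the symbols $\varphi^{ij}$ label distinct copies of $\mathbb{A}^i$); addition is componentwise and multiplication is given by $(a^h\varphi^{hi})(a^i\varphi^{ij})=a^h\varphi^{hi}(a^i)\varphi^{hj}$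 and $(a^h\varphi^{hi})(a^j\varphi^{jl})=0$ if $i\ne j$. For an $\mathbb{A}$-bimodule $\mathbb{M}$, $\mathbb{M}!=\prod_{i\in\mathcal{C}}\coprod_{j\ge i}\mathbb{M}^i\varphi^{ij}$ as a $k$-module, with $\mathbb{A}!$-actions $(a^h\varphi^{hi})(m^i\varphi^{ij})=a^hT_{\mathbb{M}}^{hi}(m^i)\varphi^{hj}$, $(m^h\varphi^{hi})(a^i\varphi^{ij})=m^h\varphi^{hi}(a^i)\varphi^{hj}$, and $(a^h\varphi^{hi})(m^j\varphi^{jl})=0=(m^h\varphi^{hi})(a^j\varphi^{jl})$ if $i\neq j$. For a map $\eta$ of $\mathbb{A}$-bimodules, $\eta!(n^i\varphi^{ij})=\eta^i(n^i)\varphi^{ij}$. This is a functor $!:\mathbb{A}\text{-bimod}\to\mathbb{A}!\text{-bimod}$. **Relative derived categories.** For $\mathcal{A}$ equal to $\mathbb{A}$-bimod or $\mathbb{A}!$-bimod, $Kom^-(\mathcal{A})$ is the category of complexes bounded to the right, $\cdots\to M_n\to\cdots\to M_1\to M_0\to 0$, in $\mathcal{A}$, with chain maps, and $\mathcal{K}^-(\mathcal{A})$ is its homotopy category (chain maps modulo chain homotopy in $\mathcal{A}$). A map $f$ in $Kom^-(\mathbb{A}!\text{-bimod})$ is a relative quasi-isomorphism if its mapping cone is contractible as a complex of $k$-modules. A map $f:\mathbb{M}_\bullet\to\mathbb{N}_\bullet$ in $Kom^-(\mathbb{A}\text{-bimod})$ is a relative quasi-isomorphism if for every $i\in\mathcal{C}$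 the cone of $f^i:\mathbb{M}_\bullet^i\to\mathbb{N}_\bullet^i$ is contractible as a complex of $k$-modules. $\mathcal{D}_k^-(\mathcal{A})=\mathcal{K}^-(\mathcal{A})[\Sigma^{-1}]$ is the localization of $\mathcal{K}^-(\mathcal{A})$ at the class $\Sigma$ of relative quasi-isomorphisms. The functor $!$, applied termwise to complexes, preserves homotopies and relative quasi-isomorphisms, so induces a functor on these localizations. *)

(* Defs.v *)
From HB Require Import structures.
From mathcomp Require Import all_boot all_order all_algebra.
From mathcomp Require Import boolp classical_sets functions cardinality fsbigop.

Set Implicit Arguments.
Unset Strict Implicit.
Unset Printing Implicit Defensive.

Import Order.TTheory GRing.Theory.
Local Open Scope ring_scope.

Record is_equiv (T : Type) (R : T -> T -> Prop) : Prop := IsEquiv {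
  eqv_refl : forall x, R x x;
  eqv_sym : forall x y, R x y -> R y x;
  eqv_trans : forall x y z, R x y -> R y z -> R x z
}.

(* The library's {eq_quot _} asks for a choiceType, and the zigzags below live
   in a universe above that of the carriers of its structures; hence the set
   of equivalence classes. *)
Section Quotient.
Variables (T : Type) (R : T -> T -> Prop) (E : is_equiv R).

Definition quot : Type := {P : T -> Prop | exists x, P = R x}.
Definition cls (x : T) : quot := exist _ (R x) (ex_intro _ x erefl).
Definition rep (u : quot) : T := projT1 (cid (proj2_sig u)).

Lemma repK u : cls (rep u) = u.
Proof.
rewrite /rep; case: u => P eP /=; case: cid => x /= PE.
exact/eq_exist/esym.
Qed.

Lemma clsP x y : cls x = cls y <-> R x y.
Proof.
split=> [/(congr1 (fun u => sval u y)) /= ->|xy]; first exact: (eqv_refl E).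
apply: eq_exist; apply: functional_extensionality_dep => z.
apply: propositional_extensionality.
split; last exact: (eqv_trans E).
by move=> xz; apply: (eqv_trans E) xz; apply: (eqv_sym E).
Qed.

Lemma rep_cls x : R (rep (cls x)) x.
Proof. by apply/clsP; rewrite repK. Qed.

End Quotient.

Record category := Category {
  ob :> Type;
  mor : ob -> ob -> Type;
  idm : forall X, mor X X;
  cmp : forall X Y Z, mor Y Z -> mor X Y -> mor X Z;
  cmpA : forall X Y Z W (h : mor Z W) (g : mor Y Z) (f : mor X Y),
    cmp h (cmp g f) = cmp (cmp h g) f;
  cmp1m : forall X Y (f : mor X Y), cmp (idm Y) f = f;
  cmpm1 : forall X Y (f : mor X Y), cmp f (idm X) = f
}.
Arguments idm {_} X.
Arguments cmp {_ X Y Z}.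

Record functor (C D : category) := Functor {
  fob :> C -> D;
  fmor : forall X Y : C, mor X Y -> mor (fob X) (fob Y);
  fmor1 : forall X, fmor (idm X) = idm (fob X);
  fmorM : forall X Y Z (g : mor Y Z) (f : mor X Y),
    fmor (cmp g f) = cmp (fmor g) (fmor f)
}.
Arguments fmor {C D} _ {X Y}.

Record congruence (C : category) := Congruence {
  crel : forall X Y : C, mor X Y -> mor X Y -> Prop;
  crel_equiv : forall X Y, is_equiv (@crel X Y);
  crel_cmp : forall (X Y Z : C) (g g' : mor Y Z) (f f' : mor X Y),
    crel g g' -> crel f f' -> crel (cmp g f) (cmp g' f')
}.
Arguments crel {C} _ {X Y}.

Section QuotientCategory.
Variables (C : category) (R : congruence C).

Definition qmor (X Y : C) : Type := quot (@crel C R X Y).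
Definition qcls (X Y : C) (f : mor X Y) : qmor X Y := cls (crel R) f.
Definition qcmp (X Y Z : C) (g : qmor Y Z) (f : qmor X Y) : qmor X Z :=
  qcls (cmp (rep g) (rep f)).

Lemma qmor_ind (X Y : C) (P : qmor X Y -> Prop) :
  (forall f, P (qcls f)) -> forall u, P u.
Proof. by move=> Pc u; rewrite -(repK u); apply: Pc. Qed.

Lemma qcmpE (X Y Z : C) (g : mor Y Z) (f : mor X Y) :
  qcmp (qcls g) (qcls f) = qcls (cmp g f).
Proof. apply/(clsP (crel_equiv R _ _)).
by apply: crel_cmp; exact: (rep_cls (crel_equiv R _ _)). Qed.

Fact qcmpA (X Y Z W : C) (h : qmor Z W) (g : qmor Y Z) (f : qmor X Y) :
  qcmp h (qcmp g f) = qcmp (qcmp h g) f.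
Proof.
elim/qmor_ind: h => h; elim/qmor_ind: g => g; elim/qmor_ind: f => f.
by rewrite !qcmpE cmpA.
Qed.

Fact qcmp1m (X Y : C) (f : qmor X Y) : qcmp (qcls (idm Y)) f = f.
Proof. by elim/qmor_ind: f => f; rewrite qcmpE cmp1m. Qed.

Fact qcmpm1 (X Y : C) (f : qmor X Y) : qcmp f (qcls (idm X)) = f.
Proof. by elim/qmor_ind: f => f; rewrite qcmpE cmpm1. Qed.

Definition quot_cat : category := Category qcmpA qcmp1m qcmpm1.

End QuotientCategory.
Arguments qcls {C} R {X Y}.

Section QuotientFunctor.
Variables (C D : category) (R : congruence C) (S : congruence D).
Variables (F : functor C D).
Hypothesis FR : forall (X Y : C) (f g : mor X Y),
  crel R f g -> crel S (fmor F f) (fmor F g).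

Definition qfmor (X Y : C) (f : qmor R X Y) : qmor S (F X) (F Y) :=
  qcls S (fmor F (rep f)).

Lemma qfmorE (X Y : C) (f : mor X Y) : qfmor (qcls R f) = qcls S (fmor F f).
Proof. apply/(clsP (crel_equiv S _ _)); apply: FR.
exact: (rep_cls (crel_equiv R _ _)). Qed.

Fact qfmor1 (X : C) : qfmor (qcls R (idm X)) = qcls S (idm (F X)).
Proof. by rewrite qfmorE fmor1. Qed.

Fact qfmorM (X Y Z : C) (g : qmor R Y Z) (f : qmor R X Y) :
  qfmor (qcmp g f) = qcmp (qfmor g) (qfmor f).
Proof.
elim/qmor_ind: g => g; elim/qmor_ind: f => f.
by rewrite qcmpE !qfmorE qcmpE fmorM.
Qed.

Definition quot_functor : functor (quot_cat R) (quot_cat S) :=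
  @Functor (quot_cat R) (quot_cat S) F qfmor qfmor1 qfmorM.

End QuotientFunctor.

Definition mclass (C : category) := forall X Y : C, mor X Y -> Prop.

Section Localization.
Variables (C : category) (W : mclass C).

(* Paths from X whose steps are morphisms of C or formal inverses of elements
   of W; the last step of the path is the outermost constructor. *)
Inductive zigzag (X : C) : C -> Type :=
| znil : zigzag X X
| zfwd Y Z : zigzag X Y -> mor Y Z -> zigzag X Z
| zbwd Y Z (p : zigzag X Y) (s : mor Z Y) : W s -> zigzag X Z.
Arguments znil {X}.
Arguments zfwd {X Y Z}.
Arguments zbwd {X Y Z}.

Fixpoint zcat (X Y Z : C) (q : zigzag Y Z) : zigzag X Y -> zigzag X Z :=
  match q with
  | znil => fun p => p
  | zfwd _ _ q f => fun p => zfwd (zcat q p) f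
  | zbwd _ _ q s w => fun p => zbwd (zcat q p) s w
  end.

Fact zcatA (X Y Z T : C) (r : zigzag Z T) (q : zigzag Y Z) (p : zigzag X Y) :
  zcat r (zcat q p) = zcat (zcat r q) p.
Proof. by elim: r q => [|? ? r IH f|? ? r IH s w] q //=; rewrite IH. Qed.

Fact zcat1p (X Y : C) (p : zigzag X Y) : zcat znil p = p.
Proof. by []. Qed.

Fact zcatp1 (X Y : C) (p : zigzag X Y) : zcat p znil = p.
Proof. by elim: p => [|? ? r IH f|? ? r IH s w] //=; rewrite IH. Qed.

Definition zigzag_cat : category := Category zcatA zcat1p zcatp1.

(* The least congruence for which zfwd is functorial and zbwd inverts zfwd. *)
Inductive zeq (X : C) : forall Y, zigzag X Y -> zigzag X Y -> Prop :=
| zeq_refl Y (p : zigzag X Y) : zeq p p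
| zeq_sym Y (p q : zigzag X Y) : zeq p q -> zeq q p
| zeq_trans Y (p q r : zigzag X Y) : zeq p q -> zeq q r -> zeq p r
| zeq_fwd Y Z (p q : zigzag X Y) (f : mor Y Z) :
    zeq p q -> zeq (zfwd p f) (zfwd q f)
| zeq_bwd Y Z (p q : zigzag X Y) (s : mor Z Y) (w : W s) :
    zeq p q -> zeq (zbwd p s w) (zbwd q s w)
| zeq_id Y (p : zigzag X Y) : zeq (zfwd p (idm Y)) p
| zeq_cmp Y Z T (p : zigzag X Y) (f : mor Y Z) (g : mor Z T) :
    zeq (zfwd (zfwd p f) g) (zfwd p (cmp g f))
| zeq_fwdbwd Y Z (p : zigzag X Z) (s : mor Z Y) (w : W s) :
    zeq (zbwd (zfwd p s) s w) p
| zeq_bwdfwd Y Z (p : zigzag X Y) (s : mor Z Y) (w : W s) :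
    zeq (zfwd (zbwd p s w) s) p.

Fact zeq_equiv (X Y : C) : is_equiv (@zeq X Y).
Proof. by split; [exact: zeq_refl | exact: zeq_sym | exact: zeq_trans]. Qed.

Fact zeq_cat (X Y Z : C) (q q' : zigzag Y Z) (p p' : zigzag X Y) :
  zeq q q' -> zeq p p' -> zeq (zcat q p) (zcat q' p').
Proof.
move=> qq' pp'; apply: (@zeq_trans _ _ _ (zcat q p')).
  by elim: q {qq'} => //= *; [exact: zeq_fwd | exact: zeq_bwd].
elim: qq' => {pp' q q' Z} /=.
- by move=> *; exact: zeq_refl.
- by move=> *; exact: zeq_sym.
- by move=> Z q1 q2 q3 _ ? _; exact: zeq_trans.
- by move=> *; exact: zeq_fwd.
- by move=> *; exact: zeq_bwd.
- by move=> *; exact: zeq_id.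
- by move=> *; exact: zeq_cmp.
- by move=> *; exact: zeq_fwdbwd.
- by move=> *; exact: zeq_bwdfwd.
Qed.

Definition zeq_congr : congruence zigzag_cat :=
  @Congruence zigzag_cat zeq zeq_equiv zeq_cat.

Definition localization : category := quot_cat zeq_congr.

End Localization.
Arguments znil {C W X}.
Arguments zfwd {C W X Y Z}.
Arguments zbwd {C W X Y Z}.

Section LocalizedFunctor.
Variables (C D : category) (W : mclass C) (V : mclass D) (F : functor C D).
Hypothesis FW : forall (X Y : C) (s : mor X Y), W s -> V (fmor F s).

Fixpoint zmap (X Y : C) (p : zigzag W X Y) : zigzag V (F X) (F Y) :=
  match p with
  | znil => znil
  | zfwd _ _ p f => zfwd (zmap p) (fmor F f)
  | zbwd _ _ p s w => zbwd (zmap p) (fmor F s) (FW w)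
  end.

Fact zmapM (X Y Z : C) (q : zigzag W Y Z) (p : zigzag W X Y) :
  zmap (zcat q p) = zcat (zmap q) (zmap p).
Proof. by elim: q p => [|? ? r IH f|? ? r IH s w] p //=; rewrite IH. Qed.

Definition zmap_functor : functor (zigzag_cat W) (zigzag_cat V) :=
  @Functor (zigzag_cat W) (zigzag_cat V) F zmap (fun=> erefl) zmapM.

Fact zmap_eq (X Y : C) (p q : zigzag W X Y) : zeq p q -> zeq (zmap p) (zmap q).
Proof.
elim=> {Y p q} /=.
- by move=> *; exact: zeq_refl.
- by move=> *; exact: zeq_sym.
- by move=> Z q1 q2 q3 _ ? _; exact: zeq_trans.
- by move=> *; exact: zeq_fwd.
- by move=> *; exact: zeq_bwd.
- by move=> *; rewrite fmor1; exact: zeq_id.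
- by move=> *; rewrite fmorM; exact: zeq_cmp.
- by move=> *; exact: zeq_fwdbwd.
- by move=> *; exact: zeq_bwdfwd.
Qed.

Definition loc_functor : functor (localization W) (localization V) :=
  @quot_functor _ _ (zeq_congr W) (zeq_congr V) zmap_functor zmap_eq.

End LocalizedFunctor.

Record preadditive := Preadditive {
  pob :> Type;
  pmor : pob -> pob -> zmodType;
  pidm : forall X, pmor X X;
  pcmp : forall X Y Z, pmor Y Z -> pmor X Y -> pmor X Z;
  pcmpA : forall X Y Z W (h : pmor Z W) (g : pmor Y Z) (f : pmor X Y),
    pcmp h (pcmp g f) = pcmp (pcmp h g) f;
  pcmp1m : forall X Y (f : pmor X Y), pcmp (pidm Y) f = f;
  pcmpm1 : forall X Y (f : pmor X Y), pcmp f (pidm X) = f;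
  pcmpDl : forall X Y Z (g g' : pmor Y Z) (f : pmor X Y),
    pcmp (g + g') f = pcmp g f + pcmp g' f;
  pcmpDr : forall X Y Z (g : pmor Y Z) (f f' : pmor X Y),
    pcmp g (f + f') = pcmp g f + pcmp g f'
}.
Arguments pidm {_} X.
Arguments pcmp {_ X Y Z}.

Record additive_functor (A B : preadditive) := AdditiveFunctor {
  afob :> A -> B;
  afmor : forall X Y : A, pmor X Y -> pmor (afob X) (afob Y);
  afmor1 : forall X, afmor (pidm X) = pidm (afob X);
  afmorM : forall X Y Z (g : pmor Y Z) (f : pmor X Y),
    afmor (pcmp g f) = pcmp (afmor g) (afmor f);
  afmorD : forall X Y (f g : pmor X Y), afmor (f + g) = afmor f + afmor g
}.
Arguments afmor {A B} _ {X Y}.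

Section PreadditiveTheory.
Variable A : preadditive.
Implicit Types X Y Z : A.

Lemma pcmp0l X Y Z (f : pmor X Y) : pcmp (0 : pmor Y Z) f = 0.
Proof. by apply: (addrI (pcmp 0 f)); rewrite -pcmpDl !addr0. Qed.

Lemma pcmp0r X Y Z (g : pmor Y Z) : pcmp g (0 : pmor X Y) = 0.
Proof. by apply: (addrI (pcmp g 0)); rewrite -pcmpDr !addr0. Qed.

Lemma pcmpNl X Y Z (g : pmor Y Z) (f : pmor X Y) : pcmp (- g) f = - pcmp g f.
Proof. by apply: (addrI (pcmp g f)); rewrite -pcmpDl !subrr pcmp0l. Qed.

Lemma pcmpNr X Y Z (g : pmor Y Z) (f : pmor X Y) : pcmp g (- f) = - pcmp g f.
Proof. by apply: (addrI (pcmp g f)); rewrite -pcmpDr !subrr pcmp0r. Qed.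

Lemma pcmpBl X Y Z (g g' : pmor Y Z) (f : pmor X Y) :
  pcmp (g - g') f = pcmp g f - pcmp g' f.
Proof. by rewrite pcmpDl pcmpNl. Qed.

Lemma pcmpBr X Y Z (g : pmor Y Z) (f f' : pmor X Y) :
  pcmp g (f - f') = pcmp g f - pcmp g f'.
Proof. by rewrite pcmpDr pcmpNr. Qed.

Lemma afmor0 (B : preadditive) (F : additive_functor A B) X Y :
  afmor F (0 : pmor X Y) = 0.
Proof. by apply: (addrI (afmor F 0)); rewrite -afmorD !addr0. Qed.

Lemma afmorB (B : preadditive) (F : additive_functor A B) X Y (f g : pmor X Y) :
  afmor F (f - g) = afmor F f - afmor F g.
Proof. by apply: (addIr (afmor F g)); rewrite -afmorD !subrK. Qed.

(* ... -> M_n -> ... -> M_1 -> M_0 -> 0, so a homotopy has no term s_{-1} *)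
Record complex := Complex {
  cob :> nat -> A;
  cd : forall n, pmor (cob n.+1) (cob n);
  cdd : forall n, pcmp (cd n) (cd n.+1) = 0
}.

Record chain_map (M N : complex) := ChainMap {
  cm :> forall n, pmor (M n) (N n);
  cmd : forall n, pcmp (cm n) (cd M n) = pcmp (cd N n) (cm n.+1)
}.

Lemma chain_mapP (M N : complex) (f g : chain_map M N) :
  (forall n, f n = g n) -> f = g.
Proof.
case: f g => f df [g dg] /= fg.
have {}fg : f = g by apply: functional_extensionality_dep.
by case: _ / fg dg => dg; congr ChainMap; exact: Prop_irrelevance.
Qed.

Fact chain_id_subproof (M : complex) n :
  pcmp (pidm (M n)) (cd M n) = pcmp (cd M n) (pidm (M n.+1)).
Proof. by rewrite pcmp1m pcmpm1. Qed.

Definition chain_id (M : complex) : chain_map M M :=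
  ChainMap (chain_id_subproof M).

Fact chain_cmp_subproof (M N P : complex) (g : chain_map N P)
    (f : chain_map M N) n :
  pcmp (pcmp (g n) (f n)) (cd M n) = pcmp (cd P n) (pcmp (g n.+1) (f n.+1)).
Proof. by rewrite -pcmpA cmd pcmpA cmd pcmpA. Qed.

Definition chain_cmp (M N P : complex) (g : chain_map N P) (f : chain_map M N) :
  chain_map M P := ChainMap (chain_cmp_subproof g f).

Fact chain_cmpA (M N P Q : complex) (h : chain_map P Q) (g : chain_map N P)
    (f : chain_map M N) :
  chain_cmp h (chain_cmp g f) = chain_cmp (chain_cmp h g) f.
Proof. by apply: chain_mapP => n /=; rewrite pcmpA. Qed.

Fact chain_cmp1m (M N : complex) (f : chain_map M N) :
  chain_cmp (chain_id N) f = f.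
Proof. by apply: chain_mapP => n /=; rewrite pcmp1m. Qed.

Fact chain_cmpm1 (M N : complex) (f : chain_map M N) :
  chain_cmp f (chain_id M) = f.
Proof. by apply: chain_mapP => n /=; rewrite pcmpm1. Qed.

Definition Kom : category := Category chain_cmpA chain_cmp1m chain_cmpm1.

Definition null_homotopy (M N : complex) (f : forall n, pmor (M n) (N n))
    (s : forall n, pmor (M n) (N n.+1)) : Prop :=
  f 0%N = pcmp (cd N 0) (s 0%N) /\
  forall n, f n.+1 = pcmp (cd N n.+1) (s n.+1) + pcmp (s n) (cd M n).

Definition null_homotopic (M N : complex) (f : forall n, pmor (M n) (N n)) :=
  exists s, null_homotopy f s.

Definition homotopic (M N : complex) (f g : chain_map M N) : Prop :=
  null_homotopic (fun n => f n - g n).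

Definition contractible (M : complex) : Prop :=
  null_homotopic (fun n => pidm (M n)).

Fact homotopic_equiv (M N : complex) : is_equiv (@homotopic M N).
Proof.
split.
- move=> f; exists (fun=> 0); split=> [|n].
    by rewrite subrr pcmp0r.
  by rewrite subrr pcmp0r pcmp0l addr0.
- move=> f g [s [s0 sS]]; exists (fun n => - s n); split=> [|n].
    by rewrite -opprB s0 pcmpNr.
  by rewrite -opprB sS pcmpNr pcmpNl opprD.
- move=> f g h [s [s0 sS]] [t [t0 tS]]; exists (fun n => s n + t n).
  split=> [|n].
    by rewrite pcmpDr -s0 -t0 addrA subrK.
  by rewrite pcmpDr pcmpDl addrACA -sS -tS addrA subrK.
Qed.

Fact homotopic_cmp (M N P : complex) (g g' : chain_map N P)
    (f f' : chain_map M N) :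
  homotopic g g' -> homotopic f f' ->
  homotopic (chain_cmp g f) (chain_cmp g' f').
Proof.
move=> [t [t0 tS]] [s [s0 sS]].
exists (fun n => pcmp (t n) (f n) + pcmp (g' n.+1) (s n)).
have gf n : pcmp (g n) (f n) - pcmp (g' n) (f' n) =
    pcmp (g n - g' n) (f n) + pcmp (g' n) (f n - f' n).
  by rewrite pcmpBl pcmpBr addrA subrK.
split=> [|n] /=; rewrite gf.
  by rewrite t0 s0 pcmpDr !pcmpA cmd.
rewrite tS sS !(pcmpDl, pcmpDr) !pcmpA cmd addrACA; congr (_ + _).
by rewrite -[pcmp (pcmp (t n) (f n)) _]pcmpA cmd pcmpA.
Qed.

Definition homotopy_congr : congruence Kom :=
  @Congruence Kom homotopic homotopic_equiv homotopic_cmp.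

Definition homotopy_cat : category := quot_cat homotopy_congr.

End PreadditiveTheory.
Arguments Kom A : clear implicits.
Arguments homotopy_cat A : clear implicits.

Section KomFunctor.
Variables (A B : preadditive) (F : additive_functor A B).

Fact Kom_ob_subproof (M : complex A) n :
  pcmp (afmor F (cd M n)) (afmor F (cd M n.+1)) = 0.
Proof. by rewrite -afmorM cdd afmor0. Qed.

Definition Kom_ob (M : complex A) : complex B :=
  @Complex B (fun n => F (M n)) (fun n => afmor F (cd M n)) (Kom_ob_subproof M).

Fact Kom_map_subproof (M N : complex A) (f : chain_map M N) n :
  pcmp (afmor F (f n)) (cd (Kom_ob M) n) =
  pcmp (cd (Kom_ob N) n) (afmor F (f n.+1)).
Proof. by rewrite /= -!afmorM cmd. Qed.

Definition Kom_map (M N : complex A) (f : chain_map M N) :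
    chain_map (Kom_ob M) (Kom_ob N) :=
  @ChainMap B (Kom_ob M) (Kom_ob N) (fun n => afmor F (f n))
    (Kom_map_subproof f).

Fact Kom_map1 (M : complex A) : Kom_map (chain_id M) = chain_id (Kom_ob M).
Proof. by apply: chain_mapP => n /=; rewrite afmor1. Qed.

Fact Kom_mapM (M N P : complex A) (g : chain_map N P) (f : chain_map M N) :
  Kom_map (chain_cmp g f) = chain_cmp (Kom_map g) (Kom_map f).
Proof. by apply: chain_mapP => n /=; rewrite afmorM. Qed.

Definition Kom_functor : functor (Kom A) (Kom B) :=
  @Functor (Kom A) (Kom B) Kom_ob Kom_map Kom_map1 Kom_mapM.

Fact Kom_map_homotopic (M N : complex A) (f g : chain_map M N) :
  homotopic f g -> homotopic (Kom_map f) (Kom_map g).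
Proof.
move=> [s [s0 sS]]; exists (fun n => afmor F (s n)).
by split=> [|n] /=; rewrite -afmorB ?s0 ?sS ?afmorD !afmorM.
Qed.

Definition homotopy_functor : functor (homotopy_cat A) (homotopy_cat B) :=
  @quot_functor _ _ (homotopy_congr A) (homotopy_congr B) Kom_functor
    Kom_map_homotopic.

End KomFunctor.

Section LinearMaps.
Variable k : comPzRingType.

Section MkLinear.
Variables (U V : lmodType k) (f : U -> V) (Hf : linear f).
Definition mklinear : {linear U -> V} :=
  HB.pack f (GRing.isLinear.Build k U V *:%R f Hf).
End MkLinear.

Lemma linearP_eq (U V : lmodType k) (f g : {linear U -> V}) : f =1 g -> f = g.
Proof.
case: f g => f [[fm] [fs]] [g [[gm] [gs]]] /= fg.
have {}fg : f = g by apply: functional_extensionality_dep.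
case: _ / fg gm gs => gm gs.
by rewrite (Prop_irrelevance fm gm) (Prop_irrelevance fs gs).
Qed.

Section Operations.
Variables U V W : lmodType k.

Fact lin0_subproof : linear (fun _ : U => 0 : V).
Proof. by move=> a x y; rewrite scaler0 addr0. Qed.
Definition lin0 := mklinear lin0_subproof.

Fact linD_subproof (f g : {linear U -> V}) : linear (fun x => f x + g x).
Proof. by move=> a x y; rewrite !linearP scalerDr addrACA. Qed.
Definition linD f g := mklinear (linD_subproof f g).

Fact linN_subproof (f : {linear U -> V}) : linear (fun x => - f x).
Proof. by move=> a x y; rewrite linearP opprD scalerN. Qed.
Definition linN f := mklinear (linN_subproof f).

Fact lin1_subproof : linear (fun x : U => x).
Proof. by []. Qed.
Definition lin1 := mklinear lin1_subproof.

Fact linM_subproof (g : {linear V -> W}) (f : {linear U -> V}) :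
  linear (fun x => g (f x)).
Proof. by move=> a x y; rewrite !linearP. Qed.
Definition linM g f := mklinear (linM_subproof g f).

End Operations.
End LinearMaps.
Arguments lin0 {k U V}.
Arguments lin1 {k} U.

Definition kmod_mor (k : comPzRingType) (U V : lmodType k) : Type :=
  {linear U -> V}.

Section KModMor.
Variables (k : comPzRingType) (U V : lmodType k).
Notation mor := (kmod_mor U V).

HB.instance Definition _ := gen_eqMixin mor.
HB.instance Definition _ := gen_choiceMixin mor.

Fact kmod_addA : associative (@linD k U V : mor -> mor -> mor).
Proof. by move=> f g h; apply: linearP_eq => x /=; rewrite addrA. Qed.
Fact kmod_addC : commutative (@linD k U V : mor -> mor -> mor).
Proof. by move=> f g; apply: linearP_eq => x /=; rewrite addrC. Qed.
Fact kmod_add0 : left_id (lin0 : mor) (@linD k U V : mor -> mor -> mor).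
Proof. by move=> f; apply: linearP_eq => x /=; rewrite add0r. Qed.
Fact kmod_addN : left_inverse (lin0 : mor) (@linN k U V : mor -> mor)
  (@linD k U V : mor -> mor -> mor).
Proof. by move=> f; apply: linearP_eq => x /=; rewrite addNr. Qed.

HB.instance Definition _ :=
  GRing.isZmodule.Build mor kmod_addA kmod_addC kmod_add0 kmod_addN.

End KModMor.

Definition kmod (k : comPzRingType) : preadditive.
Proof.
unshelve refine (@Preadditive (lmodType k) (fun U V => kmod_mor U V) (@lin1 k)
  (fun U V W (g : kmod_mor V W) (f : kmod_mor U V) => linM g f) _ _ _ _ _) => *;
  apply: linearP_eq => x //=.
exact: linearD.
Defined.

Section MappingCone.
Variables (k : comPzRingType) (M N : complex (kmod k)) (f : chain_map M N).

Definition cone_ob (n : nat) : lmodType k :=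
  match n with
  | 0 => N 0
  | m.+1 => (N m.+1 * M m)%type : lmodType k
  end.

Definition cone_d_fun (n : nat) : cone_ob n.+1 -> cone_ob n :=
  match n with
  | 0 => fun z => (cd N 0 : {linear _ -> _}) z.1 + (f 0 : {linear _ -> _}) z.2
  | m.+1 => fun z =>
      ((cd N m.+1 : {linear _ -> _}) z.1 + (f m.+1 : {linear _ -> _}) z.2,
       - (cd M m : {linear _ -> _}) z.2)
  end.

Fact cone_d_subproof n : linear (@cone_d_fun n).
Proof.
case: n => [|n] a x y /=; first by rewrite !linearP scalerDr addrACA.
by congr pair => /=; rewrite !linearP ?scalerDr ?scalerN ?opprD // addrACA.
Qed.

Definition cone_d n : kmod_mor (cone_ob n.+1) (cone_ob n) :=
  mklinear (@cone_d_subproof n).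

Fact cone_dd n : pcmp (cone_d n : pmor (_ : kmod k) _) (cone_d n.+1) = 0.
Proof.
apply: linearP_eq => -[x y].
have dd (K : complex (kmod k)) m z :
    (cd K m : {linear _ -> _}) ((cd K m.+1 : {linear _ -> _}) z) = 0.
  by have /(congr1 (fun h : kmod_mor _ _ => (h : {linear _ -> _}) z)) := cdd K m.
have fd m z : (f m : {linear _ -> _}) ((cd M m : {linear _ -> _}) z) =
    (cd N m : {linear _ -> _}) ((f m.+1 : {linear _ -> _}) z).
  by have /(congr1 (fun h : kmod_mor _ _ => (h : {linear _ -> _}) z)) := cmd f m.
case: n x y => [|n] x y /=.
  by rewrite linearD linearN dd fd add0r subrr.
by rewrite linearD !linearN fd !dd add0r subrr /= !oppr0.
Qed.

Definition cone : complex (kmod k) := Complex cone_dd.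

End MappingCone.

(* The library's algType requires 1 != 0; a k-algebra here is a ring, possibly
   zero, with a ring morphism from k to its center. *)
Record kalgebra (k : comPzRingType) := KAlgebra {
  kring :> pzRingType;
  kscal : {rmorphism k -> kring};
  kscalC : forall c x, kscal c * x = x * kscal c
}.
Arguments kscal {k} _.

Record bimodule (k : comPzRingType) (B : kalgebra k) := Bimodule {
  bmod :> lmodType k;
  lact : B -> bmod -> bmod;
  ract : bmod -> B -> bmod;
  lactDl : forall a b m, lact (a + b) m = lact a m + lact b m;
  lactDr : forall a m n, lact a (m + n) = lact a m + lact a n;
  lact1 : forall m, lact 1 m = m;
  lactA : forall a b m, lact a (lact b m) = lact (a * b) m;
  ractDl : forall m n a, ract (m + n) a = ract m a + ract n a;
  ractDr : forall m a b, ract m (a + b) = ract m a + ract m b;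
  ract1 : forall m, ract m 1 = m;
  ractA : forall m a b, ract (ract m a) b = ract m (a * b);
  lractA : forall a m b, ract (lact a m) b = lact a (ract m b);
  lact_sym : forall c m, lact (kscal B c) m = c *: m;
  ract_sym : forall c m, ract m (kscal B c) = c *: m
}.
Arguments lact {k B b} a m : rename.
Arguments ract {k B b} m a : rename.

Record bimod_mor (k : comPzRingType) (B : kalgebra k) (M N : bimodule B) :=
  BimodMor {
    bmor :> {linear M -> N};
    bmorl : forall a m, bmor (lact a m) = lact a (bmor m);
    bmorr : forall m a, bmor (ract m a) = ract (bmor m) a
  }.

Section BimoduleCategory.
Variables (k : comPzRingType) (B : kalgebra k).

Lemma bimod_morP (M N : bimodule B) (f g : bimod_mor M N) : f =1 g -> f = g.
Proof.
case: f g => f fl fr [g gl gr] /= fg; have {}fg := linearP_eq fg.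
case: _ / fg gl gr => gl gr.
by rewrite (Prop_irrelevance fl gl) (Prop_irrelevance fr gr).
Qed.

Section Act.
Variable M : bimodule B.
Lemma lact0 (m : M) : lact 0 m = 0.
Proof. by apply: (addrI (lact 0 m)); rewrite -lactDl !addr0. Qed.
Lemma lactr0 (a : B) : lact a (0 : M) = 0.
Proof. by apply: (addrI (lact a 0)); rewrite -lactDr !addr0. Qed.
Lemma ract0 (a : B) : ract (0 : M) a = 0.
Proof. by apply: (addrI (ract 0 a)); rewrite -ractDl !addr0. Qed.
Lemma ractr0 (m : M) : ract m 0 = 0.
Proof. by apply: (addrI (ract m 0)); rewrite -ractDr !addr0. Qed.
Lemma lactN (a : B) (m : M) : lact a (- m) = - lact a m.
Proof. by apply: (addrI (lact a m)); rewrite -lactDr !subrr lactr0. Qed.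
Lemma ractN (m : M) (a : B) : ract (- m) a = - ract m a.
Proof. by apply: (addrI (ract m a)); rewrite -ractDl !subrr ract0. Qed.
End Act.

Section Mor.
Variables M N : bimodule B.

Definition bimod_mor0 : bimod_mor M N.
Proof. by exists lin0 => *; rewrite /= ?lactr0 ?ract0. Defined.

Definition bimod_morD (f g : bimod_mor M N) : bimod_mor M N.
Proof.
by exists (linD f g) => * /=; rewrite ?(bmorl, bmorr) ?lactDr ?ractDl.
Defined.

Definition bimod_morN (f : bimod_mor M N) : bimod_mor M N.
Proof. by exists (linN f) => * /=; rewrite ?(bmorl, bmorr) ?lactN ?ractN. Defined.

HB.instance Definition _ := gen_eqMixin (bimod_mor M N).
HB.instance Definition _ := gen_choiceMixin (bimod_mor M N).

Fact bimod_addA : associative bimod_morD.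
Proof. by move=> f g h; apply: bimod_morP => x /=; rewrite addrA. Qed.
Fact bimod_addC : commutative bimod_morD.
Proof. by move=> f g; apply: bimod_morP => x /=; rewrite addrC. Qed.
Fact bimod_add0 : left_id bimod_mor0 bimod_morD.
Proof. by move=> f; apply: bimod_morP => x /=; rewrite add0r. Qed.
Fact bimod_addN : left_inverse bimod_mor0 bimod_morN bimod_morD.
Proof. by move=> f; apply: bimod_morP => x /=; rewrite addNr. Qed.

HB.instance Definition _ := GRing.isZmodule.Build (bimod_mor M N)
  bimod_addA bimod_addC bimod_add0 bimod_addN.

End Mor.

Definition bimod_id (M : bimodule B) : bimod_mor M M.
Proof. by exists (lin1 M). Defined.

Definition bimod_cmp (M N P : bimodule B) (g : bimod_mor N P)
  (f : bimod_mor M N) : bimod_mor M P.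
Proof. by exists (linM g f) => * /=; rewrite ?(bmorl, bmorr). Defined.

Definition bimod : preadditive.
Proof.
apply: (@Preadditive (bimodule B) (fun M N => bimod_mor M N) bimod_id
  bimod_cmp) => *; apply: bimod_morP => x //=.
exact: linearD.
Defined.

Definition bimod_forget : additive_functor bimod (kmod k).
Proof.
by apply: (@AdditiveFunctor bimod (kmod k) (fun M : bimodule B => M : lmodType k)
  (fun M N (f : bimod_mor M N) => (f : {linear M -> N}) : kmod_mor M N))
  => *; apply: linearP_eq.
Defined.

End BimoduleCategory.
Arguments bimod {k} B.
Arguments bimod_forget {k} B.

Record presheaf (k : comPzRingType) (d : Order.disp_t) (C : porderType d) :=
  Presheaf {
    psh :> C -> kalgebra k;
    phi : forall i j : C, (i <= j)%O -> {rmorphism psh j -> psh i};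
    phi_kscal : forall i j (ij : (i <= j)%O) c,
      phi ij (kscal (psh j) c) = kscal (psh i) c;
    phi_id : forall i (ii : (i <= i)%O) x, phi ii x = x;
    phi_cmp : forall h i j (hi : (h <= i)%O) (ij : (i <= j)%O) (hj : (h <= j)%O) x,
      phi hi (phi ij x) = phi hj x
  }.
Arguments phi {k d C} p {i j}.

Section PresheafBimodules.
Variables (k : comPzRingType) (d : Order.disp_t) (C : porderType d).
Variable A : presheaf k C.

(* The maps pbT are k-linear by lact_sym, pbTl and phi_kscal. *)
Record pbimodule := PBimodule {
  pbob :> forall i : C, bimodule (A i);
  pbT : forall i j : C, (i <= j)%O -> pbob j -> pbob i;
  pbTD : forall i j (ij : (i <= j)%O) m n, pbT ij (m + n) = pbT ij m + pbT ij n;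
  pbTl : forall i j (ij : (i <= j)%O) a m,
    pbT ij (lact a m) = lact (phi A ij a) (pbT ij m);
  pbTr : forall i j (ij : (i <= j)%O) m a,
    pbT ij (ract m a) = ract (pbT ij m) (phi A ij a);
  pbT_id : forall i (ii : (i <= i)%O) m, pbT ii m = m;
  pbT_cmp : forall h i j (hi : (h <= i)%O) (ij : (i <= j)%O) (hj : (h <= j)%O) m,
    pbT hi (pbT ij m) = pbT hj m
}.
Arguments pbT p {i j}.

Record pbimod_mor (M N : pbimodule) := PBimodMor {
  pbmor :> forall i : C, bimod_mor (M i) (N i);
  pbmorT : forall i j (ij : (i <= j)%O) m,
    pbmor i (pbT M ij m) = pbT N ij (pbmor j m)
}.

Lemma pbimod_morP (M N : pbimodule) (f g : pbimod_mor M N) :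
  (forall i, f i =1 g i) -> f = g.
Proof.
case: f g => f fT [g gT] /= fg.
have {}fg : f = g.
  by apply: functional_extensionality_dep => i; apply: bimod_morP; exact: fg.
by case: _ / fg gT => gT; rewrite (Prop_irrelevance fT gT).
Qed.

Lemma pbT0 (M : pbimodule) i j (ij : (i <= j)%O) : pbT M ij 0 = 0.
Proof. by apply: (addrI (pbT M ij 0)); rewrite -pbTD !addr0. Qed.
Lemma pbTN (M : pbimodule) i j (ij : (i <= j)%O) m : pbT M ij (- m) = - pbT M ij m.
Proof. by apply: (addrI (pbT M ij m)); rewrite -pbTD !subrr pbT0. Qed.

Section Mor.
Variables M N : pbimodule.

Definition pbimod_mor0 : pbimod_mor M N.
Proof. exists (fun i => bimod_mor0 (M i) (N i)) => * /=. by rewrite pbT0. Defined.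

Definition pbimod_morD (f g : pbimod_mor M N) : pbimod_mor M N.
Proof. by exists (fun i => bimod_morD (f i) (g i)) => * /=; rewrite !pbmorT pbTD. Defined.

Definition pbimod_morN (f : pbimod_mor M N) : pbimod_mor M N.
Proof. by exists (fun i => bimod_morN (f i)) => * /=; rewrite pbmorT pbTN. Defined.

HB.instance Definition _ := gen_eqMixin (pbimod_mor M N).
HB.instance Definition _ := gen_choiceMixin (pbimod_mor M N).

Fact pbimod_addA : associative pbimod_morD.
Proof. by move=> f g h; apply: pbimod_morP => i x /=; rewrite addrA. Qed.
Fact pbimod_addC : commutative pbimod_morD.
Proof. by move=> f g; apply: pbimod_morP => i x /=; rewrite addrC. Qed.
Fact pbimod_add0 : left_id pbimod_mor0 pbimod_morD.
Proof. by move=> f; apply: pbimod_morP => i x /=; rewrite add0r. Qed.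
Fact pbimod_addN : left_inverse pbimod_mor0 pbimod_morN pbimod_morD.
Proof. by move=> f; apply: pbimod_morP => i x /=; rewrite addNr. Qed.

HB.instance Definition _ := GRing.isZmodule.Build (pbimod_mor M N)
  pbimod_addA pbimod_addC pbimod_add0 pbimod_addN.

End Mor.

Definition pbimod_id (M : pbimodule) : pbimod_mor M M.
Proof. by exists (fun i => bimod_id (M i)). Defined.

Definition pbimod_cmp (M N P : pbimodule) (g : pbimod_mor N P)
  (f : pbimod_mor M N) : pbimod_mor M P.
Proof.
by exists (fun i => bimod_cmp (g i) (f i)) => * /=; rewrite !pbmorT.
Defined.

Definition pbimod : preadditive.
Proof.
apply: (@Preadditive pbimodule (fun M N => pbimod_mor M N) pbimod_id
  pbimod_cmp) => *; apply: pbimod_morP => i x //=.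
exact: linearD.
Defined.

Definition pbimod_at (i : C) : additive_functor pbimod (kmod k).
Proof.
by apply: (@AdditiveFunctor pbimod (kmod k)
  (fun M : pbimodule => M i : lmodType k)
  (fun M N (f : pbimod_mor M N) => (f i : {linear M i -> N i}) : kmod_mor _ _))
  => *; apply: linearP_eq.
Defined.

End PresheafBimodules.
Arguments pbT {k d C A} p {i j}.
Arguments pbimod {k d C} A.
Arguments pbimod_at {k d C} A i.

Section RowFiniteMatrices.
Variables (d : Order.disp_t) (C : porderType d).

Record rfmat (V : C -> zmodType) := RFMat {
  rfm :> forall i : C, C -> V i;
  rfm_upper : forall i j, ~~ (i <= j)%O -> rfm i j = 0;
  rfm_finite : forall i, finite_set [set j | rfm i j != 0]%classic
}.

Lemma rfmatP (V : C -> zmodType) (m n : rfmat V) :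
  (forall i j, m i j = n i j) -> m = n.
Proof.
case: m n => m mu mf [n nu nf] /= mn.
have {}mn : m = n.
  by do 2![apply: functional_extensionality_dep => ?]; apply: mn.
case: _ / mn nu nf => nu nf.
by rewrite (Prop_irrelevance mu nu) (Prop_irrelevance mf nf).
Qed.

Section Zmodule.
Variable V : C -> zmodType.

Definition rf0 : rfmat V.
Proof.
exists (fun _ _ => 0) => // i.
by apply: (@sub_finite_set _ _ set0) => // j /=; rewrite eqxx.
Defined.

Definition rfN (m : rfmat V) : rfmat V.
Proof.
exists (fun i j => - m i j) => [i j ij|i]; first by rewrite rfm_upper ?oppr0.
by apply: sub_finite_set (rfm_finite m i) => j /=; rewrite oppr_eq0.
Defined.

Definition rfD (m n : rfmat V) : rfmat V.
Proof.
exists (fun i j => m i j + n i j) => [i j ij|i].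
  by rewrite !rfm_upper ?addr0.
apply: (@sub_finite_set _ _
    ([set j | m i j != 0] `|` [set j | n i j != 0])%classic).
  move=> j /=; case: (eqVneq (m i j) 0) => [->|]; last by left.
  by rewrite add0r; right.
by rewrite finite_setU; split; apply: rfm_finite.
Defined.

HB.instance Definition _ := gen_eqMixin (rfmat V).
HB.instance Definition _ := gen_choiceMixin (rfmat V).

Fact rfDA : associative rfD.
Proof. by move=> x y z; apply: rfmatP => i j /=; rewrite addrA. Qed.
Fact rfDC : commutative rfD.
Proof. by move=> x y; apply: rfmatP => i j /=; rewrite addrC. Qed.
Fact rf0D : left_id rf0 rfD.
Proof. by move=> x; apply: rfmatP => i j /=; rewrite add0r. Qed.
Fact rfND : left_inverse rf0 rfN rfD.
Proof. by move=> x; apply: rfmatP => i j /=; rewrite addNr. Qed.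

HB.instance Definition _ := GRing.isZmodule.Build (rfmat V) rfDA rfDC rf0D rfND.

Definition rf_diag (x : forall i, V i) : rfmat V.
Proof.
exists (fun i j => if i == j then x i else 0) => [i j|i].
  by case: (i =P j) => [<-|//]; rewrite lexx.
apply: sub_finite_set (finite_set1 i) => j /=.
by case: (i =P j) => [<-|_] //; rewrite eqxx.
Defined.

Lemma rf_supp (m : rfmat V) i :
  exists2 s : seq C, uniq s & forall j, j \notin s -> m i j = 0.
Proof.
have /finite_seqP[s sE] := rfm_finite m i.
exists (undup s); first exact: undup_uniq.
move=> j; rewrite mem_undup; apply: contraNeq => mij.
by have : ([set` s] j)%classic by rewrite -sE.
Qed.

End Zmodule.

Record abpresheaf := AbPresheaf {
  abob :> C -> zmodType;
  abT : forall i j : C, (i <= j)%O -> abob j -> abob i;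
  abTD : forall i j (ij : (i <= j)%O) x y, abT ij (x + y) = abT ij x + abT ij y;
  abT_id : forall i (ii : (i <= i)%O) x, abT ii x = x;
  abT_cmp : forall h i j (hi : (h <= i)%O) (ij : (i <= j)%O) (hj : (h <= j)%O) x,
    abT hi (abT ij x) = abT hj x
}.

Arguments abT _ {i j}.

Definition extend0 (G : zmodType) (b : bool) : (b -> G) -> G :=
  if b return (b -> G) -> G then fun f => f isT else fun=> 0.

(* The structure map for i <= j, and 0 for other pairs. *)
Definition ext_map (V : abpresheaf) (i j : C) (x : V j) : V i :=
  extend0 (fun ij : (i <= j)%O => abT V ij x).

Lemma ext_mapE (V : abpresheaf) i j (ij : (i <= j)%O) (x : V j) :
  ext_map i x = abT V ij x.
Proof.
rewrite /ext_map; set f := fun _ => _; rewrite -[RHS]/(f ij).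
by case: (i <= j)%O f ij => // f ij; rewrite (bool_irrelevance ij isT).
Qed.

Lemma abT0 (V : abpresheaf) i j (ij : (i <= j)%O) : abT V ij 0 = 0.
Proof. by apply: (addrI (abT V ij 0)); rewrite -abTD !addr0. Qed.

Lemma ext_mapN (V : abpresheaf) i j (x : V j) : ~~ (i <= j)%O -> ext_map i x = 0.
Proof. by rewrite /ext_map; set f := fun _ => _; case: (i <= j)%O f. Qed.

Lemma ext_mapD (V : abpresheaf) i j (x y : V j) :
  ext_map i (x + y) = ext_map i x + ext_map i y.
Proof.
case: (boolP (i <= j)%O) => ij; first by rewrite !ext_mapE abTD.
by rewrite !ext_mapN ?addr0.
Qed.

Lemma ext_map0 (V : abpresheaf) i j : ext_map i (0 : V j) = 0.
Proof. by apply: (addrI (@ext_map V i j 0)); rewrite -ext_mapD !addr0. Qed.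

Lemma ext_map_sum (V : abpresheaf) i j (I : Type) (s : seq I) (F : I -> V j) :
  ext_map i (\sum_(x <- s) F x) = \sum_(x <- s) ext_map i (F x).
Proof.
exact: (big_morph (@ext_map V i j) (@ext_mapD V i j) (ext_map0 V i j)).
Qed.

Definition biadditive (U V W : zmodType) (f : U -> V -> W) : Prop :=
  (forall x x' y, f (x + x') y = f x y + f x' y) /\
  (forall x y y', f x (y + y') = f x y + f x y').

Lemma biadd0l (U V W : zmodType) (f : U -> V -> W) y : biadditive f -> f 0 y = 0.
Proof. by case=> fl _; apply: (addrI (f 0 y)); rewrite -fl !addr0. Qed.

Lemma biadd0r (U V W : zmodType) (f : U -> V -> W) x : biadditive f -> f x 0 = 0.
Proof. by case=> _ fr; apply: (addrI (f x 0)); rewrite -fr !addr0. Qed.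

Section Product.
Variables (U : C -> zmodType) (V : abpresheaf) (W : C -> zmodType).
Variable mu : forall i, U i -> V i -> W i.
Hypothesis muD : forall i, biadditive (@mu i).

(* (u^h phi^{hi}) (v^i phi^{ij}) = mu u^h (T^{hi} v^i) phi^{hj} *)
Definition rf_mul_fun (u : rfmat U) (v : rfmat V) (h j : C) : W h :=
  \sum_(i \in [set: C]) mu (u h i) (ext_map h (v i j)).

Implicit Types (u : rfmat U) (v : rfmat V).

Lemma rf_mul_funE u v h j (s : seq C) : uniq s ->
  (forall i, i \notin s -> u h i = 0) ->
  rf_mul_fun u v h j = \sum_(i <- s) mu (u h i) (ext_map h (v i j)).
Proof.
move=> us u0; rewrite /rf_mul_fun (fsbigE s) //; last first.
  by move=> i _ /u0 ->; apply: biadd0l.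
by apply: eq_bigl => i; rewrite in_setT.
Qed.

Definition rf_mul (u : rfmat U) (v : rfmat V) : rfmat W.
Proof.
exists (rf_mul_fun u v) => [h j hj|h].
  apply: fsbig1 => i _; case: (boolP (h <= i)%O) => hi.
    have ij : ~~ (i <= j)%O by apply: contra hj; apply: le_trans.
    by rewrite (rfm_upper v ij) ext_map0 (biadd0r _ (muD h)).
  by rewrite ext_mapN // (biadd0r _ (muD h)).
have [s us u0] := rf_supp u h.
apply: (@sub_finite_set _ _ (\bigcup_(i in [set` s]) [set j | v i j != 0])%classic).
  move=> j /=; rewrite (rf_mul_funE _ _ us u0) => nz.
  have /hasP[i si vij] : has (fun i => v i j != 0) s.
    apply: contraNT nz => /hasPn vs; rewrite big_seq big1 // => i /vs.
    by rewrite negbK => /eqP ->; rewrite ext_map0 (biadd0r _ (muD h)).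
  by exists i.
by apply: bigcup_finite => // i _; apply: rfm_finite.
Defined.

Lemma rf_mulE u v h j (s : seq C) : uniq s ->
  (forall i, i \notin s -> u h i = 0) ->
  rf_mul u v h j = \sum_(i <- s) mu (u h i) (ext_map h (v i j)).
Proof. exact: rf_mul_funE. Qed.

Lemma rf_mulDl u u' v : rf_mul (u + u') v = rf_mul u v + rf_mul u' v.
Proof.
apply: rfmatP => h j.
have [s us u0] := rf_supp u h; have [s' us' u0'] := rf_supp u' h.
pose t := undup (s ++ s'); have ut : uniq t by apply: undup_uniq.
have t0 i : i \notin t -> u h i = 0.
  by rewrite mem_undup mem_cat negb_or => /andP[/u0].
have t0' i : i \notin t -> u' h i = 0.
  by rewrite mem_undup mem_cat negb_or => /andP[_ /u0'].
have tD i : i \notin t -> (u + u') h i = 0.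
  by move=> it; rewrite [LHS](_ : _ = u h i + u' h i) // t0 // t0' // addr0.
rewrite [RHS](_ : _ = rf_mul u v h j + rf_mul u' v h j) //.
rewrite (rf_mulE v j ut tD) (rf_mulE v j ut t0) (rf_mulE v j ut t0').
by rewrite -big_split; apply: eq_bigr => i _ /=; case: (muD h) => ->.
Qed.

Lemma rf_mulDr u v v' : rf_mul u (v + v') = rf_mul u v + rf_mul u v'.
Proof.
apply: rfmatP => h j; have [s us u0] := rf_supp u h.
rewrite [RHS](_ : _ = rf_mul u v h j + rf_mul u v' h j) //.
rewrite !(rf_mulE _ j us u0).
by rewrite -big_split; apply: eq_bigr => i _ /=; case: (muD h) => _ <-; rewrite ext_mapD.
Qed.

Lemma rf_diag_mul (x : forall i, U i) v h j :
  rf_mul (rf_diag x) v h j = mu (x h) (v h j).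
Proof.
rewrite (@rf_mulE _ _ _ _ [:: h]) //=; last first.
  by move=> i; rewrite inE eq_sym => /negbTE ->.
by rewrite big_seq1 eqxx ext_mapE ?abT_id.
Qed.

Lemma rf_mul_diag u (x : forall i, V i) h j (hj : (h <= j)%O) :
  rf_mul u (rf_diag x) h j = mu (u h j) (abT V hj (x j)).
Proof.
have [s us u0] := rf_supp u h; pose t := undup (j :: s).
have ut : uniq t by apply: undup_uniq.
rewrite (@rf_mulE _ _ _ _ t) //; last first.
  by move=> i; rewrite mem_undup inE negb_or => /andP[_ /u0].
have jt : j \in t by rewrite mem_undup inE eqxx.
rewrite (bigD1_seq j) //= eqxx ext_mapE big1 ?addr0 // => i /negbTE ->.
by rewrite ext_map0 (biadd0r _ (muD h)).
Qed.

End Product.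

Section ProductAssoc.
Variables (U X Z : C -> zmodType) (V W Y : abpresheaf).
Variables (muUV : forall i, U i -> V i -> X i).
Variables (muVW : forall i, V i -> W i -> Y i).
Variables (muXW : forall i, X i -> W i -> Z i).
Variables (muUY : forall i, U i -> Y i -> Z i).
Hypothesis (UVD : forall i, biadditive (@muUV i)).
Hypothesis (VWD : forall i, biadditive (@muVW i)).
Hypothesis (XWD : forall i, biadditive (@muXW i)).
Hypothesis (UYD : forall i, biadditive (@muUY i)).
Hypothesis muA : forall i u v w, muUY u (@muVW i v w) = muXW (muUV u v) w.
Hypothesis muT : forall i j (ij : (i <= j)%O) v w,
  abT Y ij (muVW v w) = muVW (abT V ij v) (abT W ij w).

Lemma rf_mulA (u : rfmat U) (v : rfmat V) (w : rfmat W) :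
  rf_mul UYD u (rf_mul VWD v w) = rf_mul XWD (rf_mul UVD u v) w.
Proof.
apply: rfmatP => h l.
have [s us u0] := rf_supp u h.
pose r i := s2val (cid2 (rf_supp v i)).
have ur i : uniq (r i) by exact: s2valP (cid2 (rf_supp v i)).
have r0 i j : j \notin r i -> v i j = 0 by apply: s2valP' (cid2 (rf_supp v i)) j.
pose t := undup (flatten [seq r i | i <- s]).
have ut : uniq t by apply: undup_uniq.
have t0 i j : i \in s -> j \notin t -> v i j = 0.
  move=> si jt; apply: r0; apply: contra jt => ji.
  by rewrite mem_undup; apply/flatten_mapP; exists i.
have X0 j : j \notin t -> rf_mul UVD u v h j = 0.
  move=> jt; rewrite (rf_mulE UVD v j us u0) big_seq big1 // => i si.
  by rewrite (t0 _ _ si jt) ext_map0 (biadd0r _ (UVD h)).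
rewrite (rf_mulE UYD _ l us u0) (rf_mulE XWD w l ut X0).
transitivity (\sum_(i <- s) \sum_(j <- t)
    muUY (u h i) (ext_map h (muVW (v i j) (ext_map i (w j l))))).
  rewrite big_seq [RHS]big_seq; apply: eq_bigr => i si.
  rewrite (rf_mulE VWD w l ut (fun j => t0 i j si)) ext_map_sum.
  apply: (big_morph (muUY (u h i))); first exact: (proj2 (UYD h)).
  exact: biadd0r (UYD h).
rewrite exchange_big; apply: eq_bigr => j _.
rewrite (rf_mulE UVD v j us u0).
rewrite (big_morph (fun x => muXW x (ext_map h (w j l)))
  (fun x y => proj1 (XWD h) x y _) (biadd0l _ (XWD h))).
apply: eq_bigr => i _; rewrite -muA; congr muUY.
case: (boolP (h <= i)%O) => hi; last by rewrite !(ext_mapN _ hi) (biadd0l _ (VWD h)).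
case: (boolP (i <= j)%O) => ij; last first.
  by rewrite rfm_upper // ext_map0 (biadd0l _ (VWD i)) ext_map0 (biadd0l _ (VWD h)).
rewrite !(ext_mapE hi) muT ext_mapE (ext_mapE (le_trans hi ij)).
by rewrite (abT_cmp _ _ (le_trans hi ij)).
Qed.

End ProductAssoc.

End RowFiniteMatrices.

Section Shriek.
Variables (k : comPzRingType) (d : Order.disp_t) (C : porderType d).
Variable A : presheaf k C.

Definition ps_ab : abpresheaf C :=
  @AbPresheaf _ C (fun i => A i : zmodType) (fun i j ij => phi A ij)
    (fun i j ij => rmorphD (phi A ij)) (@phi_id _ _ _ A) (@phi_cmp _ _ _ A).

Definition pb_ab (M : pbimodule A) : abpresheaf C :=
  @AbPresheaf _ C (fun i => M i : zmodType) (@pbT _ _ _ A M)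
    (@pbTD _ _ _ A M) (@pbT_id _ _ _ A M) (@pbT_cmp _ _ _ A M).

Fact mulD i : biadditive (fun a b : A i => a * b).
Proof. by split=> *; [exact: mulrDl | exact: mulrDr]. Qed.

Definition shriek_ring : Type := rfmat (fun i => A i : zmodType).
HB.instance Definition _ := GRing.Zmodule.on shriek_ring.

Definition shriek_one : shriek_ring := rf_diag (fun i : C => 1 : A i).

(* (a^h phi^{hi}) (a^i phi^{ij}) = a^h phi^{hi}(a^i) phi^{hj} *)
Definition shriek_mul : shriek_ring -> shriek_ring -> shriek_ring :=
  @rf_mul _ _ _ ps_ab _ _ mulD.

Fact shriek_mulA : associative shriek_mul.
Proof.
move=> a b c; apply: (@rf_mulA _ _ _ _ _ ps_ab ps_ab ps_ab) => *.
  exact: mulrA.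
exact: rmorphM.
Qed.

Fact shriek_mul1 : left_id shriek_one shriek_mul.
Proof. by move=> a; apply: rfmatP => h j; rewrite rf_diag_mul mul1r. Qed.

Lemma shriek_mul_diag (U : C -> zmodType) (W : C -> zmodType)
    (mu : forall i, U i -> A i -> W i) (muD : forall i, biadditive (@mu i))
    (u : rfmat U) (x : forall i, A i) h j :
  (forall hj : (h <= j)%O, phi A hj (x j) = x h) ->
  @rf_mul _ _ U ps_ab W mu muD u (rf_diag x) h j = mu h (u h j) (x h).
Proof.
move=> xh; case: (boolP (h <= j)%O) => hj.
  by rewrite (@rf_mul_diag _ _ U ps_ab W) /= xh.
by rewrite !(rfm_upper _ hj) (biadd0l _ (muD h)).
Qed.

Fact shriek_mulr1 : right_id shriek_one shriek_mul.
Proof.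
move=> a; apply: rfmatP => h j.
by rewrite shriek_mul_diag ?mulr1 // => hj; rewrite rmorph1.
Qed.

Fact shriek_mulDl : left_distributive shriek_mul +%R.
Proof. by move=> a b c; apply: rf_mulDl. Qed.

Fact shriek_mulDr : right_distributive shriek_mul +%R.
Proof. by move=> a b c; apply: rf_mulDr. Qed.

HB.instance Definition _ := GRing.Zmodule_isPzRing.Build shriek_ring
  shriek_mulA shriek_mul1 shriek_mulr1 shriek_mulDl shriek_mulDr.

Definition shriek_scal_fun (c : k) : shriek_ring :=
  rf_diag (fun i : C => kscal (A i) c).

Lemma shriek_scal_mulr (a : shriek_ring) c h j :
  (a * shriek_scal_fun c) h j = a h j * kscal (A h) c.
Proof. by rewrite shriek_mul_diag // => hj; rewrite phi_kscal. Qed.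

Fact shriek_scal_zmod : zmod_morphism shriek_scal_fun.
Proof.
move=> c e; apply: rfmatP => i j /=.
by case: (i == j); rewrite ?rmorphB ?subr0.
Qed.

Fact shriek_scal_monoid : monoid_morphism shriek_scal_fun.
Proof.
split=> [|c e]; apply: rfmatP => i j.
  by rewrite /= rmorph1.
rewrite shriek_scal_mulr /=.
by case: (i == j); rewrite ?rmorphM ?mul0r.
Qed.

Definition shriek_scal : {rmorphism k -> shriek_ring} :=
  HB.pack shriek_scal_fun
    (GRing.isZmodMorphism.Build k shriek_ring shriek_scal_fun shriek_scal_zmod)
    (GRing.isMonoidMorphism.Build k shriek_ring shriek_scal_fun
       shriek_scal_monoid).

Fact shriek_scalC c (a : shriek_ring) : shriek_scal c * a = a * shriek_scal c.
Proof.
apply: rfmatP => h j; rewrite shriek_scal_mulr.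
by rewrite [LHS]rf_diag_mul kscalC.
Qed.

Definition shriek_alg : kalgebra k := KAlgebra shriek_scalC.

Section OnObjects.
Variable M : pbimodule A.

Fact lactD i : biadditive (fun (a : A i) (m : M i) => lact a m).
Proof. by split=> *; [exact: lactDl | exact: lactDr]. Qed.
Fact ractD i : biadditive (fun (m : M i) (a : A i) => ract m a).
Proof. by split=> *; [exact: ractDl | exact: ractDr]. Qed.

Definition shriek_mod : Type := rfmat (fun i => M i : zmodType).
HB.instance Definition _ := GRing.Zmodule.on shriek_mod.

Definition shriek_scale (c : k) (m : shriek_mod) : shriek_mod.
Proof.
exists (fun i j => c *: m i j) => [i j ij|i].
  by rewrite rfm_upper ?scaler0.
apply: sub_finite_set (rfm_finite m i) => j /=.
by apply: contra => /eqP ->; rewrite scaler0.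
Defined.

Fact shriek_scaleA a b m :
  shriek_scale a (shriek_scale b m) = shriek_scale (a * b) m.
Proof. by apply: rfmatP => i j /=; rewrite scalerA. Qed.
Fact shriek_scale1 : left_id 1 shriek_scale.
Proof. by move=> m; apply: rfmatP => i j /=; rewrite scale1r. Qed.
Fact shriek_scaleDr : right_distributive shriek_scale +%R.
Proof. by move=> a m n; apply: rfmatP => i j /=; rewrite scalerDr. Qed.
Fact shriek_scaleDl m : {morph shriek_scale^~ m : a b / a + b}.
Proof. by move=> a b; apply: rfmatP => i j /=; rewrite scalerDl. Qed.

HB.instance Definition _ := GRing.Zmodule_isLmodule.Build k shriek_mod
  shriek_scaleA shriek_scale1 shriek_scaleDr shriek_scaleDl.

(* (a^h phi^{hi}) (m^i phi^{ij}) = a^h T^{hi}(m^i) phi^{hj} *)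
Definition shriek_lact : shriek_alg -> shriek_mod -> shriek_mod :=
  @rf_mul _ _ _ (pb_ab M) _ _ lactD.

(* (m^h phi^{hi}) (a^i phi^{ij}) = m^h phi^{hi}(a^i) phi^{hj} *)
Definition shriek_ract : shriek_mod -> shriek_alg -> shriek_mod :=
  @rf_mul _ _ _ ps_ab _ _ ractD.

Lemma shriek_lactE (a : shriek_ring) (m : shriek_mod) h j (s : seq C) :
  uniq s -> (forall i, i \notin s -> a h i = 0) ->
  shriek_lact a m h j =
  \sum_(i <- s) lact (a h i) (@ext_map _ _ (pb_ab M) h i (m i j)).
Proof. exact: (@rf_mul_funE _ _ _ (pb_ab M) _ _ lactD). Qed.

Lemma shriek_ractE (m : shriek_mod) (a : shriek_ring) h j (s : seq C) :
  uniq s -> (forall i, i \notin s -> m h i = 0) ->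
  shriek_ract m a h j =
  \sum_(i <- s) ract (m h i) (@ext_map _ _ ps_ab h i (a i j)).
Proof. exact: (@rf_mul_funE _ _ _ ps_ab _ _ ractD). Qed.

Definition shriek_bimodule : bimodule shriek_alg.
Proof.
apply: (@Bimodule k shriek_alg shriek_mod shriek_lact shriek_ract).
- by move=> a b m; apply: rf_mulDl.
- by move=> a m n; apply: rf_mulDr.
- by move=> m; apply: rfmatP => h j; rewrite [LHS]rf_diag_mul lact1.
- move=> a b m; apply: (@rf_mulA _ _ _ _ _ ps_ab (pb_ab M) (pb_ab M)) => *.
    exact: lactA.
  exact: pbTl.
- by move=> m n a; apply: rf_mulDl.
- by move=> m a b; apply: rf_mulDr.
- move=> m; apply: rfmatP => h j.
  by rewrite [LHS]shriek_mul_diag ?ract1 // => hj; rewrite rmorph1.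
- move=> m a b; apply/esym.
  apply: (@rf_mulA _ _ _ _ _ ps_ab ps_ab ps_ab) => *.
    by rewrite ractA.
  exact: rmorphM.
- move=> a m b; apply/esym.
  apply: (@rf_mulA _ _ _ _ _ (pb_ab M) ps_ab (pb_ab M)) => *.
    by rewrite lractA.
  exact: pbTr.
- by move=> c m; apply: rfmatP => h j; rewrite [LHS]rf_diag_mul lact_sym.
- move=> c m; apply: rfmatP => h j.
  by rewrite [LHS]shriek_mul_diag ?ract_sym // => hj; rewrite phi_kscal.
Defined.

End OnObjects.

Section OnMorphisms.
Variables (M N : pbimodule A) (f : pbimod_mor M N).

(* f!(m^i phi^{ij}) = f^i(m^i) phi^{ij} *)
Definition shriek_map_fun (m : shriek_mod M) : shriek_mod N.
Proof.
exists (fun i j => f i (m i j)) => [i j ij|i].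
  by rewrite rfm_upper ?linear0.
apply: sub_finite_set (rfm_finite m i) => j /=.
by apply: contra => /eqP ->; rewrite linear0.
Defined.

Fact shriek_map_linear : linear shriek_map_fun.
Proof. by move=> c m n; apply: rfmatP => i j /=; rewrite linearP. Qed.

Definition shriek_map : bimod_mor (shriek_bimodule M) (shriek_bimodule N).
Proof.
exists (mklinear shriek_map_linear).
- move=> a m; apply: rfmatP => h j.
  have [s us a0] := rf_supp a h.
  rewrite [RHS](shriek_lactE _ j us a0).
  rewrite -[LHS]/(f h (shriek_lact a m h j)) (shriek_lactE _ j us a0).
  rewrite raddf_sum; apply: eq_bigr => i _; rewrite [LHS](bmorl (f h)); congr lact.
  case: (boolP (h <= i)%O) => hi; last by rewrite !ext_mapN ?linear0.
  by rewrite !(ext_mapE hi) /= pbmorT.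
- move=> m a; apply: rfmatP => h j.
  have [s us m0] := rf_supp m h.
  have n0 i : i \notin s -> shriek_map_fun m h i = 0.
    by move=> /m0 /= ->; rewrite linear0.
  rewrite [RHS](shriek_ractE _ j us n0).
  rewrite -[LHS]/(f h (shriek_ract m a h j)) (shriek_ractE _ j us m0).
  by rewrite raddf_sum; apply: eq_bigr => i _; exact: (bmorr (f h)).
Defined.

End OnMorphisms.

Definition shriek : additive_functor (pbimod A) (bimod shriek_alg).
Proof.
apply: (@AdditiveFunctor (pbimod A) (bimod shriek_alg) shriek_bimodule
  shriek_map) => *; apply: bimod_morP => m; exact: rfmatP.
Defined.

End Shriek.

Section RelativeDerived.
Variable k : comPzRingType.

Definition rel_qis_bimod (B : kalgebra k) (M N : complex (bimod B))
    (f : chain_map M N) : Prop :=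
  contractible (cone (Kom_map (bimod_forget B) f)).

Definition Sigma_bimod (B : kalgebra k) : mclass (homotopy_cat (bimod B)) :=
  fun M N g => exists2 f : chain_map M N,
    rel_qis_bimod f & g = qcls (homotopy_congr _) f.

Definition Dk_bimod (B : kalgebra k) : category := localization (@Sigma_bimod B).

Variables (d : Order.disp_t) (C : porderType d) (A : presheaf k C).

Definition rel_qis_pbimod (M N : complex (pbimod A)) (f : chain_map M N) :
    Prop :=
  forall i : C, contractible (cone (Kom_map (pbimod_at A i) f)).

Definition Sigma_pbimod : mclass (homotopy_cat (pbimod A)) :=
  fun M N g => exists2 f : chain_map M N,
    rel_qis_pbimod f & g = qcls (homotopy_congr _) f.

Definition Dk_pbimod : category := localization Sigma_pbimod.

Section ShriekCone.
Variables (M N : complex (pbimod A)) (f : chain_map M N).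

Let Ki i := cone (Kom_map (pbimod_at A i) f).
Let K := cone (Kom_map (bimod_forget (shriek_alg A)) (Kom_map (shriek A) f)).

Let ev n : K n -> forall i j, Ki i n :=
  match n with
  | 0 => fun z i j => (z : shriek_mod (N 0)) i j
  | m.+1 => fun z i j =>
      ((z.1 : shriek_mod (N m.+1)) i j, (z.2 : shriek_mod (M m)) i j)
  end.

Fact ev_inj n (x y : K n) : (forall i j, ev x i j = ev y i j) -> x = y.
Proof.
case: n x y => [|n] x y xy; first exact: rfmatP.
case: x y xy => [x1 x2] [y1 y2] xy; congr pair; apply: rfmatP => i j.
  by have [] := xy i j.
by have [] := xy i j.
Qed.

Fact evD n (x y : K n) i j : ev (x + y) i j = ev x i j + ev y i j.
Proof. by case: n x y. Qed.

Fact evP n c (x y : K n) i j : ev (c *: x + y) i j = c *: ev x i j + ev y i j.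
Proof. by case: n x y. Qed.

Fact ev_d n (x : K n.+1) i j :
  ev ((cd K n : {linear _ -> _}) x) i j =
  (cd (Ki i) n : {linear _ -> _}) (ev x i j).
Proof. by case: n x => [|n] x. Qed.

Fact ev_upper n (x : K n) i j : ~~ (i <= j)%O -> ev x i j = 0.
Proof. by case: n x => [|n] x ij /=; rewrite !rfm_upper. Qed.

Fact ev_finite n (x : K n) i : finite_set [set j | ev x i j != 0]%classic.
Proof.
case: n x => [|n] x; first exact: (rfm_finite (x : shriek_mod (N 0))).
apply: (@sub_finite_set _ _
  ([set j | (x.1 : shriek_mod (N n.+1)) i j != 0] `|`
   [set j | (x.2 : shriek_mod (M n)) i j != 0])%classic).
  move=> j /=; case: (eqVneq ((x.1 : shriek_mod (N n.+1)) i j) 0) => [->|_].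
    case: (eqVneq ((x.2 : shriek_mod (M n)) i j) 0) => [->|]; last by right.
    by rewrite eqxx.
  by left.
by rewrite finite_setU; split; apply: rfm_finite.
Qed.

Fact ev_mk n (e : forall i, C -> Ki i n) :
  (forall i j, ~~ (i <= j)%O -> e i j = 0) ->
  (forall i, finite_set [set j | e i j != 0]%classic) ->
  exists x : K n, forall i j, ev x i j = e i j.
Proof.
case: n e => [|n] e eu ef.
  by exists (@RFMat _ C (fun i => N 0 i : zmodType) e eu ef : shriek_mod (N 0)).
have u1 i j : ~~ (i <= j)%O -> (e i j).1 = 0 by move=> /eu ->.
have u2 i j : ~~ (i <= j)%O -> (e i j).2 = 0 by move=> /eu ->.
have f1 i : finite_set [set j | (e i j).1 != 0]%classic.
  apply: sub_finite_set (ef i) => j /=.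
  by apply: contra => /eqP ->.
have f2 i : finite_set [set j | (e i j).2 != 0]%classic.
  apply: sub_finite_set (ef i) => j /=.
  by apply: contra => /eqP ->.
exists ((@RFMat _ C (fun i => N n.+1 i : zmodType) _ u1 f1 : shriek_mod (N n.+1)),
        (@RFMat _ C (fun i => M n i : zmodType) _ u2 f2 : shriek_mod (M n))).
by move=> i j /=; case: (e i j).
Qed.

Lemma shriek_rel_qis : rel_qis_pbimod f -> rel_qis_bimod (Kom_map (shriek A) f).
Proof.
move=> ctr.
pose s i n : {linear Ki i n -> Ki i n.+1} := projT1 (cid (ctr i)) n.
have s0 i (z : Ki i 0) : z = (cd (Ki i) 0 : {linear _ -> _}) (s i 0%N z).
  have [+ _] := projT2 (cid (ctr i)).
  by move=> /(congr1 (fun h : kmod_mor _ _ => (h : {linear _ -> _}) z)).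
have sS i n (z : Ki i n.+1) :
    z = (cd (Ki i) n.+1 : {linear _ -> _}) (s i n.+1 z)
      + s i n ((cd (Ki i) n : {linear _ -> _}) z).
  have [_ +] := projT2 (cid (ctr i)).
  by move=> /(_ n) /(congr1 (fun h : kmod_mor _ _ => (h : {linear _ -> _}) z)).
have ex n (x : K n) : exists y : K n.+1, forall i j, ev y i j = s i n (ev x i j).
  apply: ev_mk => [i j ij|i]; first by rewrite ev_upper ?linear0.
  apply: sub_finite_set (ev_finite x i) => j /=.
  by apply: contra => /eqP ->; rewrite linear0.
pose t n x := projT1 (cid (ex n x)).
have tE n x i j : ev (t n x) i j = s i n (ev x i j) := projT2 (cid (ex n x)) i j.
have tlin n : linear (t n).
  by move=> c x y; apply: ev_inj => i j; rewrite evP !tE evP linearP.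
exists (fun n => mklinear (tlin n) : kmod_mor _ _); split=> [|n].
  apply: linearP_eq => x; apply: ev_inj => i j.
  rewrite [RHS](ev_d (t 0%N x) i j) tE.
  exact: s0.
apply: linearP_eq => x; apply: ev_inj => i j.
rewrite [RHS](evD ((cd K n.+1 : {linear _ -> _}) (t n.+1 x))
  (t n ((cd K n : {linear _ -> _}) x))).
rewrite ev_d !tE ev_d.
exact: (sS i n (ev x i j)).
Qed.

End ShriekCone.

Fact shriek_Sigma (M N : homotopy_cat (pbimod A)) (g : mor M N) :
  Sigma_pbimod g -> Sigma_bimod (fmor (homotopy_functor (shriek A)) g).
Proof.
move=> [f fq ->]; exists (Kom_map (shriek A) f); first exact: shriek_rel_qis.
exact: (@qfmorE _ _ (homotopy_congr _) (homotopy_congr _) (Kom_functor (shriek A))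
  (@Kom_map_homotopic _ _ (shriek A)) M N f).
Qed.

Definition Dk_shriek : functor Dk_pbimod (Dk_bimod (shriek_alg A)) :=
  loc_functor shriek_Sigma.

End RelativeDerived.
Arguments Dk_bimod {k} B.
Arguments Dk_pbimod {k d C} A.
Arguments Dk_shriek {k d C} A.

(* Main.v *)
From HB Require Import structures.
Require Import Defs.
From mathcomp Require Import all_boot all_order all_algebra.
From mathcomp Require Import boolp classical_sets functions cardinality fsbigop.

(** Write B for the algebra A!, F for the functor ! and e_h for the diagonal
    idempotents of B.  A presheaf bimodule M is visible in F M, whose entry
    e_h (F M) e_j is M^h for every h <= j; its structure map M^i -> M^h
    is the left action of phi^{hi}, from the entry (i, i) to the entry
    (h, i), followed by the inverse of the right action of phi^{hi}, from the
    entry (h, h) to the entry (h, i).  In a complex Y of B-bimodules that is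
    only related to some F M by a zigzag, the second action has no inverse, and
    the presheaf is rebuilt as a homotopy limit.  The rectification R(Y) is, at
    h, the total complex of the cochains that send a chain i_0 <= ... <= i_n
    with i_n <= h to e_{i_0} Y e_{i_n}, truncated in degree 0 to the cocycles.
    It is a presheaf in h by restriction of cochains, and A^h acts through
    phi^{i_0 h} on the left and phi^{i_n h} on the right.  The cobar complex
    T(Y) consists of the families, indexed by h, of cochains on the chains
    below h with values in e_{i_0} Y; it is again a complex of B-bimodules.

    There are natural maps unit : M -> R(F M), eta : Y -> T(Y) and
    tau : F(R(Y)) -> T(Y), with tau o F(unit) = eta at Y = F M.  The maps unit
    and eta at F M are relative quasi-isomorphisms, because a chain below h can
    be coned off by adding h on top (cone_homotopy), which gives k-linear
    deformation retractions (sdr_contractible).  The functors R and T preserve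
    relative quasi-isomorphisms (cone_tot_contractible): a k-linear contraction
    of the cone of Y -> Y', applied chain by chain, has as commutator with the
    total differential the identity plus an operator that raises the length of
    chains; such an operator is invertible, and dividing by it contracts the
    cone of the total complexes, even after the truncation.

    Full faithfulness is then formal (loc_fully_faithful).  On the localized
    categories R F is isomorphic to the identity, so F is faithful.  Given f
    from F M to F N, put g = unit^-1 R(f) unit.  Then
    eta f = T(f) eta = T(f) tau F(unit) = tau F(R(f)) F(unit)
    = tau F(unit) F(g) = eta F(g), and eta is invertible at F N, so f = F(g).

    The statement thus follows without tensor products or projective
    resolutions.  The poset may be infinite: the differentials and the
    contraction act on one row of a matrix at a time, and the sums over
    vertices that occur, in the left action on T(Y) and in tau, run over the
    support of a single row. *)

Set Implicit Arguments.
Unset Strict Implicit.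
Unset Printing Implicit Defensive.

Import Order.TTheory GRing.Theory.
Local Open Scope ring_scope.

(** * Full faithfulness on localizations from natural maps *)

Section CompositeFunctors.
Variables C D E : category.

Fact comp_functor1 (G : functor D E) (F : functor C D) X :
  fmor G (fmor F (idm X)) = idm (G (F X)).
Proof. by rewrite !fmor1. Qed.

Fact comp_functorM (G : functor D E) (F : functor C D) X Y Z
    (g : mor Y Z) (f : mor X Y) :
  fmor G (fmor F (cmp g f)) = cmp (fmor G (fmor F g)) (fmor G (fmor F f)).
Proof. by rewrite !fmorM. Qed.

Definition comp_functor (G : functor D E) (F : functor C D) : functor C E :=
  @Functor C E (fun X => G (F X)) (fun X Y f => fmor G (fmor F f))
    (comp_functor1 G F) (@comp_functorM G F).

Definition id_functor : functor C C :=
  @Functor C C (fun X => X) (fun X Y f => f) (fun=> erefl)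
    (fun _ _ _ _ _ => erefl).

End CompositeFunctors.
Arguments id_functor C : clear implicits.

Section Localized.
Variables (C : category) (W : mclass C).

Definition locm (X Y : C) (f : mor X Y) : @mor (localization W) X Y :=
  qcls (zeq_congr W) (zfwd znil f).

Definition iso_mor (D : category) (X Y : D) (f : mor X Y) : Prop :=
  exists g : mor Y X, cmp g f = idm X /\ cmp f g = idm Y.

Lemma locm_iso (X Y : C) (f : mor X Y) : W f -> iso_mor (locm f).
Proof.
move=> w; exists (qcls (zeq_congr W) (zbwd znil f w)).
split; rewrite [LHS]qcmpE.
  by apply: (proj2 (clsP (zeq_equiv _ X X) _ _)); exact: zeq_fwdbwd.
by apply: (proj2 (clsP (zeq_equiv _ Y Y) _ _)); exact: zeq_bwdfwd.
Qed.

Lemma locmM (X Y Z : C) (g : mor Y Z) (f : mor X Y) :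
  locm (cmp g f) = cmp (locm g) (locm f).
Proof.
rewrite [RHS]qcmpE; apply/(clsP (zeq_equiv _ X Z)); apply: zeq_sym.
exact: zeq_cmp.
Qed.

End Localized.

Lemma iso_monic (D : category) (X Y Z : D) (f : mor Y Z) (g h : mor X Y) :
  iso_mor f -> cmp f g = cmp f h -> g = h.
Proof.
move=> [f' [f'f _]] /(congr1 (cmp f')).
by rewrite !cmpA f'f !cmp1m.
Qed.

Section LocalizedFunctors.
Variables (C D : category) (W : mclass C) (V : mclass D) (F : functor C D).
Hypothesis FW : forall (X Y : C) (s : mor X Y), W s -> V (fmor F s).

Lemma loc_functorE (X Y : C) (p : zigzag W X Y) :
  fmor (loc_functor FW) (qcls (zeq_congr W) p) = qcls (zeq_congr V) (zmap FW p).
Proof.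
exact: (@qfmorE (zigzag_cat W) (zigzag_cat V) (zeq_congr W) (zeq_congr V)
  (zmap_functor FW) (@zmap_eq _ _ _ _ F FW) X Y p).
Qed.

Lemma loc_functor_locm (X Y : C) (f : mor X Y) :
  fmor (loc_functor FW) (locm W f) = locm V (fmor F f).
Proof. exact: loc_functorE. Qed.

End LocalizedFunctors.

Section LocalizedNaturality.
Variables (C D : category) (W : mclass C) (V : mclass D).
Variables (F G : functor C D).
Hypothesis FW : forall (X Y : C) (s : mor X Y), W s -> V (fmor F s).
Hypothesis GW : forall (X Y : C) (s : mor X Y), W s -> V (fmor G s).
Variable t : forall X : C, mor (F X) (G X).
Hypothesis tN : forall (X Y : C) (f : mor X Y),
  cmp (t Y) (fmor F f) = cmp (fmor G f) (t X).

(** A formal inverse is natural because its inverse is, so it suffices to follow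
    a zigzag step by step. *)
Lemma loc_natural (X Y : C) (f : @mor (localization W) X Y) :
  cmp (locm V (t Y)) (fmor (loc_functor FW) f)
  = cmp (fmor (loc_functor GW) f) (locm V (t X)).
Proof.
elim/qmor_ind: f => p.
rewrite !loc_functorE.
rewrite [LHS]qcmpE [RHS]qcmpE; apply/(clsP (zeq_equiv _ _ _)).
elim: p => [|Y' Z p IH f|Y' Z p IH s w] /=.
- exact: zeq_refl.
- apply: zeq_trans (zeq_fwd (fmor G f) IH).
  apply: zeq_trans (zeq_cmp _ _ _) _.
  by rewrite tN; apply: zeq_sym; exact: zeq_cmp.
- apply: zeq_trans (zeq_bwd (GW w) IH).
  apply: zeq_trans.
    apply: zeq_sym; exact: (zeq_fwdbwd _ (GW w)).
  apply: zeq_bwd.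
  apply: zeq_trans (zeq_cmp _ _ _) _.
  rewrite -tN.
  apply: zeq_trans.
    apply: zeq_sym; exact: zeq_cmp.
  apply: zeq_fwd.
  exact: zeq_bwdfwd.
Qed.

End LocalizedNaturality.

Section LocalizedComposite.
Variables (C D E : category) (W : mclass C) (V : mclass D) (U : mclass E).
Variables (F : functor C D) (G : functor D E).
Hypothesis FW : forall (X Y : C) (s : mor X Y), W s -> V (fmor F s).
Hypothesis GV : forall (X Y : D) (s : mor X Y), V s -> U (fmor G s).
Hypothesis GFW : forall (X Y : C) (s : mor X Y), W s -> U (fmor (comp_functor G F) s).
Hypothesis IW : forall (X Y : C) (s : mor X Y), W s -> W (fmor (id_functor C) s).

Lemma loc_comp (X Y : C) (f : @mor (localization W) X Y) :
  fmor (loc_functor GFW) f = fmor (loc_functor GV) (fmor (loc_functor FW) f)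
    :> @mor (localization U) (G (F X)) (G (F Y)).
Proof.
elim/qmor_ind: f => p.
apply: etrans (loc_functorE GFW p) _.
apply/esym/(etrans (congr1 _ (loc_functorE FW p))).
apply: etrans (loc_functorE GV (zmap FW p)) _; congr qcls.
elim: p => [|Y' Z p IH f|Y' Z p IH s w] //=; rewrite IH //.
by congr zbwd; exact: Prop_irrelevance.
Qed.

Lemma loc_id (X Y : C) (f : @mor (localization W) X Y) :
  fmor (loc_functor IW) f = f.
Proof.
elim/qmor_ind: f => p; rewrite !loc_functorE; congr qcls.
elim: p => [|Y' Z p IH f|Y' Z p IH s w] //=; rewrite IH //.
by congr zbwd; exact: Prop_irrelevance.
Qed.

End LocalizedComposite.

Section FullyFaithful.
Variables (C D : category) (W : mclass C) (V : mclass D).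
Variables (F : functor C D) (P : functor D C) (T : functor D D).
Hypothesis FW : forall (X Y : C) (s : mor X Y), W s -> V (fmor F s).
Hypothesis PV : forall (X Y : D) (s : mor X Y), V s -> W (fmor P s).
Hypothesis TV : forall (X Y : D) (s : mor X Y), V s -> V (fmor T s).
Variable u : forall X : C, mor X (P (F X)).
Variable eta : forall Y : D, mor Y (T Y).
Variable tau : forall Y : D, mor (F (P Y)) (T Y).
Hypothesis uN : forall (X Y : C) (f : mor X Y),
  cmp (u Y) f = cmp (fmor P (fmor F f)) (u X).
Hypothesis etaN : forall (X Y : D) (f : mor X Y),
  cmp (eta Y) f = cmp (fmor T f) (eta X).
Hypothesis tauN : forall (X Y : D) (f : mor X Y),
  cmp (tau Y) (fmor F (fmor P f)) = cmp (fmor T f) (tau X).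
Hypothesis uW : forall X, W (u X).
Hypothesis etaV : forall X, V (eta (F X)).
Hypothesis tau_u : forall X, cmp (tau (F X)) (fmor F (u X)) = eta (F X).

(** Here P is a left inverse of F up to the natural weak equivalence u.  A
    morphism f is recovered from P f because eta f = T(f) eta, eta factors at
    F X as tau after F u, and tau carries F(P f) to T(f). *)
Lemma loc_fully_faithful (X Y : localization W) :
  bijective (fun f : mor X Y => fmor (loc_functor FW) f).
Proof.
pose LF := loc_functor FW; pose LP := loc_functor PV; pose LT := loc_functor TV.
have PFW (X' Y' : C) (s : mor X' Y') : W s -> W (fmor (comp_functor P F) s).
  by move=> w; apply/PV/FW.
have FPV (X' Y' : D) (s : mor X' Y') : V s -> V (fmor (comp_functor F P) s).
  by move=> w; apply/FW/PV.
have IC (X' Y' : C) (s : mor X' Y') : W s -> W (fmor (id_functor C) s) by [].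
have ID (X' Y' : D) (s : mor X' Y') : V s -> V (fmor (id_functor D) s) by [].
have uL (X' Y' : C) (f : @mor (localization W) X' Y') :
    cmp (locm W (u Y')) f = cmp (fmor LP (fmor LF f)) (locm W (u X')).
  have := loc_natural (F := id_functor C) (G := comp_functor P F) IC PFW uN f.
  by rewrite loc_id (loc_comp FW PV).
have etaL (X' Y' : D) (f : @mor (localization V) X' Y') :
    cmp (locm V (eta Y')) f = cmp (fmor LT f) (locm V (eta X')).
  have := loc_natural (F := id_functor D) (G := T) ID TV etaN f.
  by rewrite loc_id.
have tauL (X' Y' : D) (f : @mor (localization V) X' Y') :
    cmp (locm V (tau Y')) (fmor LF (fmor LP f)) = cmp (fmor LT f) (locm V (tau X')).
  have := loc_natural (F := comp_functor F P) (G := T) FPV TV tauN f.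
  by rewrite (loc_comp PV FW).
have uI (Z : C) : iso_mor (locm W (u Z)) by exact: locm_iso.
have eI (Z : C) : iso_mor (locm V (eta (F Z))) by exact: locm_iso.
have tuL (Z : C) : cmp (locm V (tau (F Z))) (fmor LF (locm W (u Z)))
    = locm V (eta (F Z)).
  by rewrite loc_functor_locm -locmM tau_u.
have inj : injective (fun f : mor X Y => fmor LF f).
  move=> f g fg; apply: (iso_monic (uI Y)); rewrite !uL.
  exact: (congr1 (fun h => cmp (fmor LP h) (locm W (u X))) fg).
have surj (f : mor (LF X) (LF Y)) : exists g : mor X Y, fmor LF g = f.
  have [v [vu uv]] := uI Y.
  pose g : mor X Y := cmp v (cmp (fmor LP f) (locm W (u X))).
  have ug : cmp (locm W (u Y)) g = cmp (fmor LP f) (locm W (u X)).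
    by rewrite /g cmpA uv cmp1m.
  exists g; apply: (iso_monic (eI Y)).
  rewrite [RHS]etaL -[in LHS]tuL -[LHS]cmpA -[in LHS]fmorM ug.
  by rewrite fmorM cmpA tauL -cmpA tuL.
pose inv f := projT1 (cid (surj f)).
have invK f : fmor LF (inv f) = f := projT2 (cid (surj f)).
exists inv; last exact: invK.
by move=> f; apply: inj; exact: invK.
Qed.

End FullyFaithful.

(** * Cochains on sequences and their alternating face sums *)

Section SubLmodule.
Variables (k : comPzRingType) (L : lmodType k).

(** Carved out by a predicate, so that the same big module of cochains can be cut
    down to its homogeneous and truncated parts. *)
Record subsp := Subsp {
  sp :> L -> Prop;
  sp0 : sp 0;
  spP : forall a x y, sp x -> sp y -> sp (a *: x + y)
}.

Variable S : subsp.

Lemma spD x y : S x -> S y -> S (x + y).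
Proof. by move=> Sx Sy; rewrite -[x]scale1r; apply: spP. Qed.
Lemma spZ a x : S x -> S (a *: x).
Proof. by move=> Sx; rewrite -[_ *: _]addr0; apply: spP => //; exact: sp0. Qed.
Lemma spN x : S x -> S (- x).
Proof. by rewrite -scaleN1r; exact: spZ. Qed.

Record sub_of := SubOf { sv :> L; svP : S sv }.

Lemma sub_ofP (x y : sub_of) : sv x = sv y -> x = y.
Proof.
case: x y => x Sx [y Sy] /= xy; case: _ / xy Sy => Sy.
by rewrite (Prop_irrelevance Sx Sy).
Qed.

HB.instance Definition _ := gen_eqMixin sub_of.
HB.instance Definition _ := gen_choiceMixin sub_of.

Definition sub0 := SubOf (sp0 S).
Definition subD (x y : sub_of) := SubOf (spD (svP x) (svP y)).
Definition subN (x : sub_of) := SubOf (spN (svP x)).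
Definition subZ a (x : sub_of) := SubOf (spZ a (svP x)).

Fact sub_addA : associative subD.
Proof. by move=> x y z; apply: sub_ofP; apply: addrA. Qed.
Fact sub_addC : commutative subD.
Proof. by move=> x y; apply: sub_ofP; apply: addrC. Qed.
Fact sub_add0 : left_id sub0 subD.
Proof. by move=> x; apply: sub_ofP; apply: add0r. Qed.
Fact sub_addN : left_inverse sub0 subN subD.
Proof. by move=> x; apply: sub_ofP; apply: addNr. Qed.
HB.instance Definition _ :=
  GRing.isZmodule.Build sub_of sub_addA sub_addC sub_add0 sub_addN.

Fact sub_scaleA a b x : subZ a (subZ b x) = subZ (a * b) x.
Proof. by apply: sub_ofP; apply: scalerA. Qed.
Fact sub_scale1 : left_id 1 subZ.
Proof. by move=> x; apply: sub_ofP; apply: scale1r. Qed.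
Fact sub_scaleDr : right_distributive subZ +%R.
Proof. by move=> a x y; apply: sub_ofP; apply: scalerDr. Qed.
Fact sub_scaleDl x : {morph subZ^~ x : a b / a + b}.
Proof. by move=> a b; apply: sub_ofP; apply: scalerDl. Qed.
HB.instance Definition _ := GRing.Zmodule_isLmodule.Build k sub_of
  sub_scaleA sub_scale1 sub_scaleDr sub_scaleDl.

Lemma sv_linear : linear sv.
Proof. by []. Qed.

End SubLmodule.

Section Cochains.
Variables (k : comPzRingType) (X : Type) (T : eqType) (Y : nat -> lmodType k).

(** All degrees m of the coefficient complex are kept at once, the total degree
    being imposed later as a support condition; this makes the differential an
    endomorphism of one module and avoids casts between Y (m + n) and
    Y (n + m). *)
Definition cochain : Type := forall m : nat, X -> seq T -> Y m.

Lemma cochainP (x y : cochain) : (forall m i s, x m i s = y m i s) -> x = y.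
Proof.
move=> xy; apply: functional_extensionality_dep => m.
by apply: functional_extensionality_dep => i; apply: functional_extensionality_dep => s.
Qed.

HB.instance Definition _ := gen_eqMixin cochain.
HB.instance Definition _ := gen_choiceMixin cochain.

Definition cochain0 : cochain := fun _ _ _ => 0.
Definition cochainD (x y : cochain) : cochain := fun m i s => x m i s + y m i s.
Definition cochainN (x : cochain) : cochain := fun m i s => - x m i s.
Definition cochainZ a (x : cochain) : cochain := fun m i s => a *: x m i s.

Fact cochain_addA : associative cochainD.
Proof. by move=> x y z; apply: cochainP => *; apply: addrA. Qed.
Fact cochain_addC : commutative cochainD.
Proof. by move=> x y; apply: cochainP => *; apply: addrC. Qed.
Fact cochain_add0 : left_id cochain0 cochainD.
Proof. by move=> x; apply: cochainP => *; apply: add0r. Qed.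
Fact cochain_addN : left_inverse cochain0 cochainN cochainD.
Proof. by move=> x; apply: cochainP => *; apply: addNr. Qed.
HB.instance Definition _ := GRing.isZmodule.Build cochain
  cochain_addA cochain_addC cochain_add0 cochain_addN.

Fact cochain_scaleA a b x : cochainZ a (cochainZ b x) = cochainZ (a * b) x.
Proof. by apply: cochainP => *; apply: scalerA. Qed.
Fact cochain_scale1 : left_id 1 cochainZ.
Proof. by move=> x; apply: cochainP => *; apply: scale1r. Qed.
Fact cochain_scaleDr : right_distributive cochainZ +%R.
Proof. by move=> a x y; apply: cochainP => *; apply: scalerDr. Qed.
Fact cochain_scaleDl x : {morph cochainZ^~ x : a b / a + b}.
Proof. by move=> a b; apply: cochainP => *; apply: scalerDl. Qed.
HB.instance Definition _ := GRing.Zmodule_isLmodule.Build k cochain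
  cochain_scaleA cochain_scale1 cochain_scaleDr cochain_scaleDl.

End Cochains.
Arguments cochain {k} X T Y.

Section Faces.
Variables (k : comPzRingType) (T : eqType).

(** The simplicial face sum, unfolded along the first entry of the sequence. *)
Fixpoint altsum (V : zmodType) (y : seq T -> V) (s : seq T) : V :=
  match s with
  | [::] => 0
  | i :: t => y t - altsum (fun r => y (i :: r)) t
  end.

Definition face (r s : seq T) : Prop := subseq r s /\ (size r).+1 = size s.

Lemma eq_altsum (V : zmodType) (y z : seq T -> V) s :
  (forall r, face r s -> y r = z r) -> altsum y s = altsum z s.
Proof.
elim: s y z => //= i t IH y z yz; congr (_ - _).
  by apply: yz; split=> //; exact: subseq_cons.
apply: IH => r [rt sz]; apply: yz; split=> /=; first by rewrite eqxx.
by rewrite sz.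
Qed.

Lemma altsum0 (V : zmodType) (y : seq T -> V) s :
  (forall r, face r s -> y r = 0) -> altsum y s = 0.
Proof.
move=> y0; rewrite (@eq_altsum _ y (fun=> 0)) //.
by elim: s {y0} => //= i t ->; rewrite subrr.
Qed.

Lemma altsumB (V : zmodType) (y z : seq T -> V) s :
  altsum (fun r => y r - z r) s = altsum y s - altsum z s.
Proof.
elim: s y z => [|i t IH] y z /=; first by rewrite subrr.
by rewrite IH !opprD !opprK addrACA.
Qed.

Lemma altsumP (V : lmodType k) a (y z : seq T -> V) s :
  altsum (fun r => a *: y r + z r) s = a *: altsum y s + altsum z s.
Proof.
elim: s y z => [|i t IH] y z /=; first by rewrite scaler0 addr0.
by rewrite IH scalerBr opprD addrACA.
Qed.

Lemma raddf_altsum (V U : zmodType) (f : V -> U) (y : seq T -> V) s :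
  {morph f : x z / x - z} -> f (altsum y s) = altsum (fun r => f (y r)) s.
Proof.
move=> fB; have f0 : f 0 = 0 by rewrite -(subrr 0) fB subrr.
by elim: s y => //= i t IH y; rewrite fB IH.
Qed.

(** Deleting the first entry contributes altsum y t to both terms. *)
Lemma altsum_altsum (V : zmodType) (y : seq T -> V) s : altsum (altsum y) s = 0.
Proof.
elim: s y => //= i t IH y.
by rewrite altsumB IH subr0 subrr.
Qed.

End Faces.

(** * Truncated total complexes and the perturbation of contractions *)

Notation "f @! x" := ((f : {linear _ -> _}) x) (at level 10, x at next level).

Lemma kmodE (k : comPzRingType) (U V : lmodType k) (f g : kmod_mor U V) x :
  f = g -> f @! x = g @! x.
Proof. by move=> ->. Qed.

Lemma cdcd (k : comPzRingType) (K : complex (kmod k)) m x :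
  cd K m @! (cd K m.+1 @! x) = 0.
Proof. exact: (kmodE x (cdd K m)). Qed.

Lemma cmcd (k : comPzRingType) (K K' : complex (kmod k)) (f : chain_map K K') m x :
  f m @! (cd K m @! x) = cd K' m @! (f m.+1 @! x).
Proof. exact: (kmodE x (cmd f m)). Qed.

(** Functorial coefficients on sequences: cf x s r transports a value at r to a
    value at s whenever r is a subsequence of s.  In particular cf x s s is an
    idempotent, whose image is the module of values at s; a sequence is excluded
    by letting this idempotent vanish. *)
Record coefsys (k : comPzRingType) (X : Type) (T : eqType)
    (K : complex (kmod k)) := CoefSys {
  cf : X -> seq T -> seq T -> forall m, kmod_mor (K m) (K m);
  cfM : forall x s r t m y, subseq r s -> subseq t r ->
    cf x s r m @! (cf x r t m @! y) = cf x s t m @! y;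
  cfd : forall x s r m y,
    cd K m @! (cf x s r m.+1 @! y) = cf x s r m @! (cd K m @! y)
}.

Lemma subB_subB (V : zmodType) (x y z : V) : (x - y) - (x - z) = - (y - z).
Proof. by rewrite !opprB addrC addrA subrK. Qed.

Section Totalization.
Variables (k : comPzRingType) (X : Type) (T : eqType) (K : complex (kmod k)).
Variable E : coefsys X T K.
Notation cochain := (cochain X T (fun m => K m)).
Implicit Types y z : cochain.

Definition delta y m x s : K m := altsum (fun r => cf E x s r m @! (y m x r)) s.

(** The sign in front of delta depends on the degree of the coefficients and
    makes delta anticommute with the differential of K. *)
Definition totd y : cochain :=
  fun m x s => cd K m @! (y m.+1 x s) + (-1) ^+ m *: delta y m x s.

Lemma delta_linear a y z m x s :
  delta (a *: y + z) m x s = a *: delta y m x s + delta z m x s.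
Proof.
rewrite /delta -altsumP; apply: eq_altsum => r _.
exact: (linearP (cf E x s r m : {linear _ -> _})).
Qed.

Fact totd_linear : linear totd.
Proof.
move=> a y z; apply: cochainP => m x s.
rewrite [LHS]/totd delta_linear.
rewrite [RHS](_ : _ = a *: totd y m x s + totd z m x s) // /totd.
rewrite [cd K m @! _](linearP (cd K m : {linear _ -> _})).
by rewrite !scalerDr !scalerA [_ * a]mulrC addrACA.
Qed.
HB.instance Definition _ := GRing.isLinear.Build k cochain cochain *:%R totd totd_linear.

Lemma delta_delta y m x s : delta (fun m x r => delta y m x r) m x s = 0.
Proof.
rewrite /delta -[RHS](altsum_altsum (fun t => cf E x s t m @! (y m x t)) s).
apply: eq_altsum => r [rs _].
rewrite (raddf_altsum (f := (cf E x s r m : {linear _ -> _}))); last exact: linearB.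
by apply: eq_altsum => t [tr _]; exact: cfM.
Qed.

Lemma deltaZ a y m x s :
  delta (fun m x s => a m *: y m x s) m x s = a m *: delta y m x s.
Proof.
rewrite /delta -[RHS]addr0 -[X in _ + X](@altsum0 T _ (fun=> 0) s) // -altsumP.
by apply: eq_altsum => r _; rewrite addr0; exact: linearZ.
Qed.

Lemma delta_d y m x s :
  delta (fun m x r => cd K m @! (y m.+1 x r)) m x s = cd K m @! (delta y m.+1 x s).
Proof.
rewrite /delta (raddf_altsum (f := (cd K m : {linear _ -> _}))); last exact: linearB.
by apply: eq_altsum => r _; exact/esym/cfd.
Qed.

Lemma totdd y : totd (totd y) = 0.
Proof.
apply: cochainP => m x s; rewrite [LHS]/totd.
have -> : delta (totd y) m x s
    = delta (fun m x r => cd K m @! (y m.+1 x r)) m x s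
    + delta (fun m x r => (-1) ^+ m *: delta y m x r) m x s.
  rewrite -[X in _ = X + _]scale1r -delta_linear; apply: eq_altsum => r _.
  by rewrite -[X in _ = _ @! X]/(1 *: (cd K m @! (y m.+1 x r))
    + (-1) ^+ m *: delta y m x r) scale1r.
rewrite (deltaZ (fun m => (-1) ^+ m)) delta_delta scaler0 addr0 delta_d.
rewrite linearD cdcd add0r linearZ /=.
by rewrite exprS mulN1r scaleNr addNr.
Qed.

Definition base y : Prop := forall m x s, cf E x s s m @! (y m x s) = y m x s.

Lemma base0 : base 0.
Proof. by move=> m x s; exact: linear0. Qed.

Lemma baseP a y z : base y -> base z -> base (a *: y + z).
Proof.
move=> By Bz m x s; rewrite -[RHS]/(a *: y m x s + z m x s) -[in RHS]By -[in RHS]Bz.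
exact: linearP.
Qed.
Definition base_sp : subsp cochain := Subsp base0 baseP.

Lemma base_totd y : base y -> base (totd y).
Proof.
move=> By m x s; rewrite /totd linearD linearZ -cfd By; congr (_ + _ *: _).
rewrite /delta (raddf_altsum (f := (cf E x s s m : {linear _ -> _}))); last exact: linearB.
by apply: eq_altsum => r [rs _]; apply: cfM.
Qed.

(** A chain with size s vertices has dimension size s - 1, and the total degree
    is m minus that dimension. *)
Definition graded n y : Prop :=
  forall m x s, (m.+1 != n + size s)%N -> y m x s = 0.

Lemma graded0 n : graded n 0. Proof. by []. Qed.

Lemma gradedP n a y z : graded n y -> graded n z -> graded n (a *: y + z).
Proof.
move=> gy gz m x s mn; rewrite -[LHS]/(a *: y m x s + z m x s).
by rewrite gy // gz // scaler0 addr0.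
Qed.

Lemma graded_totd n y : graded n.+1 y -> graded n (totd y).
Proof.
move=> gy m x s mn; rewrite /totd gy ?addSn ?eqSS // linear0 add0r /delta.
rewrite altsum0 ?scaler0 // => r [_ sz]; rewrite gy ?linear0 //.
by rewrite addSnnS sz.
Qed.

(** Degree n of the total complex.  Chains of positive dimension produce negative
    degrees, which are removed by keeping only the cocycles in degree 0. *)
Definition tot_pred n y : Prop := [/\ base y, graded n y & n = 0%N -> totd y = 0].

Lemma tot_pred0 n : tot_pred n 0.
Proof. by split; [exact: base0 | exact: graded0 | rewrite linear0]. Qed.

Lemma tot_predP n a y z : tot_pred n y -> tot_pred n z -> tot_pred n (a *: y + z).
Proof.
move=> [By gy y0] [Bz gz z0]; split; [exact: baseP | exact: gradedP |].
by move=> n0; rewrite linearP /= y0 // z0 // scaler0 addr0.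
Qed.

Definition tot_sp n : subsp cochain := Subsp (tot_pred0 n) (@tot_predP n).

Lemma tot_totd n y : tot_pred n.+1 y -> tot_pred n (totd y).
Proof.
move=> [By gy _]; split; [exact: base_totd | exact: graded_totd |].
by move=> _; exact: totdd.
Qed.

Section Perturbation.
Variable h : forall m, kmod_mor (K m) (K m.+1).
Hypothesis hP : @null_homotopy (kmod k) K K (fun n => pidm (K n)) h.

(** The contraction h of K applied chain by chain.  It does not commute with the
    coefficients, hence not with delta. *)
Definition vhomot y : cochain := fun m x s =>
  match m with
  | 0 => 0
  | m'.+1 => cf E x s s m'.+1 @! (h m' @! (y m' x s))
  end.

Fact vhomot_linear : linear vhomot.
Proof.
move=> a y z; apply: cochainP => -[|m] x s.
  by rewrite [RHS](_ : _ = a *: 0 + 0) // scaler0 addr0.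
rewrite [RHS](_ : _ = a *: vhomot y m.+1 x s + vhomot z m.+1 x s) //=.
by rewrite -linearP -linearP.
Qed.
HB.instance Definition _ := GRing.isLinear.Build k cochain cochain *:%R vhomot vhomot_linear.

Lemma base_vhomot y : base (vhomot y).
Proof. by move=> [|m] x s /=; [exact: linear0 | rewrite cfM]. Qed.

Lemma graded_vhomot n y : graded n y -> graded n.+1 (vhomot y).
Proof.
by move=> gy [|m] x s //= mn; rewrite gy ?linear0 //.
Qed.

(** Equal to the identity for the vertical differential alone; delta adds terms
    that only see the faces of a chain. *)
Definition vcomm y : cochain := totd (vhomot y) + vhomot (totd y).

Fact vcomm_linear : linear vcomm.
Proof.
by move=> a y z; rewrite /vcomm !linearP /= [in RHS]scalerDr [LHS]addrACA.
Qed.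
HB.instance Definition _ := GRing.isLinear.Build k cochain cochain *:%R vcomm vcomm_linear.

Definition below n y : Prop := forall m x s, (size s < n)%N -> y m x s = 0.

Definition defect y : cochain := vcomm y - y.

Fact defect_linear : linear defect.
Proof.
by move=> a y z; rewrite /defect linearP scalerBr opprD addrACA.
Qed.
HB.instance Definition _ := GRing.isLinear.Build k cochain cochain *:%R defect defect_linear.

(** The vertical parts of vcomm give y itself, and what is left evaluates y on
    faces, which are shorter. *)
Lemma vcomm_below n y : base y -> below n y -> below n.+1 (defect y).
Proof.
move=> By yn m x s sn.
have d0 z : below n z -> delta z m x s = 0.
  move=> zn; apply: altsum0 => r [_ sz]; rewrite zn ?linear0 //.
  by rewrite -ltnS sz.
have Sn : below n (vhomot y).
  by move=> [|m'] x' s' s'n //=; rewrite yn // !linear0.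
rewrite -[LHS]/(totd (vhomot y) m x s + vhomot (totd y) m x s - y m x s).
rewrite [totd (vhomot y) m x s]/totd d0 // scaler0 addr0.
have [h0 hS] := hP; case: m d0 => [|m] d0 /=.
  rewrite addr0 cfd -[cd K 0 @! _](kmodE (y 0%N x s) h0).
  by rewrite By subrr.
rewrite cfd.
have -> : totd y m x s = cd K m @! (y m.+1 x s) + (-1) ^+ m *: delta y m x s by [].
have -> : delta y m x s = 0.
  by apply: altsum0 => r [_ sz]; rewrite yn ?linear0 // -ltnS sz.
rewrite scaler0 addr0 -linearD -[X in cf _ _ _ _ _ @! X](kmodE (y m.+1 x s) (hS m)).
by rewrite By subrr.
Qed.

Lemma base_vcomm y : base y -> base (vcomm y).
Proof.
move=> By; rewrite /vcomm -[totd _]scale1r; apply: baseP; last exact: base_vhomot.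
exact/base_totd/base_vhomot.
Qed.

Lemma vcomm_inj y : base y -> vcomm y = 0 -> y = 0.
Proof.
move=> By Qy; suff yn n : below n y by apply: cochainP => m x s; apply: (yn (size s).+1).
elim: n => [//|n IH m x s sn].
have /(_ m x s sn)/eqP := vcomm_below By IH; rewrite /defect Qy sub0r.
by rewrite -[(- y) m x s]/(- y m x s) oppr_eq0 => /eqP.
Qed.

(** Partial sums of the Neumann series of the inverse of vcomm. *)
Fixpoint approx y n : cochain :=
  match n with 0 => 0 | n'.+1 => y - defect (approx y n') end.

Lemma base_defect y : base y -> base (defect y).
Proof.
move=> By; apply: (spD (S := base_sp)); first exact: base_vcomm.
exact: (spN (S := base_sp)).
Qed.

Lemma base_approx y n : base y -> base (approx y n).
Proof.
move=> By; elim: n => [|n IH]; first exact: base0.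
apply: (spD (S := base_sp)) => //; apply: (spN (S := base_sp)).
exact: base_defect.
Qed.

Lemma approx_step y n : base y -> below n (approx y n.+1 - approx y n).
Proof.
move=> By; elim: n => [//|n IH].
have -> : approx y n.+2 - approx y n.+1
    = - defect (approx y n.+1 - approx y n).
  rewrite [defect _](linearB defect); exact: subB_subB.
have Bd : base (approx y n.+1 - approx y n).
  apply: (spD (S := base_sp)); first exact: base_approx.
  by apply: (spN (S := base_sp)); exact: base_approx.
move=> m x s sn; have /(_ m x s sn) w0 := vcomm_below Bd IH.
by rewrite -[LHS]/(- _ m x s) w0 oppr0.
Qed.

Lemma approx_stable y n j : base y -> below n (approx y (j + n) - approx y n).
Proof.
move=> By; elim: j => [|j IH]; first by rewrite subrr.
move=> m x s sn.
rewrite -[LHS]/(approx y (j + n).+1 m x s - approx y n m x s).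
have /(_ m x s) := approx_step (n := j + n) By.
rewrite -[(approx y _ - _) m x s]/(approx y (j + n).+1 m x s - approx y (j + n) m x s).
move=> /(_ (leq_trans sn (leq_addl _ _)))/eqP; rewrite subr_eq0 => /eqP ->.
exact: IH sn.
Qed.

(** At a given chain the Neumann series is stationary beyond its size. *)
Definition vcomm_inv y : cochain := fun m x s => approx y (size s).+1 m x s.

Lemma vcomm_inv_approx y n : base y -> below n (vcomm_inv y - approx y n).
Proof.
move=> By m x s sn.
have /(_ m x s (ltnSn _)) := @approx_stable y (size s).+1 (n - (size s).+1) By.
rewrite subnK // => /eqP; rewrite -oppr_eq0 => /eqP E0.
rewrite -[RHS]E0 -[RHS]/(- (approx y n m x s - approx y (size s).+1 m x s)).
by rewrite opprB.
Qed.

Lemma base_vcomm_inv y : base y -> base (vcomm_inv y).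
Proof. by move=> By m x s; exact: base_approx. Qed.

Lemma vcommK y : base y -> vcomm (vcomm_inv y) = y.
Proof.
move=> By; have -> : vcomm (vcomm_inv y) = vcomm_inv y + defect (vcomm_inv y).
  by rewrite /defect addrC subrK.
apply: cochainP => m x s.
rewrite -[LHS]/(vcomm_inv y m x s + defect (vcomm_inv y) m x s).
have Bd : base (vcomm_inv y - approx y (size s)).
  apply: (spD (S := base_sp)); first exact: base_vcomm_inv.
  by apply: (spN (S := base_sp)); exact: base_approx.
have /(_ m x s (ltnSn _)) := vcomm_below Bd (vcomm_inv_approx By).
have -> : defect (vcomm_inv y - approx y (size s)) m x s
    = defect (vcomm_inv y) m x s - defect (approx y (size s)) m x s.
  by rewrite (linearB defect).
move=> /eqP; rewrite subr_eq0 => /eqP ->.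
by rewrite -[X in X + _]/(y m x s - defect (approx y (size s)) m x s) subrK.
Qed.

Lemma graded_approx y n j : graded n y -> graded n (approx y j).
Proof.
move=> gy; pose S := Subsp (@graded0 n) (@gradedP n).
elim: j => [|j IH]; first exact: graded0.
apply: (spD (S := S)) => //; apply: (spN (S := S)).
apply: (spD (S := S)); last exact: (spN (S := S)).
apply: (spD (S := S)); first exact/graded_totd/graded_vhomot.
case: n @S gy IH => [|n] S gy IH.
  move=> [|m] x s mn //; rewrite /vhomot.
  have -> : totd (approx y j) m x s = 0; last by rewrite !linear0.
  rewrite /totd IH // linear0 add0r /delta altsum0 ?scaler0 // => r [_ sz].
  by rewrite IH ?linear0 //; move: mn; rewrite -sz !add0n eqSS.
exact/graded_vhomot/graded_totd.
Qed.

Lemma graded_vcomm_inv y n : graded n y -> graded n (vcomm_inv y).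
Proof. by move=> gy m x s; exact: graded_approx. Qed.

(** Both sides are totd (vhomot (totd y)), since totd squares to zero. *)
Lemma vcomm_totd y : vcomm (totd y) = totd (vcomm y).
Proof.
rewrite /vcomm [totd (totd y)]totdd linear0 addr0.
by apply: esym; apply: etrans (linearD totd _ _) _; rewrite /= (totdd (vhomot y)) add0r.
Qed.

(** The perturbed homotopy, h divided by its commutator with totd. *)
Definition contraction y : cochain := vhomot (vcomm_inv y).

Lemma contractionP a y z : base y -> base z ->
  contraction (a *: y + z) = a *: contraction y + contraction z.
Proof.
move=> By Bz; rewrite /contraction -linearP; congr vhomot.
apply/eqP; rewrite -subr_eq0; apply/eqP; apply: vcomm_inj.
  apply: (spD (S := base_sp)); first exact/base_vcomm_inv/baseP.
  apply: (spN (S := base_sp)); apply: baseP; exact: base_vcomm_inv.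
rewrite (linearB vcomm) (linearP vcomm) /= !vcommK ?subrr //; exact: baseP.
Qed.

Lemma contraction_base y : base (contraction y).
Proof. exact: base_vhomot. Qed.

Lemma contraction_graded n y : graded n y -> graded n.+1 (contraction y).
Proof. by move=> gy; apply/graded_vhomot/graded_vcomm_inv. Qed.

Lemma contractionE y : base y ->
  totd (contraction y) + contraction (totd y) = y.
Proof.
move=> By; rewrite -[RHS]vcommK // /vcomm; congr (_ + vhomot _).
apply/eqP; rewrite -subr_eq0; apply/eqP; apply: vcomm_inj.
  apply: (spD (S := base_sp)); first exact/base_vcomm_inv/base_totd.
  by apply: (spN (S := base_sp)); apply/base_totd/base_vcomm_inv.
rewrite (linearB vcomm) /= vcomm_totd !vcommK ?subrr //; exact: base_totd.
Qed.

End Perturbation.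
End Totalization.

(** * Total complexes preserve relative quasi-isomorphisms *)

(** P is the truncated total complex of E up to isomorphism; the rectification at
    a vertex and the cobar complex are both of this form. *)
Record realizes (k : comPzRingType) (X : Type) (T : eqType) (K : complex (kmod k))
    (E : coefsys X T K) (P : complex (kmod k)) := Realizes {
  rz : forall n, P n -> cochain X T (fun m => K m);
  rz_linear : forall n, linear (@rz n);
  rz_inj : forall n, injective (@rz n);
  rz_tot : forall n p, tot_pred E n (@rz n p);
  rz_img : forall n y, tot_pred E n y -> exists p, @rz n p = y;
  rz_d : forall n p, rz (cd P n @! p) = totd E (@rz n.+1 p)
}.

Section ConeOfTotalizations.
Variables (k : comPzRingType) (X : Type) (T : eqType) (K K' : complex (kmod k)).
Variables (f : chain_map K K') (E : coefsys X T K) (E' : coefsys X T K').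
Hypothesis fE : forall x s r m y,
  f m @! (cf E x s r m @! y) = cf E' x s r m @! (f m @! y).

Definition cone_cf_fun x s r m : cone f m -> cone f m :=
  match m with
  | 0 => fun z => cf E' x s r 0 @! z
  | m'.+1 => fun z => (cf E' x s r m'.+1 @! z.1, cf E x s r m' @! z.2)
  end.

Fact cone_cf_linear x s r m : linear (@cone_cf_fun x s r m).
Proof.
case: m => [|m] a y z; first exact: (linearP (cf E' x s r 0%N : {linear _ -> _})).
congr pair; first exact: (linearP (cf E' x s r m.+1 : {linear _ -> _})).
exact: (linearP (cf E x s r m : {linear _ -> _})).
Qed.

(** The cone of f carries the coefficients of both complexes, so that the
    perturbation applies to it as to any complex. *)
Definition cone_coefsys : coefsys X T (cone f).
Proof.
exists (fun x s r m => mklinear (@cone_cf_linear x s r m) : kmod_mor _ _).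
- move=> x s r t [|m] y rs tr; first exact: (cfM E').
  by congr pair; apply: cfM.
- move=> x s r [|m] y.
    rewrite [LHS](_ : _ = cd K' 0 @! (cf E' x s r 1 @! y.1)
      + f 0 @! (cf E x s r 0 @! y.2)) //.
    by rewrite cfd fE -linearD.
  rewrite [LHS](_ : _ = (cd K' m.+1 @! (cf E' x s r m.+2 @! y.1)
    + f m.+1 @! (cf E x s r m.+1 @! y.2), - (cd K m @! (cf E x s r m.+1 @! y.2)))) //.
  by rewrite !cfd fE -linearD -linearN.
Defined.
Notation Ec := cone_coefsys.

Definition pack (y' : cochain X T (fun m => K' m)) (y : cochain X T (fun m => K m)) :
    cochain X T (fun m => cone f m) := fun m x s =>
  match m return cone f m with
  | 0 => y' 0 x s
  | m'.+1 => (y' m'.+1 x s, y m' x s)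
  end.

Definition unpack1 (z : cochain X T (fun m => cone f m)) : cochain X T (fun m => K' m) :=
  fun m x s => match m return cone f m -> K' m with
    | 0 => fun u => u | m'.+1 => fun u => u.1 end (z m x s).

Definition unpack2 (z : cochain X T (fun m => cone f m)) : cochain X T (fun m => K m) :=
  fun m x s => (z m.+1 x s).2.

Lemma packK z : pack (unpack1 z) (unpack2 z) = z.
Proof. by apply: cochainP => -[|m] x s //=; rewrite [RHS]surjective_pairing. Qed.

Lemma packP a y' y z' z : pack (a *: y' + z') (a *: y + z) = a *: pack y' y + pack z' z.
Proof. by apply: cochainP => -[|m] x s. Qed.

Lemma pack_inj y' y z' z : pack y' y = pack z' z -> y' = z' /\ y = z.
Proof.
move=> yz; split; apply: cochainP => m x s.
  case: m => [|m]; first exact: (congr1 (fun w => w 0%N x s) yz).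
  by case: (congr1 (fun w => w m.+1 x s) yz).
by case: (congr1 (fun w => w m.+1 x s) yz).
Qed.

Definition fcochain (y : cochain X T (fun m => K m)) : cochain X T (fun m => K' m) :=
  fun m x s => f m @! (y m x s).

Fact fcochain_linear : linear fcochain.
Proof.
move=> a y z; apply: cochainP => m x s; exact: (linearP (f m : {linear _ -> _})).
Qed.

Lemma fcochain0 : fcochain 0 = 0.
Proof. by apply: cochainP => m x s; exact: linear0. Qed.

Lemma pack0 : pack 0 0 = 0.
Proof. by apply: cochainP => -[|m]. Qed.

Lemma altsum_pair (V U : zmodType) (y : seq T -> V) (z : seq T -> U) s :
  altsum (fun r => (y r, z r) : (V * U)%type) s = (altsum y s, altsum z s).
Proof. by elim: s y z => //= i t IH y z; rewrite IH. Qed.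

(** The total differential commutes with taking cones; the shift of the source by
    one degree accounts for the sign on its delta. *)
Lemma totd_pack y' y :
  totd Ec (pack y' y) = pack (totd E' y' + fcochain y) (- totd E y).
Proof.
apply: cochainP => -[|m] x s.
  rewrite [LHS](_ : _ = cd K' 0 @! (y' 1%N x s) + f 0 @! (y 0%N x s)
    + (-1) ^+ 0 *: delta E' y' 0%N x s) //.
  by rewrite addrAC.
rewrite [LHS](_ : _ = ((cd K' m.+1 @! (y' m.+2 x s) + f m.+1 @! (y m.+1 x s),
   - (cd K m @! (y m.+1 x s))) : (K' m.+1 * K m)%type)
    + (-1) ^+ m.+1 *: delta Ec (pack y' y) m.+1 x s) //.
have -> : delta Ec (pack y' y) m.+1 x s
    = (delta E' y' m.+1 x s, delta E y m x s) by rewrite -altsum_pair.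
congr pair => /=; first by rewrite addrAC.
by rewrite -[RHS]/(- (_ + _)) opprD exprS mulN1r scaleNr.
Qed.

Lemma base_pack y' y : base Ec (pack y' y) <-> base E' y' /\ base E y.
Proof.
split=> [B|[B' B] [|m] x s]; last 2 first.
- exact: B'.
- by congr pair; [exact: B' | exact: B].
split=> m x s; last exact: (congr1 snd (B m.+1 x s)).
by case: m => [|m]; [exact: (B 0%N x s) | exact: (congr1 fst (B m.+1 x s))].
Qed.

Lemma graded_pack n y' y :
  graded n.+1 (pack y' y) <-> graded n.+1 y' /\ graded n y.
Proof.
split=> [g|[g' g] [|m] x s mn]; last 2 first.
- exact: g'.
- by rewrite /pack g' // g.
split=> m x s mn; last exact: (congr1 snd (g m.+1 x s mn)).
by case: m mn => [|m] mn; [exact: (g 0%N x s mn) | exact: (congr1 fst (g m.+1 x s mn))].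
Qed.

Lemma graded_pack0 y' : graded 0 y' -> graded 0 (pack y' 0).
Proof. by move=> g [|m] x s mn; rewrite /pack g. Qed.

Variables (P P' : complex (kmod k)) (F : chain_map P P').
Variables (R : realizes E P) (R' : realizes E' P').
Hypothesis FR : forall n p, rz R' (F n @! p) = fcochain (@rz _ _ _ _ _ _ R n p).

Definition cone_rz n : cone F n -> cochain X T (fun m => cone f m) :=
  match n with
  | 0 => fun w => pack (rz R' w) 0
  | n'.+1 => fun w => pack (rz R' w.1) (rz R w.2)
  end.

Lemma cone_rz_linear n : linear (@cone_rz n).
Proof.
move=> a y z; case: n y z => [|n] y z /=; rewrite ?rz_linear -packP //.
by rewrite scaler0 addr0.
Qed.

Lemma cone_rz_inj n : injective (@cone_rz n).
Proof.
case: n => [|n] y z /pack_inj; first by case=> /rz_inj.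
by case: y z => [y1 y2] [z1 z2] [/rz_inj /= -> /rz_inj /= ->].
Qed.

Lemma cone_rz_d n w : cone_rz (cd (cone F) n @! w) = totd Ec (@cone_rz n.+1 w).
Proof.
case: n w => [|n] w; rewrite totd_pack.
  have [_ _ /(_ erefl) ->] := rz_tot R w.2.
  rewrite oppr0 -rz_d -FR -[X in _ = pack (X + _) _]scale1r -rz_linear scale1r.
  by [].
rewrite -rz_d -FR -[X in _ = pack (X + _) _]scale1r -rz_linear scale1r.
congr pack; rewrite -rz_d /=.
have z0 : rz R (0 : P n) = 0.
  have := rz_linear R (-1) (0 : P n) 0; rewrite scaler0 addr0 => ->.
  by rewrite scaleN1r addNr.
rewrite -[- cd P n _]addr0 -scaleN1r; apply: etrans (rz_linear _ _ _ _) _.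
by rewrite z0 addr0 scaleN1r.
Qed.

Lemma cone_rz_base n w : base Ec (@cone_rz n w).
Proof.
case: n w => [|n] w; apply/base_pack; split; try exact: base0.
- by have [] := rz_tot R' w.
- by have [] := rz_tot R' w.1.
- by have [] := rz_tot R w.2.
Qed.

Lemma cone_rz_graded n w : graded n (@cone_rz n w).
Proof.
case: n w => [|n] w.
  by apply: graded_pack0; have [] := rz_tot R' w.
apply/graded_pack; split; first by have [] := rz_tot R' w.1.
by have [] := rz_tot R w.2.
Qed.

(** The truncation only restricts the degree 0 part of the source, which sits in
    degree 1 of the cone. *)
Lemma cone_rz_img n z : base Ec z -> graded n.+1 z ->
  (n = 0%N -> unpack2 (totd Ec z) = 0) -> exists w, @cone_rz n.+1 w = z.
Proof.
rewrite -{1 2 3}(packK z) => /base_pack[B' B] /graded_pack[g' g] z0.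
have [|p' p'E] := @rz_img _ _ _ _ _ _ R' n.+1 (unpack1 z); first by split.
have [|p pE] := @rz_img _ _ _ _ _ _ R n (unpack2 z).
  split=> // n0; have := z0 n0; rewrite totd_pack => /eqP.
  by rewrite -[unpack2 _]/(- totd E (unpack2 z)) oppr_eq0 => /eqP.
by exists (p', p); rewrite /cone_rz /= p'E pE packK.
Qed.

(** The contraction obtained by perturbation respects the truncation: applied to a
    cocycle z of degree 0 it gives an element with differential z, whose
    component in the source must therefore be a cocycle. *)
Lemma cone_tot_contractible : contractible (cone f) -> contractible (cone F).
Proof.
move=> [h hP].
have S0 : contraction Ec h 0 = 0.
  have := contractionP hP (-1) (base0 Ec) (base0 Ec).
  by rewrite scaler0 addr0 => ->; rewrite scaleN1r addNr.
have ex n (w : cone F n) : exists w', @cone_rz n.+1 w' = contraction Ec h (cone_rz w).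
  apply: cone_rz_img; first exact: contraction_base.
    exact/contraction_graded/cone_rz_graded.
  move=> n0; have := contractionE hP (cone_rz_base w).
  have -> : totd Ec (cone_rz w) = 0.
    case: n n0 w => // _ w; rewrite totd_pack.
    have [_ _ /(_ erefl) ->] := rz_tot R' w.
    rewrite (linear0 (totd E)) oppr0 add0r.
    by rewrite fcochain0 pack0.
  by rewrite S0 addr0 => ->; case: n n0 w.
pose t n w := projT1 (cid (ex n w)).
have tE n w : cone_rz (t n w) = contraction Ec h (cone_rz w) := projT2 (cid (ex n w)).
have tlin n : linear (t n).
  move=> c y z; apply: cone_rz_inj; rewrite tE !cone_rz_linear !tE.
  exact: contractionP (cone_rz_base _) (cone_rz_base _).
exists (fun n => mklinear (tlin n) : kmod_mor _ _); split=> [|n].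
  apply: linearP_eq => w; apply: cone_rz_inj.
  rewrite [RHS](cone_rz_d (t 0%N w)) tE -[LHS](contractionE hP (cone_rz_base w)).
  have -> : totd Ec (@cone_rz 0 w) = 0; last by rewrite S0 addr0.
  rewrite totd_pack; have [_ _ /(_ erefl) ->] := rz_tot R' w.
  by rewrite (linear0 (totd E)) oppr0 add0r fcochain0 pack0.
apply: linearP_eq => w; apply: cone_rz_inj.
rewrite -[LHS](contractionE hP (cone_rz_base w)) -tE -cone_rz_d -cone_rz_d -tE.
rewrite -[X in X + _]scale1r -cone_rz_linear scale1r.
by [].
Qed.

End ConeOfTotalizations.

(** * Matrix units and diagonal matrices in A! *)

Section ElementsOfShriek.
Variables (k : comPzRingType) (d : Order.disp_t) (C : porderType d).
Variable A : presheaf k C.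
Notation B := (shriek_ring A).
Notation ext i h a := (@ext_map _ C (ps_ab A) i h a).

(** The matrix unit phi^{ij}, zero unless i <= j. *)
Definition arr (i j : C) : B.
Proof.
exists (fun g l => if [&& g == i, l == j & (i <= j)%O] then 1 else 0 : A g) => [g l|g].
  by case: ifP => // /and3P[/eqP-> /eqP-> ->].
apply: sub_finite_set (finite_set1 j) => l /=.
by case: ifP => [/and3P[_ /eqP->]|] //; rewrite eqxx.
Defined.

Definition dgm (x : forall i, A i) : B := rf_diag x.
(** The element a of A^h acting on all rows i <= h at once, through phi^{ih}. *)
Definition dg (h : C) (a : A h) : B := dgm (fun i => ext i h a).

Lemma ext_comp g i h (a : A h) : (g <= i)%O -> (i <= h)%O -> ext g i (ext i h a) = ext g h a.
Proof.
move=> gi ih; rewrite (ext_mapE ih) (ext_mapE gi) (ext_mapE (le_trans gi ih)).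
exact: phi_cmp.
Qed.

Lemma ext_phi h' h (hh : (h' <= h)%O) i (a : A h) : (i <= h')%O ->
  ext i h' (phi A hh a) = ext i h a.
Proof. by move=> ih; rewrite -(ext_comp a ih hh) (ext_mapE hh). Qed.

Lemma ext1 g h : (g <= h)%O -> ext g h 1 = 1.
Proof. by move=> gh; rewrite (ext_mapE gh); exact: rmorph1. Qed.

Lemma extM g h (a b : A h) : ext g h (a * b) = ext g h a * ext g h b.
Proof.
case: (boolP (g <= h)%O) => gh; first by rewrite !(ext_mapE gh); exact: rmorphM.
by rewrite !ext_mapN // mul0r.
Qed.

Lemma ext_kscal g h c : (g <= h)%O -> ext g h (kscal (A h) c) = kscal (A g) c.
Proof. by move=> gh; rewrite (ext_mapE gh); exact: phi_kscal. Qed.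

Lemma arr_mulE i j (x : B) g l : (i <= j)%O ->
  (arr i j * x) g l = if g == i then ext g j (x j l) else 0.
Proof.
move=> ij; rewrite [LHS](@rf_mulE _ _ _ (ps_ab A) _ _ (@mulD _ _ _ A) _ _ g l [:: j]) //.
  rewrite big_seq1 /= eqxx ij !andbT. case: (g == i); rewrite ?mul1r ?mul0r. reflexivity.
  reflexivity.
by move=> t; rewrite inE /= => /negbTE ->; rewrite andbF.
Qed.

Lemma mul_arrE i j (x : B) g l : (i <= j)%O ->
  (x * arr i j) g l = if l == j then x g i else 0.
Proof.
move=> ij; have [s us s0] := rf_supp x g; pose t := undup (i :: s).
rewrite [LHS](@rf_mulE _ _ _ (ps_ab A) _ _ (@mulD _ _ _ A) _ _ g l t) ?undup_uniq //; last first.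
  by move=> r; rewrite mem_undup inE negb_or => /andP[_ /s0].
have it : i \in t by rewrite mem_undup inE eqxx.
rewrite (bigD1_seq i) ?undup_uniq //= big1 => [|r ri]; last first.
  by rewrite (negbTE ri) /= ext_map0 mulr0.
rewrite eqxx ij andbT addr0; case: eqP => _; last by rewrite ext_map0 mulr0.
case: (boolP (g <= i)%O) => gi; first by rewrite ext1 ?mulr1.
by rewrite rfm_upper // mul0r.
Qed.

Lemma arrM g i j : (g <= i)%O -> (i <= j)%O -> arr g i * arr i j = arr g j.
Proof.
move=> gi ij; apply: rfmatP => h l; rewrite arr_mulE //= eqxx ij (le_trans gi ij) !andbT.
case: eqP => [->|_] //=; case: eqP => _; last exact: (@ext_map0 _ C (ps_ab A) g i).
exact: ext1.
Qed.

Lemma dgm_mulE (x : forall i, A i) (y : B) g l : (dgm x * y) g l = x g * y g l.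
Proof. exact: rf_diag_mul. Qed.

Lemma arr_dgm g i (x y : forall i, A i) : (g <= i)%O -> x i = y i ->
  arr g i * dgm x = arr g i * dgm y.
Proof.
move=> gi xy; apply: rfmatP => h l; rewrite !arr_mulE //.
by rewrite /= xy.
Qed.

Lemma arr_dgmC i (x : forall i, A i) : arr i i * dgm x = dgm x * arr i i.
Proof.
apply: rfmatP => g l; rewrite mul_arrE // arr_mulE // /= [i == l]eq_sym.
case: (eqVneq g i) => [->|gi]; last by rewrite if_same.
by case: eqP => _; [rewrite (ext_mapE (lexx i)); exact: phi_id | exact: (@ext_map0 _ C (ps_ab A) i i)].
Qed.

Lemma dgmM (x y : forall i, A i) : dgm x * dgm y = dgm (fun i => x i * y i).
Proof.
apply: rfmatP => h l; rewrite dgm_mulE /=.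
by case: eqP => // _; rewrite mulr0.
Qed.

Lemma dgD h (a b : A h) : dg (a + b) = dg a + dg b.
Proof.
apply: rfmatP => i j; rewrite [RHS](_ : _ = dg a i j + dg b i j) //=.
by case: eqP => _; rewrite ?addr0 // ext_mapD.
Qed.

Lemma dg0 h : dg (0 : A h) = 0.
Proof. by apply: (addrI (dg (0 : A h))); rewrite -dgD !addr0. Qed.

Lemma dgM h (a b : A h) : dg (a * b) = dg a * dg b.
Proof.
rewrite dgmM; apply: rfmatP => i j /=; case: eqP => // _; exact: extM.
Qed.

Lemma dg_sum h (I : Type) (s : seq I) (F : I -> A h) :
  dg (\sum_(i <- s) F i) = \sum_(i <- s) dg (F i).
Proof. by apply: (big_morph (@dg h)); [exact: dgD | exact: dg0]. Qed.

(** Both sides are phi^{gh}(a) phi^{gi}. *)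
Lemma arr_dgC g i h (a : A h) : (g <= i)%O -> (i <= h)%O ->
  arr g i * dg a = dg a * arr g i.
Proof.
move=> gi ih; apply: rfmatP => j l; rewrite arr_mulE // dgm_mulE /= gi andbT.
case: (eqVneq j g) => [->|_] /=; last by rewrite mulr0.
rewrite [i == l]eq_sym; case: eqP => _; last by rewrite ext_map0 mulr0.
by rewrite ext_comp // mulr1.
Qed.

Lemma arr_dg1 g i h : (g <= i)%O -> (i <= h)%O -> arr g i * dg (1 : A h) = arr g i.
Proof.
move=> gi ih; rewrite -[RHS]mulr1; apply: arr_dgm => //; exact: ext1.
Qed.

Lemma arr_dg_kscal g i h c : (g <= i)%O -> (i <= h)%O ->
  arr g i * dg (kscal (A h) c) = arr g i * shriek_scal A c.
Proof. by move=> gi ih; apply: arr_dgm => //; exact: ext_kscal. Qed.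

Lemma arr_dg_phi g i h' h (hh : (h' <= h)%O) (a : A h) :
  (g <= i)%O -> (i <= h')%O -> arr g i * dg (phi A hh a) = arr g i * dg a.
Proof. by move=> gi ih; apply: arr_dgm => //; exact: ext_phi. Qed.

Lemma rf_sumE (V : C -> zmodType) (I : Type) (s : seq I) (F : I -> rfmat V) g l :
  (\sum_(i <- s) F i) g l = \sum_(i <- s) F i g l.
Proof. by apply: (big_morph (fun m : rfmat V => m g l)). Qed.

(** The matrix unit phi^{ih} moves row h to row i, and a single row has finite
    support. *)
Lemma arr_row i h (x : B) (s : seq C) : (i <= h)%O -> uniq s ->
  (forall j, j \notin s -> x h j = 0) ->
  arr i h * x = \sum_(j <- s) dg (x h j) * arr i j.
Proof.
move=> ih us s0; apply: rfmatP => g l; rewrite arr_mulE // rf_sumE.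
transitivity (\sum_(j <- s) if (g == i) && (l == j) then ext g h (x h j) else 0); last first.
  apply: eq_bigr => j _; rewrite dgm_mulE /=.
  case: (eqVneq g i) => [->|_] /=; last by rewrite mulr0.
  case: eqP => _ /=; last by rewrite mulr0.
  case: (boolP (i <= j)%O) => ij; first by rewrite mulr1.
  rewrite rfm_upper ?ext_map0 ?mul0r //.
  by apply: contra ij; apply: le_trans.
case: (eqVneq g i) => [->|_] /=; last by rewrite big1.
case: (boolP (l \in s)) => ls; last first.
  rewrite s0 // ext_map0 big_seq big1 // => j js.
  by case: eqP ls => // ->; rewrite js.
rewrite (bigD1_seq l) //= eqxx big1 ?addr0 // => j.
by rewrite eq_sym => /negbTE ->.
Qed.

Lemma arr_dg_mul i h (x y : B) l (s : seq C) : (i <= h)%O -> uniq s ->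
  (forall j, j \notin s -> x h j = 0) ->
  arr i i * dg ((x * y) h l) = \sum_(j <- s) arr i i * (dg (x h j) * dg (y j l)).
Proof.
move=> ih us s0.
rewrite [(x * y) h l](@rf_mulE _ _ _ (ps_ab A) _ _ (@mulD _ _ _ A) _ _ h l s) //.
rewrite dg_sum mulr_sumr; apply: eq_bigr => j _.
case: (boolP (h <= j)%O) => hj; last by rewrite rfm_upper // mul0r dg0 mul0r.
rewrite [dg (x h j) * _]dgmM; apply: arr_dgm => //.
by rewrite extM ext_comp.
Qed.

End ElementsOfShriek.

(** * Chains below a vertex and their coefficients *)

Section BimoduleActions.
Variables (k : comPzRingType) (B : kalgebra k) (Y : bimodule B).

Lemma lact_linear (a : B) : linear (fun y : Y => lact a y).
Proof.
move=> c x y; rewrite lactDr; congr (_ + _).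
by rewrite -!lact_sym !lactA kscalC.
Qed.

Lemma ract_linear (a : B) : linear (fun y : Y => ract y a).
Proof.
move=> c x y; rewrite ractDl; congr (_ + _).
by rewrite -!ract_sym !ractA kscalC.
Qed.

Lemma lact_suml (I : Type) (s : seq I) (F : I -> B) (y : Y) :
  lact (\sum_(i <- s) F i) y = \sum_(i <- s) lact (F i) y.
Proof.
by apply: (big_morph (fun a => lact a y)) => [a b|]; [exact: lactDl | exact: lact0].
Qed.

Lemma lact_sumr (I : Type) (s : seq I) (F : I -> Y) (a : B) :
  lact a (\sum_(i <- s) F i) = \sum_(i <- s) lact a (F i).
Proof. by apply: big_morph => [x y|]; [exact: lactDr | exact: lactr0]. Qed.

Lemma ract_suml (I : Type) (s : seq I) (F : I -> Y) (a : B) :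
  ract (\sum_(i <- s) F i) a = \sum_(i <- s) ract (F i) a.
Proof.
by apply: (big_morph (fun y => ract y a)) => [x y|]; [exact: ractDl | exact: ract0].
Qed.

Lemma ract_sumr (I : Type) (s : seq I) (F : I -> B) (y : Y) :
  ract y (\sum_(i <- s) F i) = \sum_(i <- s) ract y (F i).
Proof. by apply: big_morph => [a b|]; [exact: ractDr | exact: ractr0]. Qed.

End BimoduleActions.

Section Chains.
Variables (d : Order.disp_t) (C : porderType d).

Definition geC : rel C := fun a b => (b <= a)%O.

Lemma geC_trans : transitive geC.
Proof. by move=> a b c ab bc; exact: le_trans bc ab. Qed.

(** Chains are listed from top to bottom, so that adding a vertex above the chain
    is a cons. *)
Definition below_chain (h : C) (s : seq C) : bool :=
  if s is p :: t then (p <= h)%O && path geC p t else false.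

Lemma path_last_le p t x : path geC p t -> x \in p :: t -> (last p t <= x)%O.
Proof.
elim: t p x => [|a t IH] p x /=; first by move=> _; rewrite inE => /eqP ->.
move=> /andP[ap pt]; rewrite inE => /orP[/eqP ->|]; last exact: IH.
apply: le_trans ap; apply: IH pt _; exact: mem_head.
Qed.

Lemma below_chain_le h p t x : below_chain h (p :: t) -> x \in p :: t -> (x <= p)%O.
Proof.
move=> /andP[_ /(order_path_min geC_trans)/allP pt].
by rewrite inE => /orP[/eqP ->|/pt].
Qed.

Lemma below_chain_last h p t : below_chain h (p :: t) -> (last p t <= p)%O.
Proof. by move=> ok; apply: below_chain_le ok _; exact: mem_last. Qed.

Lemma below_chain_sub h p t q u : below_chain h (p :: t) -> subseq (q :: u) (p :: t) ->
  [/\ below_chain h (q :: u), (q <= p)%O & (last p t <= last q u)%O].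
Proof.
move=> ok sub; have qp : (q <= p)%O.
  by apply: below_chain_le ok _; apply: (mem_subseq sub); exact: mem_head.
move: ok => /andP[ph pt]; split=> //.
  apply/andP; split; first exact: le_trans qp ph.
  exact: (subseq_sorted geC_trans sub pt).
by apply: path_last_le pt _; apply: (mem_subseq sub); exact: mem_last.
Qed.

Lemma below_chain_widen h' h s : (h' <= h)%O -> below_chain h' s -> below_chain h s.
Proof. by case: s => //= p t hh /andP[ph ->]; rewrite (le_trans ph hh). Qed.

End Chains.

Section ChainCoefficients.
Variables (k : comPzRingType) (d : Order.disp_t) (C : porderType d).
Variable A : presheaf k C.
Notation B := (shriek_alg A).
Variables (b : bool) (X : Type) (hx : X -> C).

(** With b = true values are transported on both sides, along the bottom and the
    top vertices; with b = false only on the left. *)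
Definition rfac (q p : C) : B := if b then arr A q p else 1.

Lemma rfacM q p l : (q <= p)%O -> (p <= l)%O -> rfac q p * rfac p l = rfac q l.
Proof. by rewrite /rfac; case: b => qp pl; [exact: arrM | rewrite mulr1]. Qed.

Section OneModule.
Variable Y : bimodule B.

(** Transport to the chain s of a value at the chain r: left multiplication goes
    from the bottom of r down to the bottom of s, right multiplication from the
    top of r up to the top of s.  The value at s of a cochain thus lies in
    e_{bottom} Y e_{top}, or in e_{bottom} Y when b = false. *)
Definition chain_act (h : C) (s r : seq C) (y : Y) : Y :=
  match s, r with
  | p :: t, q :: u =>
      if below_chain h s then ract (lact (arr A (last p t) (last q u) : B) y) (rfac q p) else 0
  | _, _ => 0
  end.

Lemma chain_act_linear h s r : linear (chain_act h s r).
Proof.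
move=> a y z; rewrite /chain_act; case: s r => [|p t] [|q u]; rewrite ?scaler0 ?addr0 //.
case: ifP => _; last by rewrite scaler0 addr0.
by rewrite lact_linear ract_linear.
Qed.

Lemma chain_act0 h s r : chain_act h s r 0 = 0.
Proof.
by rewrite /chain_act; case: s r => [|p t] [|q u] //; case: ifP => // _; rewrite lactr0 ract0.
Qed.

Lemma chain_actM h s r t y : subseq r s -> subseq t r ->
  chain_act h s r (chain_act h r t y) = chain_act h s t y.
Proof.
case: s r t => [|p s] [|q r] [|a t] //; rewrite ?chain_act0 // => rs tr.
rewrite /chain_act; case: (boolP (below_chain h (p :: s))) => // ok.
have [ok' qp sr] := below_chain_sub ok rs; have [_ aq rt] := below_chain_sub ok' tr.
by rewrite ok' -lractA lactA ractA arrM // rfacM.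
Qed.

End OneModule.

Lemma bimod_chain_act (Y Z : bimodule B) (f : bimod_mor Y Z) h s r y :
  f (chain_act h s r y) = chain_act h s r (f y).
Proof.
rewrite /chain_act; case: s r => [|p t] [|q u]; rewrite ?linear0 //.
by case: ifP => _; rewrite ?linear0 // bmorr bmorl.
Qed.

Definition chain_coef (Y : complex (bimod B)) :
  coefsys X C (Kom_ob (bimod_forget B) Y).
Proof.
exists (fun x s r m => mklinear (@chain_act_linear (Y m) (hx x) s r)
  : kmod_mor (Y m : bimodule B) (Y m : bimodule B)).
- by move=> x s r t m y; exact: chain_actM.
- by move=> x s r m y; exact: bimod_chain_act.
Defined.

End ChainCoefficients.

(** * Operators acting chain by chain *)

(** Cochains given at the index x' by a finite combination of operators f i m s
    applied to other cochains.  When the operators commute with differentials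
    and with transport to longer chains, totd can be computed under the sum.
    The bimodule actions, the restrictions and tau all have this form. *)
Section PointwiseOperators.
Variables (k : comPzRingType) (X X' : Type) (T : eqType) (K K' : complex (kmod k)).
Variables (E : coefsys X T K) (E' : coefsys X' T K') (x' : X').
Variables (I : Type) (S : seq I) (xs : I -> X).
Variable f : I -> forall m, seq T -> K m -> K' m.
Variables (y : I -> cochain X T (fun m => K m)) (y' : cochain X' T (fun m => K' m)).
Hypothesis f_linear : forall i m s, linear (f i (m := m) s).
Hypothesis fd : forall i m s z, f i s (cd K m @! z) = cd K' m @! (f i s z).
Hypothesis fE : forall i m s r z, subseq r s ->
  f i s (cf E (xs i) s r m @! z) = cf E' x' s r m @! (f i r z).
Hypothesis y'E : forall m s, y' m x' s = \sum_(i <- S) f i s (y i m (xs i) s).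

Let F i m s : {linear K m -> K' m} := mklinear (@f_linear i m s).

Lemma altsum_sum (V : zmodType) (g : I -> seq T -> V) s :
  altsum (fun r => \sum_(i <- S) g i r) s = \sum_(i <- S) altsum (g i) s.
Proof.
elim: s g => [|a s IH] g /=; first by rewrite big1.
by rewrite (IH (fun i r => g i (a :: r))) -sumrB.
Qed.

Lemma totd_pt m s : totd E' y' m x' s = \sum_(i <- S) f i s (totd E (y i) m (xs i) s).
Proof.
have dE : delta E' y' m x' s = \sum_(i <- S) f i s (delta E (y i) m (xs i) s).
  transitivity (altsum (fun r => \sum_(i <- S)
      f i s (cf E (xs i) s r m @! (y i m (xs i) r))) s).
    apply: eq_altsum => r [rs _]; rewrite y'E linear_sum.
    by apply: eq_bigr => i _; rewrite fE.
  rewrite altsum_sum; apply: eq_bigr => i _; rewrite /delta.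
  by rewrite [RHS](raddf_altsum (f := F i m s)) //; exact: linearB.
rewrite [LHS]/totd dE y'E linear_sum scaler_sumr -big_split; apply: eq_bigr => i _ /=.
rewrite -[f i s (totd _ _ _ _ _)]/(F i m s _) linearD linearZ.
by rewrite -fd.
Qed.

Lemma base_pt m s : (forall i, base E (y i)) -> cf E' x' s s m @! (y' m x' s) = y' m x' s.
Proof.
move=> By; rewrite y'E linear_sum; apply: eq_bigr => i _.
by rewrite -fE // By.
Qed.

Lemma graded_pt n m s : (forall i, graded n (y i)) -> (m.+1 != n + size s)%N ->
  y' m x' s = 0.
Proof.
move=> gy mn; rewrite y'E big1 // => i _; rewrite gy //.
exact: (linear0 (F i m s)).
Qed.

End PointwiseOperators.

Section PointwiseMaps.
Variables (k : comPzRingType) (X X' : Type) (T : eqType) (K K' : complex (kmod k)).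
Variables (E : X' -> coefsys X T K) (E' : coefsys X' T K').

Lemma tot_pt n (y' : cochain X' T (fun m => K' m)) :
  (forall x', exists I (S : seq I) xs f y,
    [/\ forall i m s, linear (f i m s),
        forall i m s z, f i m s (cd K m @! z) = cd K' m @! (f i m.+1 s z),
        forall i m s r z, subseq r s ->
          f i m s (cf (E x') (xs i) s r m @! z) = cf E' x' s r m @! (f i m r z),
        forall m s, y' m x' s = \sum_(i <- S) f i m s (y i m (xs i) s) &
        forall i, tot_pred (E x') n (y i)]) ->
  tot_pred E' n y'.
Proof.
move=> H; split.
- move=> m x' s; have [I [S [xs [f [y [fl fd fE y'E yn]]]]]] := H x'.
  by apply: (base_pt (f := f) fE y'E) => i; have [] := yn i.
- move=> m x' s mn; have [I [S [xs [f [y [fl fd fE y'E yn]]]]]] := H x'.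
  by apply: (graded_pt (f := f) fl y'E) mn => i; have [] := yn i.
- move=> n0; apply: cochainP => m x' s.
  have [I [S [xs [f [y [fl fd fE y'E yn]]]]]] := H x'.
  rewrite (totd_pt fl fd fE y'E) big1 // => i _.
  by have [_ _ ->] := yn i; first exact: (linear0 (mklinear (fl i m s))).
Qed.

End PointwiseMaps.

Section CochainMaps.
Variables (k : comPzRingType) (X : Type) (T : eqType) (K K' : complex (kmod k)).
Variables (E : coefsys X T K) (E' : coefsys X T K').

Section Maps.
Variable f : chain_map K K'.
Hypothesis fE : forall x s r m y,
  f m @! (cf E x s r m @! y) = cf E' x s r m @! (f m @! y).

Lemma totd_fcochain y : totd E' (fcochain f y) = fcochain f (totd E y).
Proof.
apply: cochainP => m x s.
rewrite (@totd_pt _ _ _ _ _ _ E E' x unit [:: tt] (fun=> x)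
   (fun _ m _ z => f m @! z) (fun=> y)) ?big_seq1 //.
- by move=> _ m' _; exact: linearP.
- by move=> _ m' _ z; exact: cmcd.
- by move=> _ m' s' r z _; exact: fE.
- by move=> m' s'; rewrite big_seq1.
Qed.

Lemma tot_fcochain n y : tot_pred E n y -> tot_pred E' n (fcochain f y).
Proof.
move=> yn; apply: (tot_pt (E := fun=> E)) => x.
exists unit, [:: tt], (fun=> x), (fun _ m _ z => f m @! z), (fun=> y); split=> //.
- by move=> _ m' _; exact: linearP.
- by move=> _ m' _ z; exact: cmcd.
- by move=> _ m' s' r z _; exact: fE.
- by move=> m' s'; rewrite big_seq1.
Qed.

End Maps.

Section Homotopies.
Variable h : forall m, kmod_mor (K m) (K' m.+1).
Variable f : forall m, kmod_mor (K m) (K' m).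
Hypothesis hf : @null_homotopy (kmod k) K K' f h.
Hypothesis hE : forall x s r m y,
  h m @! (cf E x s r m @! y) = cf E' x s r m.+1 @! (h m @! y).

(** A homotopy h commuting with the coefficients shifts m by one, hence changes the
    sign of delta, and the delta terms cancel in hcochainE. *)
Definition hcochain (y : cochain X T (fun m => K m)) : cochain X T (fun m => K' m) :=
  fun m x s =>
    match m with
    | 0 => 0
    | m'.+1 => h m' @! (y m' x s)
    end.

Lemma hcochain_linear : linear hcochain.
Proof.
move=> a y z; apply: cochainP => -[|m] x s.
  by rewrite [RHS](_ : _ = a *: 0 + 0) // scaler0 addr0.
exact: (linearP (h m : {linear _ -> _})).
Qed.

Lemma hcochain_tot n y : tot_pred E n y -> tot_pred E' n.+1 (hcochain y).
Proof.
move=> [By gy _]; split=> //.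
- by move=> [|m] x s; [exact: linear0 | rewrite -hE By].
- by move=> [|m] x s //= mn; rewrite gy ?linear0.
Qed.

Lemma hcochainE y :
  totd E' (hcochain y) + hcochain (totd E y) = fun m x s => f m @! (y m x s).
Proof.
apply: cochainP => m x s; have [h0 hS] := hf.
rewrite -[LHS]/(totd E' (hcochain y) m x s + hcochain (totd E y) m x s).
rewrite /totd; case: m => [|m] /=.
  rewrite [delta _ _ _ _ _](_ : _ = 0) ?scaler0 ?addr0; last first.
    by apply: altsum0 => r _; exact: linear0.
  exact/esym/(kmodE _ h0).
have -> : delta E' (hcochain y) m.+1 x s = h m @! (delta E y m x s).
  rewrite /delta (raddf_altsum (f := (h m : {linear _ -> _}))); last exact: linearB.
  by apply: eq_altsum => r _; rewrite /= hE.
rewrite linearD linearZ /= exprS mulN1r scaleNr.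
by rewrite [LHS]addrACA addNr addr0; exact/esym/(kmodE _ (hS m)).
Qed.

End Homotopies.
End CochainMaps.

(** * The rectification functor, from A!-bimodules to presheaves *)

Section CoefLemmas.
Variables (k : comPzRingType) (d : Order.disp_t) (C : porderType d).
Variable A : presheaf k C.
Notation B := (shriek_alg A).

(** The bottom of a chain below h is itself below h, where the action of dg a
    commutes with matrix units. *)
Lemma dg_chain_act b (Y : bimodule B) h s r (a : A h) (z : Y) : subseq r s ->
  lact (dg a : B) (chain_act b h s r z) = chain_act b h s r (lact (dg a : B) z).
Proof.
case: s r => [|p t] [|q u] rs; rewrite /chain_act ?lactr0 //.
case: (boolP (below_chain h _)) => ok; last by rewrite lactr0.
have [/andP[qh _] _ bb] := below_chain_sub ok rs; have [ok' _ _] := below_chain_sub ok rs.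
rewrite -lractA !lactA; congr (ract (lact _ z) _).
exact/esym/arr_dgC/(le_trans (below_chain_last ok') qh).
Qed.

Lemma chain_act_dg (Y : bimodule B) h s r (a : A h) (z : Y) : subseq r s ->
  ract (chain_act true h s r z) (dg a : B) = chain_act true h s r (ract z (dg a : B)).
Proof.
case: s r => [|p t] [|q u] rs; rewrite /chain_act ?ract0 //.
case: (boolP (below_chain h _)) => ok; last by rewrite ract0.
have [_ qp _] := below_chain_sub ok rs; have /andP[ph _] := ok.
rewrite -lractA !ractA; congr (ract (lact _ _) _).
exact: arr_dgC.
Qed.

Lemma chain_act_ract (Y : bimodule B) h s r (x : B) (z : Y) :
  ract (chain_act false h s r z) x = chain_act false h s r (ract z x).
Proof.
rewrite /chain_act; case: s r => [|p t] [|q u]; rewrite ?ract0 //.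
by case: ifP => _; rewrite ?ract0 //= !ract1 lractA.
Qed.

Section Based.
Variables (b : bool) (Y : bimodule B) (h : C).

Lemma chain_fix_l p t (z : Y) : chain_act b h (p :: t) (p :: t) z = z ->
  lact (arr A (last p t) (last p t) : B) z = z.
Proof.
rewrite /chain_act; case: ifP => _ <-; last by rewrite lactr0.
by rewrite -lractA lactA arrM.
Qed.

Lemma chain_fix_below s (z : Y) : chain_act b h s s z = z -> ~~ below_chain h s -> z = 0.
Proof. by case: s => [|p t] <- //= /negbTE ->. Qed.

Lemma lact_dg1 s (z : Y) : chain_act b h s s z = z -> lact (dg (1 : A h) : B) z = z.
Proof.
move=> zE; case: (boolP (below_chain h s)) => [|/(chain_fix_below zE) ->]; last exact: lactr0.
case: s zE => [//|p t] zE ok; have /andP[ph _] := ok.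
rewrite -(chain_fix_l zE) lactA -arr_dgC ?arr_dg1 //;
  exact: le_trans (below_chain_last ok) ph.
Qed.

Lemma lact_dg_kscal s (z : Y) c : chain_act b h s s z = z ->
  lact (dg (kscal (A h) c) : B) z = c *: z.
Proof.
move=> zE; case: (boolP (below_chain h s)) => [|/(chain_fix_below zE) ->]; last first.
  by rewrite lactr0 scaler0.
case: s zE => [//|p t] zE ok; have /andP[ph _] := ok.
have bh := le_trans (below_chain_last ok) ph.
rewrite -{1}(chain_fix_l zE) lactA -arr_dgC // arr_dg_kscal //.
rewrite -[X in lact X _](@kscalC k B c (arr A (last p t) (last p t))).
by rewrite -lactA (chain_fix_l zE) lact_sym.
Qed.

Lemma lact_dg_phi s h' (hh : (h <= h')%O) (a : A h') (z : Y) : chain_act b h s s z = z ->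
  lact (dg (phi A hh a) : B) z = lact (dg a : B) z.
Proof.
move=> zE; case: (boolP (below_chain h s)) => [|/(chain_fix_below zE) ->]; last by rewrite !lactr0.
case: s zE => [//|p t] zE ok; have /andP[ph _] := ok.
have bh := le_trans (below_chain_last ok) ph.
rewrite -(chain_fix_l zE) !lactA -arr_dgC // -arr_dgC //; last exact: le_trans bh hh.
by rewrite arr_dg_phi.
Qed.

End Based.

Section BasedRight.
Variables (Y : bimodule B) (h : C).

Lemma chain_fix_r p t (z : Y) : chain_act true h (p :: t) (p :: t) z = z ->
  ract z (arr A p p : B) = z.
Proof.
rewrite /chain_act; case: ifP => _ <-; last by rewrite ract0.
by rewrite ractA arrM.
Qed.

Lemma ract_dg1 s (z : Y) : chain_act true h s s z = z -> ract z (dg (1 : A h) : B) = z.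
Proof.
move=> zE; case: (boolP (below_chain h s)) => [|/(chain_fix_below zE) ->]; last exact: ract0.
case: s zE => [//|p t] zE /andP[ph _].
by rewrite -(chain_fix_r zE) ractA arr_dg1.
Qed.

Lemma ract_dg_kscal s (z : Y) c : chain_act true h s s z = z ->
  ract z (dg (kscal (A h) c) : B) = c *: z.
Proof.
move=> zE; case: (boolP (below_chain h s)) => [|/(chain_fix_below zE) ->]; last first.
  by rewrite ract0 scaler0.
case: s zE => [//|p t] zE /andP[ph _].
by rewrite -{1}(chain_fix_r zE) ractA arr_dg_kscal // -ractA (chain_fix_r zE) ract_sym.
Qed.

Lemma ract_dg_phi s h' (hh : (h <= h')%O) (a : A h') (z : Y) : chain_act true h s s z = z ->
  ract z (dg (phi A hh a) : B) = ract z (dg a : B).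
Proof.
move=> zE; case: (boolP (below_chain h s)) => [|/(chain_fix_below zE) ->]; last by rewrite !ract0.
case: s zE => [//|p t] zE /andP[ph _].
by rewrite -(chain_fix_r zE) !ractA arr_dg_phi.
Qed.

End BasedRight.
End CoefLemmas.

Section RectificationObjects.
Variables (k : comPzRingType) (d : Order.disp_t) (C : porderType d).
Variable A : presheaf k C.
Notation B := (shriek_alg A).
Variable Y : complex (bimod B).
Notation KY := (Kom_ob (bimod_forget B) Y).

(** The index type is unit since h is fixed: the rectification at h only sees the
    chains below h. *)
Definition rect_coef (h : C) : coefsys unit C KY := chain_coef true (fun _ : unit => h) Y.
Definition rect_car (n : nat) (h : C) : lmodType k := sub_of (tot_sp (rect_coef h) n).
Notation cch := (cochain unit C (fun m => KY m)).

Lemma rect_fix n h (y : rect_car n h) m x s :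
  chain_act true h s s (sv y m x s : (Y m : bimodule B)) = sv y m x s.
Proof. by have [By _ _] := svP y; exact: By. Qed.

Definition lcoch h (a : A h) (y : cch) : cch :=
  fun m x s => lact (dg a : B) (y m x s : (Y m : bimodule B)).
Definition rcoch h (y : cch) (a : A h) : cch :=
  fun m x s => ract (y m x s : (Y m : bimodule B)) (dg a : B).
Definition restr h' (y : cch) : cch :=
  fun m x s => if below_chain h' s then y m x s else 0.

Lemma tot_lcoch n h (a : A h) y : tot_pred (rect_coef h) n y -> tot_pred (rect_coef h) n (lcoch a y).
Proof.
move=> yn; apply: (tot_pt (E := fun=> rect_coef h)) => x.
exists unit, [:: tt], (fun=> x),
  (fun _ m _ z => lact (dg a : B) (z : (Y m : bimodule B))), (fun=> y); split=> //.
- by move=> _ m s; exact: lact_linear.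
- by move=> _ m _ z; exact/esym/(bmorl (cd Y m)).
- by move=> _ m s r z; exact: dg_chain_act.
- by move=> m s; rewrite big_seq1.
Qed.

Lemma tot_rcoch n h (a : A h) y : tot_pred (rect_coef h) n y -> tot_pred (rect_coef h) n (rcoch y a).
Proof.
move=> yn; apply: (tot_pt (E := fun=> rect_coef h)) => x.
exists unit, [:: tt], (fun=> x),
  (fun _ m _ z => ract (z : (Y m : bimodule B)) (dg a : B)), (fun=> y); split=> //.
- by move=> _ m s; exact: ract_linear.
- by move=> _ m _ z; exact/esym/(bmorr (cd Y m)).
- by move=> _ m s r z; exact: chain_act_dg.
- by move=> m s; rewrite big_seq1.
Qed.

Lemma restr_chain_act h' h (hh : (h' <= h)%O) (Z : bimodule B) s r (z : Z) : subseq r s ->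
  (if below_chain h' s then chain_act true h s r z else 0)
  = chain_act true h' s r (if below_chain h' r then z else 0).
Proof.
move=> rs; case: (boolP (below_chain h' s)) => ok; last first.
  by case: s r {rs} ok => [|p t] [|q u] ok //; rewrite /chain_act (negbTE ok).
case: s r rs ok => [|p t] [|q u] rs ok //.
have [ok' _ _] := below_chain_sub ok rs; rewrite ok' /chain_act ok.
by rewrite (below_chain_widen hh ok).
Qed.

Lemma restr_linear m (h' : C) s :
  linear (fun z : KY m => if below_chain h' s then z else 0).
Proof. by move=> c u v; case: ifP => _ //; rewrite scaler0 addr0. Qed.

Lemma restr_d m (h' : C) s z :
  (if below_chain h' s then cd KY m @! z else 0) = cd KY m @! (if below_chain h' s then z else 0).
Proof. by case: ifP => _ //; rewrite linear0. Qed.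

Lemma tot_restr n h' h (hh : (h' <= h)%O) y :
  tot_pred (rect_coef h) n y -> tot_pred (rect_coef h') n (restr h' y).
Proof.
move=> yn; apply: (tot_pt (E := fun=> rect_coef h)) => x.
exists unit, [:: tt], (fun=> x), (fun _ m s z => if below_chain h' s then z else 0), (fun=> y).
split=> //.
- by move=> _ m s; exact: restr_linear.
- by move=> _ m s z; exact: restr_d.
- by move=> _ m s r z; exact: restr_chain_act.
- by move=> m s; rewrite big_seq1.
Qed.

Lemma totd_restr h' h (hh : (h' <= h)%O) y :
  totd (rect_coef h') (restr h' y) = restr h' (totd (rect_coef h) y).
Proof.
apply: cochainP => m x s.
rewrite (@totd_pt _ _ _ _ _ _ (rect_coef h) (rect_coef h') x unit [:: tt] (fun=> x)
   (fun _ m s z => if below_chain h' s then z else 0) (fun=> y)) ?big_seq1 //.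
- by move=> _ m' s'; exact: restr_linear.
- by move=> _ m' s' z; exact: restr_d.
- by move=> _ m' s' r z; exact: restr_chain_act.
- by move=> m' s'; rewrite big_seq1.
Qed.

Section Bim.
Variables (n : nat) (h : C).

Definition rect_l (a : A h) (y : rect_car n h) : rect_car n h :=
  SubOf (S := tot_sp (rect_coef h) n) (tot_lcoch a (svP y)).
Definition rect_r (y : rect_car n h) (a : A h) : rect_car n h :=
  SubOf (S := tot_sp (rect_coef h) n) (tot_rcoch a (svP y)).

Definition rect_bim : bimodule (A h).
Proof.
apply: (@Bimodule k (A h) (rect_car n h) rect_l rect_r).
- move=> a b y; apply: sub_ofP; apply: cochainP => m x s.
  by rewrite /= /lcoch dgD; exact: lactDl.
- move=> a y z; apply: sub_ofP; apply: cochainP => m x s; exact: lactDr.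
- move=> y; apply: sub_ofP; apply: cochainP => m x s.
  exact: (@lact_dg1 _ _ _ _ true (Y m) h s _ (@rect_fix _ _ y m x s)).
- move=> a b y; apply: sub_ofP; apply: cochainP => m x s.
  by rewrite /= /lcoch lactA dgM.
- move=> y z a; apply: sub_ofP; apply: cochainP => m x s; exact: ractDl.
- move=> y a b; apply: sub_ofP; apply: cochainP => m x s.
  by rewrite /= /rcoch dgD; exact: ractDr.
- move=> y; apply: sub_ofP; apply: cochainP => m x s.
  exact: (@ract_dg1 _ _ _ _ (Y m) h s _ (@rect_fix _ _ y m x s)).
- move=> y a b; apply: sub_ofP; apply: cochainP => m x s.
  by rewrite /= /rcoch ractA dgM.
- move=> a y b; apply: sub_ofP; apply: cochainP => m x s; exact: lractA.
- move=> c y; apply: sub_ofP; apply: cochainP => m x s.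
  exact: (@lact_dg_kscal _ _ _ _ true (Y m) h s _ c (@rect_fix _ _ y m x s)).
- move=> c y; apply: sub_ofP; apply: cochainP => m x s.
  exact: (@ract_dg_kscal _ _ _ _ (Y m) h s _ c (@rect_fix _ _ y m x s)).
Defined.

Definition rect_T h' (hh : (h' <= h)%O) (y : rect_car n h) : rect_car n h' :=
  SubOf (S := tot_sp (rect_coef h') n) (tot_restr hh (svP y)).
End Bim.

Lemma restr_fix n h' h (hh : (h' <= h)%O) (y : rect_car n h) m x s :
  chain_act true h' s s (restr h' (sv y) m x s : (Y m : bimodule B)) = restr h' (sv y) m x s.
Proof. exact: (rect_fix (rect_T hh y)). Qed.

(** The restriction is semilinear because dg (phi a) and dg a agree on the rows
    and columns below h'. *)
Definition rect_pbim (n : nat) : pbimodule A.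
Proof.
apply: (@PBimodule k d C A (rect_bim n) (fun h' h hh => @rect_T n h h' hh)).
- move=> i j ij y z; apply: sub_ofP; apply: cochainP => m x s.
  exact: (linearD (mklinear (@restr_linear m i s))).
- move=> i j ij a y; apply: sub_ofP; apply: cochainP => m x s.
  rewrite [RHS](lact_dg_phi ij a (restr_fix ij y m x s)).
  rewrite /= /restr; case: ifP => _; rewrite ?lactr0; reflexivity.
- move=> i j ij y a; apply: sub_ofP; apply: cochainP => m x s.
  rewrite [RHS](ract_dg_phi ij a (restr_fix ij y m x s)).
  rewrite /= /restr; case: ifP => _; rewrite ?ract0; reflexivity.
- move=> i ii y; apply: sub_ofP; apply: cochainP => m x s; rewrite /= /restr.
  by case: (boolP (below_chain i s)) => // /(chain_fix_below (rect_fix y m x s)) ->.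
- move=> h i j hi ij hj y; apply: sub_ofP; apply: cochainP => m x s; rewrite /= /restr.
  by case: (boolP (below_chain h s)) => // ok; rewrite (below_chain_widen hi ok).
Defined.

Lemma totd_lcoch h (a : A h) y :
  totd (rect_coef h) (lcoch a y) = lcoch a (totd (rect_coef h) y).
Proof.
apply: cochainP => m x s.
rewrite (@totd_pt _ _ _ _ _ _ (rect_coef h) (rect_coef h) x unit [:: tt] (fun=> x)
   (fun _ m _ z => lact (dg a : B) (z : (Y m : bimodule B))) (fun=> y)) ?big_seq1 //.
- by move=> _ m' s'; exact: lact_linear.
- by move=> _ m' _ z; exact/esym/(bmorl (cd Y m')).
- by move=> _ m' s' r z; exact: dg_chain_act.
- by move=> m' s'; rewrite big_seq1.
Qed.

Lemma totd_rcoch h (a : A h) y :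
  totd (rect_coef h) (rcoch y a) = rcoch (totd (rect_coef h) y) a.
Proof.
apply: cochainP => m x s.
rewrite (@totd_pt _ _ _ _ _ _ (rect_coef h) (rect_coef h) x unit [:: tt] (fun=> x)
   (fun _ m _ z => ract (z : (Y m : bimodule B)) (dg a : B)) (fun=> y)) ?big_seq1 //.
- by move=> _ m' s'; exact: ract_linear.
- by move=> _ m' _ z; exact/esym/(bmorr (cd Y m')).
- by move=> _ m' s' r z; exact: chain_act_dg.
- by move=> m' s'; rewrite big_seq1.
Qed.

End RectificationObjects.

Section RectificationMorphisms.
Variables (k : comPzRingType) (d : Order.disp_t) (C : porderType d).
Variable A : presheaf k C.
Notation B := (shriek_alg A).
Notation KY Y := (Kom_ob (bimod_forget B) Y).

Section Builder.
Variables (Y Z : complex (bimod B)) (n n' : nat).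
Variable op : C -> cochain unit C (fun m => KY Y m) -> cochain unit C (fun m => KY Z m).
Hypothesis op_lin : forall h, linear (op h).
Hypothesis op_tot : forall h y, tot_pred (rect_coef Y h) n y -> tot_pred (rect_coef Z h) n' (op h y).
Hypothesis op_l : forall h (a : A h) y, op h (lcoch a y) = lcoch a (op h y).
Hypothesis op_r : forall h (a : A h) y, op h (rcoch y a) = rcoch (op h y) a.
Hypothesis op_T : forall h' h y, (h' <= h)%O -> op h' (restr h' y) = restr h' (op h y).

Definition rect_op h (y : rect_bim Y n h) : rect_bim Z n' h :=
  SubOf (S := tot_sp (rect_coef Z h) n') (op_tot (svP y)).

Fact rect_op_linear h : linear (@rect_op h).
Proof. by move=> a y z; apply: sub_ofP; exact: op_lin. Qed.

Definition rect_bim_mor h : bimod_mor (rect_bim Y n h) (rect_bim Z n' h).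
Proof.
exists (mklinear (@rect_op_linear h)).
- by move=> a y; apply: sub_ofP; exact: op_l.
- by move=> y a; apply: sub_ofP; exact: op_r.
Defined.

Definition rect_mor : pbimod_mor (rect_pbim Y n) (rect_pbim Z n').
Proof.
exists rect_bim_mor => i j ij y; apply: sub_ofP.
exact: (op_T (sv y) ij).
Defined.
End Builder.

Section Differential.
Variable Y : complex (bimod B).

Definition rect_d n : pbimod_mor (rect_pbim Y n.+1) (rect_pbim Y n) :=
  rect_mor (fun h => totd_linear (rect_coef Y h))
    (fun h y yn => tot_totd yn) (fun h a y => totd_lcoch a y)
    (fun h a y => totd_rcoch a y) (fun h' h y hh => totd_restr hh y).

Fact rect_dd n : pcmp (rect_d n : pmor (_ : pbimod A) _) (rect_d n.+1) = 0.
Proof. by apply: pbimod_morP => h y; apply: sub_ofP; exact: totdd. Qed.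

Definition rect_ob : complex (pbimod A) := Complex rect_dd.
End Differential.

Section Map.
Variables (Y Z : complex (bimod B)) (f : chain_map Y Z).
Notation fK := (Kom_map (bimod_forget B) f).

Lemma fK_coef h x s r m y :
  fK m @! (cf (rect_coef Y h) x s r m @! y) = cf (rect_coef Z h) x s r m @! (fK m @! y).
Proof. exact: bimod_chain_act. Qed.

Definition rect_map_n n : pbimod_mor (rect_pbim Y n) (rect_pbim Z n).
Proof.
apply: (@rect_mor Y Z n n (fun h => fcochain fK)).
- by move=> h; exact: fcochain_linear.
- by move=> h y; exact: (tot_fcochain (@fK_coef h)).
- by move=> h a y; apply: cochainP => m x s; exact: (bmorl (f m)).
- by move=> h a y; apply: cochainP => m x s; exact: (bmorr (f m)).
- move=> h' h y hh; apply: cochainP => m x s; rewrite /fcochain /restr.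
  by case: ifP => _ //; exact: linear0.
Defined.

Fact rect_map_d n :
  pcmp (rect_map_n n : pmor (_ : pbimod A) _) (cd (rect_ob Y) n)
  = pcmp (cd (rect_ob Z) n) (rect_map_n n.+1).
Proof.
apply: pbimod_morP => h y; apply: sub_ofP.
exact/esym/(totd_fcochain (@fK_coef h)).
Qed.

Definition rect_map : chain_map (rect_ob Y) (rect_ob Z) :=
  @ChainMap (pbimod A) (rect_ob Y) (rect_ob Z) rect_map_n rect_map_d.

Definition rect_realizes_of (W : complex (bimod B)) (h : C) :
  realizes (rect_coef W h) (Kom_ob (pbimod_at A h) (rect_ob W)).
Proof.
exists (fun n (y : rect_car W n h) => sv y).
- by [].
- by move=> n y z; exact: sub_ofP.
- by move=> n y; exact: (@svP k _ (tot_sp (rect_coef W h) n) y).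
- by move=> n y yn; exists (SubOf (S := tot_sp (rect_coef W h) n) yn : rect_car W n h).
- by [].
Defined.

Lemma rect_rel_qis : rel_qis_bimod f -> rel_qis_pbimod rect_map.
Proof.
move=> fq h; apply: (cone_tot_contractible (@fK_coef h)
  (R := rect_realizes_of Y h) (R' := rect_realizes_of Z h)) fq.
by [].
Qed.

End Map.

Lemma rect_map1 (Y : complex (bimod B)) : rect_map (chain_id Y) = chain_id (rect_ob Y).
Proof.
by apply: chain_mapP => n; apply: pbimod_morP => h y; apply: sub_ofP.
Qed.

Lemma rect_mapM (Y Z W : complex (bimod B)) (g : chain_map Z W) (f : chain_map Y Z) :
  rect_map (chain_cmp g f) = chain_cmp (rect_map g) (rect_map f).
Proof.
by apply: chain_mapP => n; apply: pbimod_morP => h y; apply: sub_ofP.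
Qed.

Definition rect_functor : functor (Kom (bimod B)) (Kom (pbimod A)) :=
  @Functor (Kom (bimod B)) (Kom (pbimod A)) rect_ob rect_map rect_map1 rect_mapM.

Section Homotopy.
Variables (Y Z : complex (bimod B)) (f g : chain_map Y Z).
Variable s : forall m, bimod_mor (Y m) (Z m.+1).
Hypothesis sP : null_homotopy (fun n => f n - g n) (s : forall m, pmor (Y m) (Z m.+1)).

Let sK m : kmod_mor (KY Y m) (KY Z m.+1) := (s m : {linear _ -> _}).
Let fgK m : kmod_mor (KY Y m) (KY Z m) :=
  ((f m : kmod_mor (KY Y m) (KY Z m)) - (g m : kmod_mor _ _)).

Lemma sK_homotopy : @null_homotopy (kmod k) (KY Y) (KY Z) fgK sK.
Proof.
have [s0 sS] := sP; split=> [|m]; apply: linearP_eq => y.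
  exact: (congr1 (fun q : bimod_mor _ _ => q y) s0).
exact: (congr1 (fun q : bimod_mor _ _ => q y) (sS m)).
Qed.

Lemma sK_coef h x t r m y :
  sK m @! (cf (rect_coef Y h) x t r m @! y) = cf (rect_coef Z h) x t r m.+1 @! (sK m @! y).
Proof. exact: bimod_chain_act. Qed.

Definition rect_s n : pbimod_mor (rect_pbim Y n) (rect_pbim Z n.+1).
Proof.
apply: (@rect_mor Y Z n n.+1 (fun h => hcochain sK)).
- by move=> h; exact: hcochain_linear.
- by move=> h y; exact: (hcochain_tot (@sK_coef h)).
- move=> h a y; apply: cochainP => -[|m] x t /=; last exact: (bmorl (s m)).
  by rewrite /lcoch /= lactr0.
- move=> h a y; apply: cochainP => -[|m] x t /=; last exact: (bmorr (s m)).
  by rewrite /rcoch /= ract0.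
- move=> h' h y hh; apply: cochainP => -[|m] x t; rewrite /hcochain /restr.
    by case: ifP.
  by case: ifP => _ //; exact: linear0.
Defined.

Lemma rect_homotopic : homotopic (rect_map f) (rect_map g).
Proof.
exists rect_s; split=> [|n]; apply: pbimod_morP => h y; apply: sub_ofP; last first.
  exact/esym/(hcochainE sK_homotopy (@sK_coef h)).
have := hcochainE sK_homotopy (@sK_coef h) (sv y).
have [_ _ ->] := svP y => //.
rewrite -[hcochain sK 0]/(mklinear (hcochain_linear sK) 0) linear0 addr0 => E.
exact: esym E.
Qed.
End Homotopy.

Lemma rect_functor_homotopic (Y Z : complex (bimod B)) (f g : chain_map Y Z) :
  homotopic f g -> homotopic (rect_map f) (rect_map g).
Proof. by move=> [s sP]; exact: (rect_homotopic sP). Qed.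

Definition rect_K : functor (homotopy_cat (bimod B)) (homotopy_cat (pbimod A)) :=
  @quot_functor _ _ (homotopy_congr (bimod B)) (homotopy_congr (pbimod A))
    rect_functor rect_functor_homotopic.

Lemma rect_KE (Y Z : complex (bimod B)) (f : chain_map Y Z) :
  fmor rect_K (qcls (homotopy_congr (bimod B)) f : @mor (homotopy_cat (bimod B)) Y Z)
  = qcls (homotopy_congr (pbimod A)) (rect_map f).
Proof.
exact: (@qfmorE _ _ (homotopy_congr (bimod B)) (homotopy_congr (pbimod A)) rect_functor
  rect_functor_homotopic Y Z f).
Qed.

Lemma rect_K_Sigma (Y Z : homotopy_cat (bimod B)) (q : mor Y Z) :
  Sigma_bimod q -> Sigma_pbimod (fmor rect_K q).
Proof.
move=> [f fq ->]; exists (rect_map f); first exact: rect_rel_qis.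
exact: rect_KE.
Qed.

End RectificationMorphisms.

(** * The cobar functor on A!-bimodules *)

Section FiniteSums.
Variables (T : choiceType) (V : zmodType).

Lemma fsumE (F : T -> V) (s : seq T) : uniq s -> (forall i, i \notin s -> F i = 0) ->
  \sum_(i \in [set: T]) F i = \sum_(i <- s) F i.
Proof.
move=> us F0; rewrite (fsbigE s) //; last by move=> i _ /F0.
by apply: eq_bigl => i; rewrite in_setT.
Qed.

End FiniteSums.

Lemma rf_supp2 (d : Order.disp_t) (C : porderType d) (V W : C -> zmodType)
    (m : rfmat V) (n : rfmat W) i : exists2 s : seq C, uniq s &
  forall j, j \notin s -> m i j = 0 /\ n i j = 0.
Proof.
have [s us s0] := rf_supp m i; have [t ut t0] := rf_supp n i.
exists (undup (s ++ t)); first exact: undup_uniq.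
by move=> j; rewrite mem_undup mem_cat negb_or => /andP[/s0 -> /t0 ->].
Qed.

Lemma rf_supp_seq (d : Order.disp_t) (C : porderType d) (V : C -> zmodType)
    (m : rfmat V) (S : seq C) : exists2 R : seq C, uniq R &
  forall i j, i \in S -> j \notin R -> m i j = 0.
Proof.
pose r i := s2val (cid2 (rf_supp m i)).
have r0 i j : j \notin r i -> m i j = 0 by apply: s2valP' (cid2 (rf_supp m i)) j.
exists (undup (flatten [seq r i | i <- S])); first exact: undup_uniq.
move=> i j iS jR; apply: r0; apply: contra jR => ji.
by rewrite mem_undup; apply/flatten_mapP; exists i.
Qed.

Section CobarObjects.
Variables (k : comPzRingType) (d : Order.disp_t) (C : porderType d).
Variable A : presheaf k C.
Notation B := (shriek_alg A).
Variable Y : complex (bimod B).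
Notation KY := (Kom_ob (bimod_forget B) Y).

(** The index h of a cochain is a row index; the chains of row h are those below
    h. *)
Definition cobar_coef : coefsys C C KY := chain_coef false (fun h : C => h) Y.
Definition cobar_car (n : nat) : lmodType k := sub_of (tot_sp cobar_coef n).
Notation cch := (cochain C C (fun m => KY m)).
Implicit Types x : shriek_ring A.

Lemma cobar_fix n (y : cobar_car n) m h s :
  chain_act false h s s (sv y m h s : (Y m : bimodule B)) = sv y m h s.
Proof. by have [By _ _] := svP y; exact: By. Qed.

Definition lact_term (x : shriek_ring A) (h j : C) m s (z : KY m) : KY m :=
  if below_chain h s then lact (dg (x h j) : B) (z : (Y m : bimodule B)) else 0.

(** Left multiplication of a column of cochains by the matrix x, rows being
    restricted to smaller chains along the way. *)
Definition lcobar (x : B) (y : cch) : cch :=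
  fun m h s => \sum_(j \in [set: C]) lact_term x h j s (y m j s).

Definition rcobar (y : cch) (x : B) : cch :=
  fun m h s => ract (y m h s : (Y m : bimodule B)) x.

Lemma lact_term0 x h j m s (z : KY m) : x h j = 0 -> lact_term x h j s z = 0.
Proof. by rewrite /lact_term => ->; case: ifP => // _; rewrite dg0 lact0. Qed.

Lemma lcobarE x y m h s (S : seq C) : uniq S -> (forall j, j \notin S -> x h j = 0) ->
  lcobar x y m h s = \sum_(j <- S) lact_term x h j s (y m j s).
Proof. by move=> uS S0; apply: fsumE => // j /S0; exact: lact_term0. Qed.

Lemma lact_term_linear x h j m s : linear (@lact_term x h j m s).
Proof.
by move=> c u v; rewrite /lact_term; case: ifP => _; [exact: lact_linear | rewrite scaler0 addr0].
Qed.

Lemma lact_term_d x h j m s z : lact_term x h j s (cd KY m @! z) = cd KY m @! (lact_term x h j s z).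
Proof.
rewrite /lact_term; case: ifP => _; last by rewrite linear0.
exact/esym/(bmorl (cd Y m)).
Qed.

Lemma lact_term_coef x h j m s r (z : KY m) : subseq r s ->
  lact_term x h j s (cf cobar_coef j s r m @! z) = cf cobar_coef h s r m @! (lact_term x h j r z).
Proof.
move=> rs; rewrite /lact_term -![cf cobar_coef _ _ _ _ @! _]/(chain_act false _ _ _ _).
case: (boolP (below_chain h s)) => ok; last first.
  by case: s r {rs} ok => [|p t] [|q u] ok //; rewrite /chain_act (negbTE ok).
case: s r rs ok => [|p t] [|q u] rs ok //; first by rewrite lactr0.
have [ok' _ _] := below_chain_sub ok rs; rewrite ok'.
case: (boolP (h <= j)%O) => hj; last by rewrite rfm_upper // dg0 !lact0 chain_act0.
by rewrite -(dg_chain_act false _ _ rs) /chain_act ok (below_chain_widen hj ok).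
Qed.

Lemma tot_lcobar n x y : tot_pred cobar_coef n y -> tot_pred cobar_coef n (lcobar x y).
Proof.
move=> yn; apply: (tot_pt (E := fun=> cobar_coef)) => h.
have [S uS S0] := rf_supp x h.
exists C, S, id, (lact_term x h), (fun=> y); split=> //.
- by move=> j m s; exact: lact_term_linear.
- by move=> j m s z; exact: lact_term_d.
- by move=> j m s r z; exact: lact_term_coef.
- by move=> m s; exact: lcobarE.
Qed.

Lemma totd_lcobar x y : totd cobar_coef (lcobar x y) = lcobar x (totd cobar_coef y).
Proof.
apply: cochainP => m h s; have [S uS S0] := rf_supp x h.
rewrite (lcobarE _ _ _ uS S0).
apply: (@totd_pt _ _ _ _ _ _ cobar_coef cobar_coef h C S id (lact_term x h) (fun=> y)).
- by move=> j m' s'; exact: lact_term_linear.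
- by move=> j m' s' z; exact: lact_term_d.
- by move=> j m' s' r z; exact: lact_term_coef.
- by move=> m' s'; exact: lcobarE.
Qed.

Lemma tot_rcobar n x y : tot_pred cobar_coef n y -> tot_pred cobar_coef n (rcobar y x).
Proof.
move=> yn; apply: (tot_pt (E := fun=> cobar_coef)) => h.
exists unit, [:: tt], (fun=> h), (fun _ m _ z => ract (z : (Y m : bimodule B)) x), (fun=> y).
split=> //.
- by move=> _ m s; exact: ract_linear.
- by move=> _ m s z; exact/esym/(bmorr (cd Y m)).
- by move=> _ m s r z _; exact: chain_act_ract.
- by move=> m s; rewrite big_seq1.
Qed.

Lemma totd_rcobar x y : totd cobar_coef (rcobar y x) = rcobar (totd cobar_coef y) x.
Proof.
apply: cochainP => m h s.
rewrite (@totd_pt _ _ _ _ _ _ cobar_coef cobar_coef h unit [:: tt] (fun=> h)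
  (fun _ m _ z => ract (z : (Y m : bimodule B)) x) (fun=> y)) ?big_seq1 //.
- by move=> _ m' s'; exact: ract_linear.
- by move=> _ m' s' z; exact/esym/(bmorr (cd Y m')).
- by move=> _ m' s' r z _; exact: chain_act_ract.
- by move=> m' s'; rewrite big_seq1.
Qed.

Section Bim.
Variable n : nat.
Implicit Types y z : cobar_car n.

Definition cobar_l (x : B) y : cobar_car n :=
  SubOf (S := tot_sp cobar_coef n) (tot_lcobar x (svP y)).
Definition cobar_r y (x : B) : cobar_car n :=
  SubOf (S := tot_sp cobar_coef n) (tot_rcobar x (svP y)).

Lemma cobar_lDl x x' y : cobar_l (x + x') y = cobar_l x y + cobar_l x' y.
Proof.
apply: sub_ofP; apply: cochainP => m h s.
have [S uS S0] := rf_supp2 x x' h.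
rewrite -[RHS]/(lcobar x (sv y) m h s + lcobar x' (sv y) m h s).
rewrite [LHS](@lcobarE _ _ _ _ _ S uS) => [|j jS]; last first.
  by have [e e'] := S0 j jS; rewrite -[LHS]/(x h j + x' h j) e e' addr0.
rewrite (@lcobarE x _ _ _ _ S uS) => [|j /S0 []//].
rewrite (@lcobarE x' _ _ _ _ S uS) => [|j /S0 []//].
rewrite -big_split; apply: eq_bigr => j _; rewrite /= /lact_term.
case: ifP => _; last by rewrite addr0.
by rewrite -[(x + x') h j]/(x h j + x' h j) dgD lactDl.
Qed.

Lemma cobar_lDr x y z : cobar_l x (y + z) = cobar_l x y + cobar_l x z.
Proof.
apply: sub_ofP; apply: cochainP => m h s; have [S uS S0] := rf_supp x h.
rewrite -[RHS]/(lcobar x (sv y) m h s + lcobar x (sv z) m h s).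
rewrite [LHS](lcobarE _ _ _ uS S0) !(lcobarE _ _ _ uS S0) -big_split.
by apply: eq_bigr => j _; exact: (linearD (mklinear (@lact_term_linear x h j m s))).
Qed.

Lemma cobar_l1 y : cobar_l 1 y = y.
Proof.
apply: sub_ofP; apply: cochainP => m h s.
rewrite [LHS](@lcobarE _ _ _ _ _ [:: h]) => [|//|j]; last first.
  by rewrite inE eq_sym => /negbTE jh; rewrite /= jh.
rewrite big_seq1 /lact_term /= eqxx; case: (boolP (below_chain h s)) => ok.
  exact: (@lact_dg1 _ _ _ _ false (Y m) h s _ (@cobar_fix _ y m h s)).
exact/esym/(chain_fix_below (@cobar_fix _ y m h s)).
Qed.

(** Associativity reduces to the formula for the entries of x * x', since the
    value at a chain p :: t is fixed by the idempotent of its bottom, which is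
    below h. *)
Lemma cobar_lA x x' y : cobar_l x (cobar_l x' y) = cobar_l (x * x') y.
Proof.
apply: sub_ofP; apply: cochainP => m h s.
rewrite -[LHS]/(lcobar x (lcobar x' (sv y)) m h s) -[RHS]/(lcobar (x * x') (sv y) m h s).
have [S uS S0] := rf_supp x h.
have [R uR R0] := rf_supp_seq x' S.
have xx0 l : l \notin R -> (x * x') h l = 0.
  move=> lR; rewrite [(x * x') h l](@rf_mulE _ _ _ (ps_ab A) _ _ (@mulD _ _ _ A) _ _ h l S) //.
  by rewrite big_seq big1 // => i iS; rewrite (R0 _ _ iS lR) ext_map0 mulr0.
rewrite (lcobarE _ _ _ uS S0) (lcobarE _ _ _ uR xx0).
case: (boolP (below_chain h s)) => ok; last first.
  by rewrite !big1 // => i _; rewrite /lact_term (negbTE ok).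
transitivity (\sum_(j <- S) \sum_(l <- R) lact (dg (x h j) : B)
    (lact (dg (x' j l) : B) (sv y m l s : (Y m : bimodule B)))).
  rewrite big_seq [RHS]big_seq; apply: eq_bigr => j jS; rewrite /lact_term ok.
  case: (boolP (h <= j)%O) => hj; last first.
    by rewrite rfm_upper // dg0 lact0 big1 // => l _; rewrite lact0.
  rewrite (lcobarE _ _ _ uR (fun l => R0 j l jS)) lact_sumr; apply: eq_bigr => l _.
  by rewrite /lact_term (below_chain_widen hj ok).
rewrite exchange_big; apply: eq_bigr => l _ /=; rewrite /lact_term ok.
case: s ok => [//|p t] ok; have /andP[ph _] := ok.
have bh := le_trans (below_chain_last ok) ph.
rewrite -[sv y m l _](chain_fix_l (@cobar_fix _ y m l (p :: t))) [RHS]lactA.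
rewrite -arr_dgC // (arr_dg_mul _ _ bh uS S0) lact_suml; apply: eq_bigr => j _.
by rewrite !lactA dgmM arr_dgmC.
Qed.

Lemma cobar_lr x y (z : B) : cobar_r (cobar_l x y) z = cobar_l x (cobar_r y z).
Proof.
apply: sub_ofP; apply: cochainP => m h s; have [S uS S0] := rf_supp x h.
rewrite -[LHS]/(ract (lcobar x (sv y) m h s : (Y m : bimodule B)) z).
rewrite [RHS](lcobarE _ _ _ uS S0) (lcobarE _ _ _ uS S0) ract_suml; apply: eq_bigr => j _.
by rewrite /lact_term; case: ifP => _; [exact: lractA | exact: ract0].
Qed.

Lemma cobar_l_kscal c y : cobar_l (kscal B c) y = c *: y.
Proof.
apply: sub_ofP; apply: cochainP => m h s.
rewrite [LHS](@lcobarE _ _ _ _ _ [:: h]) => [|//|j]; last first.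
  by rewrite inE eq_sym => /negbTE jh; rewrite /= jh.
rewrite big_seq1 /lact_term /= eqxx; case: (boolP (below_chain h s)) => ok.
  exact: (@lact_dg_kscal _ _ _ _ false (Y m) h s _ c (@cobar_fix _ y m h s)).
rewrite -[RHS]/(c *: sv y m h s) (chain_fix_below (@cobar_fix _ y m h s) ok).
exact/esym/scaler0.
Qed.

Definition cobar_bim : bimodule B.
Proof.
apply: (@Bimodule k B (cobar_car n) cobar_l cobar_r).
- exact: cobar_lDl.
- exact: cobar_lDr.
- exact: cobar_l1.
- exact: cobar_lA.
- move=> y z a; apply: sub_ofP; apply: cochainP => m x s; exact: ractDl.
- move=> y a b; apply: sub_ofP; apply: cochainP => m x s; exact: ractDr.
- move=> y; apply: sub_ofP; apply: cochainP => m x s; exact: ract1.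
- move=> y a b; apply: sub_ofP; apply: cochainP => m x s; exact: ractA.
- by move=> a y b; exact: cobar_lr.
- exact: cobar_l_kscal.
- move=> c y; apply: sub_ofP; apply: cochainP => m x s.
  exact: (@ract_sym k B (Y m) c (sv y m x s)).
Defined.

End Bim.
End CobarObjects.

Section CobarMorphisms.
Variables (k : comPzRingType) (d : Order.disp_t) (C : porderType d).
Variable A : presheaf k C.
Notation B := (shriek_alg A).
Notation KY Y := (Kom_ob (bimod_forget B) Y).

Section Builder.
Variables (Y Z : complex (bimod B)) (n n' : nat).
Variable op : cochain C C (fun m => KY Y m) -> cochain C C (fun m => KY Z m).
Hypothesis op_lin : linear op.
Hypothesis op_tot : forall y, tot_pred (cobar_coef Y) n y -> tot_pred (cobar_coef Z) n' (op y).
Hypothesis op_l : forall x y, op (lcobar x y) = lcobar x (op y).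
Hypothesis op_r : forall x y, op (rcobar y x) = rcobar (op y) x.

Definition cobar_op (y : cobar_bim Y n) : cobar_bim Z n' :=
  SubOf (S := tot_sp (cobar_coef Z) n') (op_tot (svP y)).

Fact cobar_op_linear : linear cobar_op.
Proof. by move=> a y z; apply: sub_ofP; exact: op_lin. Qed.

Definition cobar_mor : bimod_mor (cobar_bim Y n) (cobar_bim Z n').
Proof.
exists (mklinear cobar_op_linear).
- by move=> a y; apply: sub_ofP; exact: op_l.
- by move=> y a; apply: sub_ofP; exact: op_r.
Defined.
End Builder.

Section Differential.
Variable Y : complex (bimod B).

Definition cobar_d n : bimod_mor (cobar_bim Y n.+1) (cobar_bim Y n) :=
  cobar_mor (totd_linear (cobar_coef Y)) (fun y yn => tot_totd yn)
    (fun x y => totd_lcobar x y) (fun x y => totd_rcobar x y).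

Fact cobar_dd n : pcmp (cobar_d n : pmor (_ : bimod B) _) (cobar_d n.+1) = 0.
Proof. by apply: bimod_morP => y; apply: sub_ofP; exact: totdd. Qed.

Definition cobar_ob : complex (bimod B) := Complex cobar_dd.
End Differential.

Section Map.
Variables (Y Z : complex (bimod B)) (f : chain_map Y Z).
Notation fK := (Kom_map (bimod_forget B) f).

Lemma fK_cobar x s r m y :
  fK m @! (cf (cobar_coef Y) x s r m @! y) = cf (cobar_coef Z) x s r m @! (fK m @! y).
Proof. exact: bimod_chain_act. Qed.

Definition cobar_map_n n : bimod_mor (cobar_bim Y n) (cobar_bim Z n).
Proof.
apply: (@cobar_mor Y Z n n (fcochain fK)).
- exact: fcochain_linear.
- by move=> y; exact: (tot_fcochain fK_cobar).
- move=> x y; apply: cochainP => m h s; have [S uS S0] := rf_supp x h.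
  rewrite /fcochain !(lcobarE _ _ _ uS S0) linear_sum; apply: eq_bigr => j _.
  by rewrite /lact_term; case: ifP => _; [exact: (bmorl (f m)) | exact: linear0].
- by move=> x y; apply: cochainP => m h s; exact: (bmorr (f m)).
Defined.

Fact cobar_map_d n :
  pcmp (cobar_map_n n : pmor (_ : bimod B) _) (cd (cobar_ob Y) n)
  = pcmp (cd (cobar_ob Z) n) (cobar_map_n n.+1).
Proof.
apply: bimod_morP => y; apply: sub_ofP; exact/esym/(totd_fcochain fK_cobar).
Qed.

Definition cobar_map : chain_map (cobar_ob Y) (cobar_ob Z) :=
  @ChainMap (bimod B) (cobar_ob Y) (cobar_ob Z) cobar_map_n cobar_map_d.

Definition cobar_realizes_of (W : complex (bimod B)) :
  realizes (cobar_coef W) (Kom_ob (bimod_forget B) (cobar_ob W)).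
Proof.
exists (fun n (y : cobar_car W n) => sv y).
- by [].
- by move=> n y z; exact: sub_ofP.
- by move=> n y; exact: (@svP k _ (tot_sp (cobar_coef W) n) y).
- by move=> n y yn; exists (SubOf (S := tot_sp (cobar_coef W) n) yn : cobar_car W n).
- by [].
Defined.

Lemma cobar_rel_qis : rel_qis_bimod f -> rel_qis_bimod cobar_map.
Proof.
move=> fq; apply: (cone_tot_contractible fK_cobar
  (R := cobar_realizes_of Y) (R' := cobar_realizes_of Z)) fq.
by [].
Qed.

End Map.

Lemma cobar_map1 (Y : complex (bimod B)) : cobar_map (chain_id Y) = chain_id (cobar_ob Y).
Proof.
by apply: chain_mapP => n; apply: bimod_morP => y; apply: sub_ofP.
Qed.

Lemma cobar_mapM (Y Z W : complex (bimod B)) (g : chain_map Z W) (f : chain_map Y Z) :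
  cobar_map (chain_cmp g f) = chain_cmp (cobar_map g) (cobar_map f).
Proof.
by apply: chain_mapP => n; apply: bimod_morP => y; apply: sub_ofP.
Qed.

Definition cobar_functor : functor (Kom (bimod B)) (Kom (bimod B)) :=
  @Functor (Kom (bimod B)) (Kom (bimod B)) cobar_ob cobar_map cobar_map1 cobar_mapM.

Section Homotopy.
Variables (Y Z : complex (bimod B)) (f g : chain_map Y Z).
Variable s : forall m, bimod_mor (Y m) (Z m.+1).
Hypothesis sP : null_homotopy (fun n => f n - g n) (s : forall m, pmor (Y m) (Z m.+1)).

Let sK m : kmod_mor (KY Y m) (KY Z m.+1) := (s m : {linear _ -> _}).

Lemma sK_cobar x t r m y :
  sK m @! (cf (cobar_coef Y) x t r m @! y) = cf (cobar_coef Z) x t r m.+1 @! (sK m @! y).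
Proof. exact: bimod_chain_act. Qed.

Definition cobar_s n : bimod_mor (cobar_bim Y n) (cobar_bim Z n.+1).
Proof.
apply: (@cobar_mor Y Z n n.+1 (hcochain sK)).
- exact: hcochain_linear.
- by move=> y; exact: (hcochain_tot sK_cobar).
- move=> x y; apply: cochainP => -[|m] h t; have [S uS S0] := rf_supp x h.
    rewrite (lcobarE _ _ _ uS S0) big1 // => j _; exact: (linear0 (mklinear (@lact_term_linear _ _ _ _ Z x h j 0 t))).
  rewrite /hcochain !(lcobarE _ _ _ uS S0) linear_sum; apply: eq_bigr => j _.
  by rewrite /lact_term; case: ifP => _; [exact: (bmorl (s m)) | exact: linear0].
- move=> x y; apply: cochainP => -[|m] h t /=; last exact: (bmorr (s m)).
  by rewrite /rcobar /= ract0.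
Defined.

Lemma cobar_homotopic : homotopic (cobar_map f) (cobar_map g).
Proof.
exists cobar_s; split=> [|n]; apply: bimod_morP => y; apply: sub_ofP; last first.
  exact/esym/(hcochainE (sK_homotopy sP) sK_cobar).
have := hcochainE (sK_homotopy sP) sK_cobar (sv y).
have [_ _ ->] := svP y => //.
rewrite -[hcochain _ 0]/(mklinear (hcochain_linear sK) 0) linear0 addr0 => E.
exact: esym E.
Qed.
End Homotopy.

Lemma cobar_functor_homotopic (Y Z : complex (bimod B)) (f g : chain_map Y Z) :
  homotopic f g -> homotopic (cobar_map f) (cobar_map g).
Proof. by move=> [s sP]; exact: (cobar_homotopic sP). Qed.

Definition cobar_K : functor (homotopy_cat (bimod B)) (homotopy_cat (bimod B)) :=
  @quot_functor _ _ (homotopy_congr (bimod B)) (homotopy_congr (bimod B))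
    cobar_functor cobar_functor_homotopic.

Lemma cobar_KE (Y Z : complex (bimod B)) (f : chain_map Y Z) :
  fmor cobar_K (qcls (homotopy_congr (bimod B)) f : @mor (homotopy_cat (bimod B)) Y Z)
  = qcls (homotopy_congr (bimod B)) (cobar_map f).
Proof.
exact: (@qfmorE _ _ (homotopy_congr (bimod B)) (homotopy_congr (bimod B)) cobar_functor
  cobar_functor_homotopic Y Z f).
Qed.

Lemma cobar_K_Sigma (Y Z : homotopy_cat (bimod B)) (q : mor Y Z) :
  Sigma_bimod q -> Sigma_bimod (fmor cobar_K q).
Proof.
move=> [f fq ->]; exists (cobar_map f); first exact: cobar_rel_qis.
exact: cobar_KE.
Qed.

End CobarMorphisms.

(** * Coning off chains at their upper bound *)

Section Place.
Variable k : comPzRingType.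

(** The family with value v in degree n and 0 elsewhere. *)
Definition place (V : nat -> lmodType k) n (v : V n) m : V m :=
  match @eqP _ n m with
  | ReflectT e => eq_rect n (fun i => V i : Type) v m e
  | ReflectF _ => 0
  end.

Lemma place_same (V : nat -> lmodType k) n (v : V n) : place v n = v.
Proof. by rewrite /place; case: eqP => // e; rewrite (eq_axiomK e). Qed.

Lemma place_neq (V : nat -> lmodType k) n (v : V n) m : n != m -> place v m = 0.
Proof. by rewrite /place; case: eqP. Qed.

Lemma place_map (V W : nat -> lmodType k) (f : forall m, V m -> W m) n (v : V n) m :
  f m 0 = 0 -> f m (place v m) = place (V := W) (f n v) m.
Proof.
move=> f0; case: (eqVneq n m) => [<-|nm]; first by rewrite !place_same.
by rewrite !place_neq.
Qed.

Lemma place_linear (V : nat -> lmodType k) n m : linear (fun v : V n => place v m).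
Proof.
move=> a u v; case: (eqVneq n m) => [<-|nm]; first by rewrite !place_same.
by rewrite !place_neq // scaler0 addr0.
Qed.

Lemma place_sum (V : nat -> lmodType k) n m (I : Type) (s : seq I) (F : I -> V n) :
  place (\sum_(i <- s) F i) m = \sum_(i <- s) place (F i) m.
Proof. exact: (linear_sum (mklinear (@place_linear V n m))). Qed.

Lemma place_d (K : complex (kmod k)) n (v : K n.+1) m :
  cd K m @! (place (V := fun i => K i) v m.+1)
  = place (V := fun i => K i) (cd K n @! v) m.
Proof.
case: (eqVneq n m) => [<-|nm]; first by rewrite !place_same.
by rewrite !place_neq ?eqSS // linear0.
Qed.

Lemma place_d0 (K : complex (kmod k)) (v : K 0%N) m :
  cd K m @! (place (V := fun i => K i) v m.+1) = 0.
Proof. by rewrite place_neq // linear0. Qed.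

End Place.

Section Sdr.
Variables (k : comPzRingType) (K K' : complex (kmod k)) (f : chain_map K K').
Variables (g : forall n, K' n -> K n) (H : forall n, K' n -> K' n.+1).
Hypothesis g_linear : forall n, linear (@g n).
Hypothesis H_linear : forall n, linear (@H n).
Hypothesis gd : forall n z, g (cd K' n @! z) = cd K n @! (g z).
Hypothesis gf : forall n y, g (f n @! y) = y.
Hypothesis Hf : forall n y, H (f n @! y) = 0.
Hypothesis H0 : forall z : K' 0%N, cd K' 0 @! (H z) + f 0%N @! (g z) = z.
Hypothesis HS : forall n (z : K' n.+1),
  cd K' n.+1 @! (H z) + H (cd K' n @! z) + f n.+1 @! (g z) = z.

(** With H f = 0 the pair (H, g) contracts the cone of f, with no correction
    term. *)
Lemma sdr_contractible : contractible (cone f).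
Proof.
pose s n : cone f n -> cone f n.+1 :=
  match n with
  | 0 => fun z => (H z, g z)
  | n'.+1 => fun w => (H w.1, g w.1)
  end.
have slin n : linear (s n).
  by case: n => [|n] a y z; congr pair; exact: H_linear || exact: g_linear.
exists (fun n => mklinear (slin n) : kmod_mor _ _); split=> [|n].
  by apply: linearP_eq => z; exact/esym/H0.
apply: linearP_eq => -[z y].
have Hadd m u v : H (u + v : K' m) = H u + H v := linearD (mklinear (@H_linear m)) u v.
have gadd m u v : g (u + v : K' m) = g u + g v := linearD (mklinear (@g_linear m)) u v.
case: n z y => [|n] z y.
  rewrite [RHS](_ : _ = ((cd K' 1 @! (H z) + f 1%N @! (g z), - (cd K 0 @! (g z)))
    + (H (cd K' 0 @! z + f 0%N @! y), g (cd K' 0 @! z + f 0%N @! y))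
    : (K' 1%N * K 0%N)%type)) //.
  rewrite Hadd gadd Hf gf addr0 gd.
  by congr pair; rewrite /= ?addKr // -[LHS]HS addrAC.
rewrite [RHS](_ : _ = ((cd K' n.+2 @! (H z) + f n.+2 @! (g z), - (cd K n.+1 @! (g z)))
    + (H (cd K' n.+1 @! z + f n.+1 @! y), g (cd K' n.+1 @! z + f n.+1 @! y))
    : (K' n.+2 * K n.+1)%type)) //.
rewrite Hadd gadd Hf gf addr0 gd.
by congr pair; rewrite /= ?addKr // -[LHS]HS addrAC.
Qed.

End Sdr.

Section VertexCochains.
Variables (k : comPzRingType) (d : Order.disp_t) (C : porderType d).
Variable A : presheaf k C.
Notation B := (shriek_alg A).
Variables (b : bool) (X : Type) (hx : X -> C).
Variable Y : complex (bimod B).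
Notation KY := (Kom_ob (bimod_forget B) Y).
Notation E := (chain_coef b hx Y).
Notation cch := (cochain X C (fun m => KY m)).

Lemma chain_coefE x s r m y :
  cf E x s r m @! y = chain_act b (hx x) s r (y : (Y m : bimodule B)).
Proof. by []. Qed.

(** A degree n element v x i for each vertex i, seen as a cochain on the chains
    of dimension 0.  It is a cocycle for delta when the values at the two ends
    of an edge agree after transport to the edge. *)
Definition vcochain n (v : X -> C -> KY n) : cch := fun m x s =>
  match s with
  | [:: i] => if (i <= hx x)%O then place (V := fun m => KY m) (v x i) m else 0
  | _ => 0
  end.

Section Compatible.
Variables (n : nat) (v : X -> C -> KY n).
Hypothesis v_fix : forall x i, (i <= hx x)%O ->
  chain_act b (hx x) [:: i] [:: i] (v x i : (Y n : bimodule B)) = v x i.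
Hypothesis v_edge : forall x p q, (q <= p)%O -> (p <= hx x)%O ->
  chain_act b (hx x) [:: p; q] [:: q] (v x q : (Y n : bimodule B))
  = chain_act b (hx x) [:: p; q] [:: p] (v x p : (Y n : bimodule B)).

Lemma place_chain_act h s r m (z : KY n) :
  chain_act b h s r (place (V := fun m => KY m) z m : (Y m : bimodule B))
  = place (V := fun m => KY m) (chain_act b h s r (z : (Y n : bimodule B))) m.
Proof.
exact: (place_map (V := fun m => KY m) (W := fun m => KY m)
  (f := fun m z => chain_act b h s r (z : (Y m : bimodule B)))) (chain_act0 _ _ _ _ _).
Qed.

Lemma vcochain_base : base E (vcochain v).
Proof.
move=> m x [|i [|j s]]; rewrite /vcochain ?linear0 // chain_coefE.
case: (boolP (i <= hx x)%O) => ix; last exact: chain_act0.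
by rewrite place_chain_act v_fix.
Qed.

Lemma vcochain_graded : graded n (vcochain v).
Proof.
move=> m x [|i [|j s]] //= mn; case: ifP => // _; apply: place_neq.
by move: mn; rewrite addn1 eqSS eq_sym.
Qed.

Lemma delta_vcochain m x s : delta E (vcochain v) m x s = 0.
Proof.
rewrite /delta; case: s => [|p [|q [|r s]]] //; last 1 first.
- apply: altsum0 => -[|i [|j u]] [_ sz] //; exact: linear0.
- exact: subr0.
rewrite -[LHS]/((chain_act b (hx x) [:: p; q] [:: q] (vcochain v m x [:: q] : (Y m : bimodule B)) : KY m)
  - (chain_act b (hx x) [:: p; q] [:: p] (vcochain v m x [:: p] : (Y m : bimodule B)) - 0)).
rewrite subr0 /vcochain.
case: (boolP (below_chain (hx x) [:: p; q])) => [|ok]; last by rewrite /chain_act (negbTE ok) subrr.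
move=> /and3P[ph qp _]; rewrite ph (le_trans qp ph) !place_chain_act.
by rewrite v_edge // subrr.
Qed.

End Compatible.

Lemma vcochain_totd n (v : X -> C -> KY n.+1)
  (v_fix : forall x i, (i <= hx x)%O ->
    chain_act b (hx x) [:: i] [:: i] (v x i : (Y n.+1 : bimodule B)) = v x i)
  (v_edge : forall x p q, (q <= p)%O -> (p <= hx x)%O ->
    chain_act b (hx x) [:: p; q] [:: q] (v x q : (Y n.+1 : bimodule B))
    = chain_act b (hx x) [:: p; q] [:: p] (v x p : (Y n.+1 : bimodule B))) :
  totd E (vcochain v) = vcochain (fun x i => cd KY n @! (v x i)).
Proof.
apply: cochainP => m x s; rewrite /totd delta_vcochain // scaler0 addr0.
case: s => [|i [|j s]]; rewrite ?linear0 //=.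
by case: ifP => _; [exact: (@place_d k KY n (v x i) m) | exact: linear0].
Qed.

Lemma vcochain_tot n (v : X -> C -> KY n)
  (v_fix : forall x i, (i <= hx x)%O ->
    chain_act b (hx x) [:: i] [:: i] (v x i : (Y n : bimodule B)) = v x i)
  (v_edge : forall x p q, (q <= p)%O -> (p <= hx x)%O ->
    chain_act b (hx x) [:: p; q] [:: q] (v x q : (Y n : bimodule B))
    = chain_act b (hx x) [:: p; q] [:: p] (v x p : (Y n : bimodule B))) :
  tot_pred E n (vcochain v).
Proof.
split; [exact: vcochain_base | exact: vcochain_graded |].
case: n v v_fix v_edge => // v v_fix v_edge _.
apply: cochainP => m x s; rewrite /totd delta_vcochain // scaler0 addr0.
case: s => [|i [|j s]]; rewrite ?linear0 //=.
by case: ifP => _; [exact: (@place_d0 k KY (v x i) m) | exact: linear0].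
Qed.

Section ConeHomotopy.
Variable slide : X -> seq C -> forall m, KY m -> KY m.
Hypothesis slide_linear : forall x s m, linear (@slide x s m).
Hypothesis slide_d : forall x s m z, cd KY m @! (slide x s z) = slide x s (cd KY m @! z).
Hypothesis slide_face : forall x p t q u m (z : (Y m : bimodule B)),
  below_chain (hx x) (p :: t) -> subseq (q :: u) (p :: t) ->
  chain_act b (hx x) (p :: t) (q :: u) (slide x (q :: u) z : (Y m : bimodule B))
  = slide x (p :: t) (chain_act b (hx x) (hx x :: p :: t) (hx x :: q :: u) z : (Y m : bimodule B)).
Hypothesis slide_id : forall x p t m (z : (Y m : bimodule B)),
  below_chain (hx x) (p :: t) -> chain_act b (hx x) (p :: t) (p :: t) z = z ->
  slide x (p :: t) (chain_act b (hx x) (hx x :: p :: t) (p :: t) z : (Y m : bimodule B)) = z.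

Let slide0 x s m : slide x s (0 : KY m) = 0 := linear0 (mklinear (@slide_linear x s m)).

(** Evaluation on the chain with the apex hx x added on top.  The values at the
    longer chain have to be brought back to the shorter one, which is the role
    of slide; the sign compensates the one in totd. *)
Definition cone_off (y : cch) : cch := fun m x s =>
  match s with
  | [::] => 0
  | p :: t => (-1) ^+ m *: slide x (p :: t) (y m x (hx x :: p :: t))
  end.

(** What coning off leaves: the value at the apex transported to each vertex. *)
Definition apex (y : cch) : cch := fun m x s =>
  match s with
  | [:: p] => if (p <= hx x)%O then
      slide x [:: p] (chain_act b (hx x) [:: hx x; p] [:: hx x] (y m x [:: hx x] : (Y m : bimodule B)))
      else 0
  | _ => 0
  end.

Lemma cone_off_linear : linear cone_off.
Proof.
move=> a y z; apply: cochainP => m x [|p t].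
  by rewrite [RHS](_ : _ = a *: 0 + 0) // scaler0 addr0.
rewrite -[RHS]/(a *: ((-1) ^+ m *: slide x (p :: t) (y m x _))
  + (-1) ^+ m *: slide x (p :: t) (z m x _)).
by rewrite /cone_off slide_linear scalerDr !scalerA mulrC.
Qed.

Lemma cone_off0 : cone_off 0 = 0.
Proof. by apply: cochainP => m x [|p t] //; rewrite /cone_off slide0 scaler0. Qed.

Lemma cone_off_tot n y : tot_pred E n y -> tot_pred E n.+1 (cone_off y).
Proof.
move=> [By gy _]; split=> //.
- move=> m x [|p t]; first exact: linear0.
  rewrite /cone_off linearZ; congr (_ *: _); rewrite chain_coefE.
  case: (boolP (below_chain (hx x) (p :: t))) => ok.
    by rewrite slide_face // -chain_coefE By.
  by rewrite (chain_fix_below (By m x (hx x :: p :: t))) ?slide0 ?chain_act0 //= lexx.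
- by move=> m x [|p t] //= mn; rewrite gy ?slide0 ?scaler0 // addnS.
Qed.

(** The face of hx x :: s opposite to the apex gives back y at s, and the other
    faces cancel against delta of the coned cochain; on a single vertex p the
    face [:: hx x] has no counterpart, and it accounts for apex. *)
Lemma cone_homotopy y : base E y -> totd E (cone_off y) + cone_off (totd E y) = y - apex y.
Proof.
move=> By; apply: cochainP => m x s.
rewrite -[LHS]/(totd E (cone_off y) m x s + cone_off (totd E y) m x s).
rewrite -[RHS]/(y m x s - apex y m x s).
case: s => [|p t].
  by rewrite /totd /= linear0 scaler0 !addr0 -[y m x _]By chain_coefE subr0.
case: (boolP (below_chain (hx x) (p :: t))) => ok; last first.
  have y0 m' : y m' x (p :: t) = 0 by exact: (chain_fix_below (By m' x (p :: t))).
  have h0 z : base E z -> z m x (hx x :: p :: t) = 0.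
    by move=> Bz; apply: (chain_fix_below (Bz m x (hx x :: p :: t))); rewrite /= lexx.
  have c0 z : base E z -> cone_off z m x (p :: t) = 0.
    by move=> Bz; rewrite /cone_off h0 // slide0 scaler0.
  rewrite (c0 (totd E y)) ?addr0; last exact: base_totd.
  have -> : totd E (cone_off y) m x (p :: t) = 0.
    rewrite /totd /cone_off.
    have -> : y m.+1 x (hx x :: p :: t) = 0.
      by apply: (chain_fix_below (By m.+1 x (hx x :: p :: t))); rewrite /= lexx.
    rewrite slide0 scaler0 linear0 add0r /delta altsum0 ?scaler0 // => r _.
    by rewrite chain_coefE /chain_act; case: r => // q u; rewrite (negbTE ok).
  rewrite y0 sub0r /apex; case: t ok {y0 h0 c0} => [|q u] ok; last by rewrite oppr0.
  by move: ok; rewrite /= andbT => /negbTE ->; rewrite oppr0.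
set h := hx x.
pose G r := cf E x (h :: p :: t) (h :: r) m @! (y m x (h :: r)).
have dC : delta E y m x (h :: p :: t)
    = cf E x (h :: p :: t) (p :: t) m @! (y m x (p :: t)) - altsum G (p :: t) by [].
have slideB u w : slide x (p :: t) (u - w : KY m) = slide x (p :: t) u - slide x (p :: t) w
  := linearB (mklinear (@slide_linear x (p :: t) m)) u w.
have slideG : slide x (p :: t) (altsum G (p :: t)) = altsum (fun r => slide x (p :: t) (G r)) (p :: t).
  exact: (raddf_altsum (f := @slide x (p :: t) m)).
have dH : delta E (cone_off y) m x (p :: t)
    = (-1) ^+ m *: (slide x (p :: t) (altsum G (p :: t)) - apex y m x (p :: t)).
  case: t ok @G dC slideB slideG => [|q u] ok G dC slideB slideG.
    have ph : (p <= h)%O by case/andP: ok.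
    rewrite [LHS](_ : _ = 0); last exact: subr0.
    rewrite /apex -/h ph (_ : altsum G [:: p] = G [::]); last exact: subr0.
    by rewrite subrr scaler0.
  rewrite /apex subr0 slideG -[RHS]addr0 -[X in _ + X](@altsum0 C _ (fun=> 0) [:: p, q & u]) //.
  rewrite -altsumP /delta; apply: eq_altsum => -[|r1 r] [rs sz] //.
  rewrite addr0 /cone_off linearZ; congr (_ *: _).
  by rewrite chain_coefE slide_face.
have slideD u w : slide x (p :: t) (u + w : KY m) = slide x (p :: t) u + slide x (p :: t) w
  := linearD (mklinear (@slide_linear x (p :: t) m)) u w.
have slideZ a u : slide x (p :: t) (a *: u : KY m) = a *: slide x (p :: t) u.
  by have := slide_linear x (p :: t) a u 0; rewrite slide0 !addr0.
pose a := slide x (p :: t) (cd KY m @! (y m.+1 x (h :: p :: t))).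
pose g := slide x (p :: t) (altsum G (p :: t)).
have E1 : totd E (cone_off y) m x (p :: t)
    = (-1) ^+ m.+1 *: a + (-1) ^+ m *: ((-1) ^+ m *: (g - apex y m x (p :: t))).
  rewrite /totd dH /cone_off; congr (_ + _); apply: etrans (linearZ _ _) _.
  by congr (_ *: _); exact: slide_d.
have E2 : cone_off (totd E y) m x (p :: t)
    = (-1) ^+ m *: (a + (-1) ^+ m *: (y m x (p :: t) - g)).
  rewrite /cone_off /totd -/h dC slideD slideZ slideB; congr (_ *: (_ + _ *: (_ - _))).
  by apply: (slide_id ok); exact: By.
rewrite E1 E2 !scalerDr !scalerA -!expr2 sqrr_sign !scale1r exprS mulN1r scaleNr.
by rewrite addrACA addNr add0r addrC addrA subrK.
Qed.

End ConeHomotopy.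
End VertexCochains.

(** * From the rectification to the cobar complex *)

Section Tau.
Variables (k : comPzRingType) (d : Order.disp_t) (C : porderType d).
Variable A : presheaf k C.
Notation B := (shriek_alg A).
Variable Y : complex (bimod B).
Notation KY := (Kom_ob (bimod_forget B) Y).

Definition tau_term (h j : C) m (s : seq C) (z : KY m) : KY m :=
  match s with
  | p :: t => if (h <= j)%O then ract (z : (Y m : bimodule B)) (arr A p j : B) else 0
  | [::] => 0
  end.

Lemma tau_term_linear h j m s : linear (@tau_term h j m s).
Proof.
move=> a u v; case: s => [|p t] /=; first by rewrite scaler0 addr0.
by case: ifP => _; [exact: ract_linear | rewrite scaler0 addr0].
Qed.

Lemma tau_term0 h j m s : tau_term h j s (0 : KY m) = 0.
Proof. exact: (linear0 (mklinear (@tau_term_linear h j m s))). Qed.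

Lemma tau_term_sum h j m s (I : Type) (S : seq I) (F : I -> KY m) :
  tau_term h j s (\sum_(i <- S) F i) = \sum_(i <- S) tau_term h j s (F i).
Proof. exact: (linear_sum (mklinear (@tau_term_linear h j m s))). Qed.

Lemma tau_term_d h j m s z : tau_term h j s (cd KY m @! z) = cd KY m @! (tau_term h j s z).
Proof.
case: s => [|p t]; rewrite /tau_term ?linear0 //; case: ifP => _; rewrite ?linear0 //.
exact/esym/(bmorr (cd Y m)).
Qed.

Lemma tau_term_coef h j m s r (z : KY m) : subseq r s ->
  tau_term h j s (cf (rect_coef Y h) tt s r m @! z)
  = cf (cobar_coef Y) h s r m @! (tau_term h j r z).
Proof.
rewrite -[cf (rect_coef _ _) _ _ _ _ @! _]/(chain_act true _ _ _ _).
rewrite -[cf (cobar_coef _) _ _ _ _ @! _]/(chain_act false _ _ _ _) /tau_term.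
case: s r => [|p t] [|q u] rs //; rewrite /chain_act.
  by case: ifP => // _; rewrite ract0.
case: (boolP (below_chain h (p :: t))) => ok; last by rewrite ract0 if_same.
have [_ qp _] := below_chain_sub ok rs; have /andP[ph _] := ok.
case: (boolP (h <= j)%O) => hj; last by rewrite lactr0 ract0.
by rewrite ractA arrM // ?(le_trans ph) // lractA; exact/esym/ract1.
Qed.

Notation FRect n := (shriek_bimodule (rect_pbim Y n)).
Notation ext n h i y := (@ext_map _ C (pb_ab (rect_pbim Y n)) h i y).

(** The entry (h, j) of w is a cochain on the chains below h, with values in
    e_{bottom} Y e_{top}; multiplying by phi^{top, j} on the right places it in
    column j, and the columns of row h are added up. *)
Definition tau_fun n (w : FRect n) : cochain C C (fun m => KY m) :=
  fun m h s => \sum_(j \in [set: C])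
    tau_term h j s (sv ((w : shriek_mod _) h j : rect_car Y n h) m tt s).

Lemma tau_funE n (w : FRect n) m h s (S : seq C) : uniq S ->
  (forall j, j \notin S -> (w : shriek_mod _) h j = 0) ->
  tau_fun w m h s = \sum_(j <- S)
    tau_term h j s (sv ((w : shriek_mod _) h j : rect_car Y n h) m tt s).
Proof. by move=> uS S0; apply: fsumE => // j /S0 ->; exact: tau_term0. Qed.

Lemma tau_tot n (w : FRect n) : tot_pred (cobar_coef Y) n (tau_fun w).
Proof.
apply: (tot_pt (E := rect_coef Y)) => h.
have [S uS S0] := rf_supp (w : shriek_mod _) h.
exists C, S, (fun=> tt), (tau_term h), (fun j => sv ((w : shriek_mod _) h j : rect_car Y n h)).
split.
- by move=> j m s; exact: tau_term_linear.
- by move=> j m s z; exact: tau_term_d.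
- by move=> j m s r z; exact: tau_term_coef.
- by move=> m s; exact: tau_funE.
- by move=> j; exact: (@svP k _ (tot_sp (rect_coef Y h) n)).
Qed.

Lemma tau_totd n (w : FRect n.+1) :
  totd (cobar_coef Y) (tau_fun w) = tau_fun (shriek_map (rect_d Y n) w : FRect n).
Proof.
apply: cochainP => m h s; have [S uS S0] := rf_supp (w : shriek_mod _) h.
rewrite [RHS](@tau_funE n _ m h s S uS) => [|j /S0 wj]; last first.
  by rewrite -[LHS]/(rect_d Y n h ((w : shriek_mod _) h j)) wj linear0.
apply: (@totd_pt _ _ _ _ _ _ (rect_coef Y h) (cobar_coef Y) h C S (fun=> tt) (tau_term h)
  (fun j => sv ((w : shriek_mod _) h j : rect_car Y n.+1 h))).
- by move=> j m' s'; exact: tau_term_linear.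
- by move=> j m' s' z; exact: tau_term_d.
- by move=> j m' s' r z; exact: tau_term_coef.
- by move=> m' s'; exact: tau_funE.
Qed.

Definition tau_op n (w : FRect n) : cobar_bim Y n :=
  SubOf (S := tot_sp (cobar_coef Y) n) (tau_tot w).

Fact tau_op_linear n : linear (@tau_op n).
Proof.
move=> a u v; apply: sub_ofP; apply: cochainP => m h s.
have [S uS S0] := rf_supp2 (u : shriek_mod _) (v : shriek_mod _) h.
rewrite -[RHS]/(a *: tau_fun u m h s + tau_fun v m h s).
rewrite [LHS](@tau_funE n _ m h s S uS) => [|j /S0[uj vj]]; last first.
  rewrite -[LHS]/(a *: (u : shriek_mod _) h j + (v : shriek_mod _) h j).
  by rewrite uj vj scaler0 addr0.
rewrite (@tau_funE n u m h s S uS) => [|j /S0[]//].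
rewrite (@tau_funE n v m h s S uS) => [|j /S0[]//].
rewrite scaler_sumr -big_split; apply: eq_bigr => j _.
exact: tau_term_linear.
Qed.

Lemma sv_sum n h (I : Type) (S : seq I) (F : I -> rect_car Y n h) m s :
  sv (\sum_(i <- S) F i) m tt s = \sum_(i <- S) sv (F i) m tt s.
Proof. by apply: (big_morph (fun y : rect_car Y n h => sv y m tt s)). Qed.

Lemma sv_ext n h i (y : rect_pbim Y n i) m s : (h <= i)%O ->
  sv (ext n h i y : rect_car Y n h) m tt s
  = if below_chain h s then sv (y : rect_car Y n i) m tt s else 0.
Proof. by move=> hi; rewrite (ext_mapE hi). Qed.

Lemma tau_op_l n (x : B) (w : FRect n) : tau_op (lact x w) = lact x (tau_op w).
Proof.
apply: sub_ofP; apply: cochainP => m h s.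
rewrite -[RHS]/(lcobar (x : shriek_ring A) (tau_fun w) m h s) -[LHS]/(tau_fun (lact x w) m h s).
have [S uS S0] := rf_supp (x : shriek_ring A) h.
have [R uR R0] := rf_supp_seq (w : shriek_mod _) S.
have xwE j : ((lact x w : FRect n) : shriek_mod _) h j
    = \sum_(i <- S) lact ((x : shriek_ring A) h i) (ext n h i ((w : shriek_mod _) i j)).
  exact: shriek_lactE.
rewrite (@tau_funE n _ m h s R uR) => [|j jR]; last first.
  rewrite xwE big_seq big1 // => i iS; rewrite (R0 _ _ iS jR) ext_map0.
  exact: lactr0.
rewrite (lcobarE _ _ _ uS S0).
case: (boolP (below_chain h s)) => ok; last first.
  rewrite !big1 // => j _; first by rewrite /lact_term (negbTE ok).
  by rewrite (chain_fix_below (rect_fix (_ : rect_car Y n h) m tt s) ok) tau_term0.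
transitivity (\sum_(j <- R) \sum_(i <- S) tau_term h j s
   (lact (dg ((x : shriek_ring A) h i) : B)
     (sv (ext n h i ((w : shriek_mod _) i j) : rect_car Y n h) m tt s : (Y m : bimodule B)))).
  by apply: eq_bigr => j _; rewrite xwE sv_sum tau_term_sum.
rewrite exchange_big /= big_seq [RHS]big_seq; apply: eq_bigr => i iS.
rewrite /lact_term ok (tau_funE _ _ uR (fun j => R0 i j iS)) lact_sumr.
apply: eq_bigr => j _; case: (boolP (h <= i)%O) => hi; last first.
  by rewrite rfm_upper // dg0 !lact0 tau_term0.
rewrite sv_ext // ok; case: s ok => [//|p t] ok; rewrite /tau_term.
case: (boolP (i <= j)%O) => ij; first by rewrite (le_trans hi ij) lractA.
have -> : sv ((w : shriek_mod _) i j : rect_car Y n i) m tt (p :: t) = 0.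
  by rewrite rfm_upper.
by rewrite lactr0; case: ifP => _; rewrite ?ract0.
Qed.

Lemma tau_op_r n (w : FRect n) (x : B) : tau_op (ract w x) = ract (tau_op w) x.
Proof.
apply: sub_ofP; apply: cochainP => m h s.
rewrite -[RHS]/(ract (tau_fun w m h s : (Y m : bimodule B)) x) -[LHS]/(tau_fun (ract w x) m h s).
have [S uS S0] := rf_supp (w : shriek_mod _) h.
have [R uR R0] := rf_supp_seq (x : shriek_ring A) S.
have wxE j : ((ract w x : FRect n) : shriek_mod _) h j
    = \sum_(i <- S) ract ((w : shriek_mod _) h i)
        (@ext_map _ C (ps_ab A) h i ((x : shriek_ring A) i j)).
  exact: shriek_ractE.
rewrite (@tau_funE n _ m h s R uR) => [|j jR]; last first.
  rewrite wxE big_seq big1 // => i iS; rewrite (R0 _ _ iS jR) ext_map0.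
  exact: ractr0.
rewrite (tau_funE _ _ uS S0) ract_suml.
transitivity (\sum_(j <- R) \sum_(i <- S) tau_term h j s
   (ract (sv ((w : shriek_mod _) h i : rect_car Y n h) m tt s : (Y m : bimodule B))
     (dg (@ext_map _ C (ps_ab A) h i ((x : shriek_ring A) i j)) : B))).
  by apply: eq_bigr => j _; rewrite wxE sv_sum tau_term_sum.
rewrite exchange_big /= big_seq [RHS]big_seq; apply: eq_bigr => i iS.
case: s => [|p t]; first by rewrite big1 // ract0.
case: (boolP (h <= i)%O) => hi; last first.
  have -> : sv ((w : shriek_mod _) h i : rect_car Y n h) m tt (p :: t) = 0.
    by rewrite rfm_upper.
  rewrite tau_term0 ract0 big1 // => j _.
  by rewrite ract0 tau_term0.
have wfix := rect_fix ((w : shriek_mod _) h i : rect_car Y n h) m tt (p :: t).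
case: (boolP (below_chain h (p :: t))) => ok; last first.
  rewrite (chain_fix_below wfix ok) tau_term0 ract0 big1 // => j _.
  by rewrite ract0 tau_term0.
have /andP[ph _] := ok.
rewrite /tau_term hi ractA.
rewrite [X in ract _ X](arr_row (le_trans ph hi) uR (fun j => R0 i j iS)) ract_sumr.
apply: eq_bigr => j _.
case: (boolP (i <= j)%O) => ij; last first.
  by rewrite [(x : shriek_ring A) i j]rfm_upper // ext_map0 !dg0 mul0r !ractr0 ract0 if_same.
have wr := chain_fix_r wfix.
have key : (arr A p p : B) * (dg (@ext_map _ C (ps_ab A) h i ((x : shriek_ring A) i j)) : B)
    = (arr A p p : B) * (dg ((x : shriek_ring A) i j) : B).
  by rewrite (ext_mapE hi); exact: arr_dg_phi.
rewrite (le_trans hi ij) -[RHS]ractA; congr ract.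
apply: etrans (congr1 (fun z => ract z _) (esym wr)) _.
rewrite ractA key -ractA.
exact: (congr1 (fun z => ract z _) wr).
Qed.

Definition tau_n n : bimod_mor (FRect n) (cobar_bim Y n).
Proof.
exists (mklinear (@tau_op_linear n)).
- by move=> x w; exact: tau_op_l.
- by move=> w x; exact: tau_op_r.
Defined.

Fact tau_cmd n :
  pcmp (tau_n n : pmor (_ : bimod B) _) (cd (Kom_ob (shriek A) (rect_ob Y)) n)
  = pcmp (cd (cobar_ob Y) n) (tau_n n.+1).
Proof. apply: bimod_morP => w; apply: sub_ofP; exact/esym/tau_totd. Qed.

Definition tau : chain_map (Kom_ob (shriek A) (rect_ob Y)) (cobar_ob Y) :=
  @ChainMap (bimod B) (Kom_ob (shriek A) (rect_ob Y)) (cobar_ob Y) tau_n tau_cmd.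

End Tau.

Lemma tau_natural (k : comPzRingType) (d : Order.disp_t) (C : porderType d)
    (A : presheaf k C) (Y Z : complex (bimod (shriek_alg A))) (f : chain_map Y Z) :
  chain_cmp (tau Z) (Kom_map (shriek A) (rect_map f)) = chain_cmp (cobar_map f) (tau Y).
Proof.
apply: chain_mapP => n; apply: bimod_morP => w; apply: sub_ofP.
apply: cochainP => m h s; have [S uS S0] := rf_supp (w : shriek_mod _) h.
rewrite -[RHS]/(f m (tau_fun w m h s)).
rewrite -[LHS]/(tau_fun (shriek_map (rect_map_n f n) w : shriek_bimodule (rect_pbim Z n)) m h s).
rewrite (tau_funE _ _ uS S0) linear_sum.
rewrite [LHS](@tau_funE _ _ _ _ Z n _ m h s S uS) => [|j /S0 wj]; last first.
  by rewrite -[LHS]/(rect_map_n f n h ((w : shriek_mod _) h j)) wj linear0.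
apply: eq_bigr => j _; rewrite /tau_term; case: s => [|p t]; first by rewrite linear0.
by case: ifP => _; [rewrite [RHS](bmorr (f m)) | rewrite linear0].
Qed.

(** * The coaugmentation of the cobar complex *)

Section Eta.
Variables (k : comPzRingType) (d : Order.disp_t) (C : porderType d).
Variable A : presheaf k C.
Notation B := (shriek_alg A).
Variable Y : complex (bimod B).
Notation KY := (Kom_ob (bimod_forget B) Y).

(** Row h of y, pulled back to the vertex i. *)
Definition eta_v n (y : Y n : bimodule B) (h i : C) : KY n := lact (arr A i h : B) y.

Lemma eta_v_fix n (y : Y n : bimodule B) h i : (i <= h)%O ->
  chain_act false h [:: i] [:: i] (eta_v y h i : (Y n : bimodule B)) = eta_v y h i.
Proof. by move=> ih; rewrite /chain_act /= ih /= ract1 lactA arrM. Qed.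

Lemma eta_v_edge n (y : Y n : bimodule B) h p q : (q <= p)%O -> (p <= h)%O ->
  chain_act false h [:: p; q] [:: q] (eta_v y h q : (Y n : bimodule B))
  = chain_act false h [:: p; q] [:: p] (eta_v y h p : (Y n : bimodule B)).
Proof.
move=> qp ph; rewrite /chain_act; case: ifP => // _.
by rewrite !ract1 /eta_v /= !lactA !arrM // (le_trans qp ph).
Qed.

Definition eta_fun n (y : Y n : bimodule B) : cochain C C (fun m => KY m) :=
  vcochain id (eta_v y).

Lemma eta_tot n (y : Y n : bimodule B) : tot_pred (cobar_coef Y) n (eta_fun y).
Proof. by apply: vcochain_tot => *; [exact: eta_v_fix | exact: eta_v_edge]. Qed.

Lemma eta_totd n (y : Y n.+1 : bimodule B) :
  totd (cobar_coef Y) (eta_fun y) = eta_fun (cd Y n y : (Y n : bimodule B)).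
Proof.
rewrite /eta_fun vcochain_totd => [|*|*]; last 2 first.
- exact: eta_v_fix.
- exact: eta_v_edge.
congr vcochain; apply: functional_extensionality_dep => h.
by apply: functional_extensionality_dep => i; exact: (bmorl (cd Y n)).
Qed.

Definition eta_op n (y : Y n : bimodule B) : cobar_bim Y n :=
  SubOf (S := tot_sp (cobar_coef Y) n) (eta_tot y).

Fact eta_op_linear n : linear (@eta_op n).
Proof.
move=> a u v; apply: sub_ofP; apply: cochainP => m h s.
rewrite -[RHS]/(a *: eta_fun u m h s + eta_fun v m h s).
rewrite -[LHS]/(eta_fun (a *: u + v) m h s) /eta_fun /vcochain /=.
case: s => [|i [|j s]]; rewrite ?scaler0 ?addr0 //.
case: ifP => _; last by rewrite scaler0 addr0.
by rewrite -place_linear /eta_v lact_linear.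
Qed.

Lemma place_lact n (x : B) (y : Y n : bimodule B) m :
  lact x (place (V := fun m => KY m) (y : KY n) m : (Y m : bimodule B))
  = place (V := fun m => KY m) (lact x y : KY n) m.
Proof.
by apply: (@place_map k (fun m => KY m) (fun m => KY m)
  (fun m z => lact x (z : (Y m : bimodule B))) n y m); exact: lactr0.
Qed.

Lemma place_ract n (x : B) (y : Y n : bimodule B) m :
  ract (place (V := fun m => KY m) (y : KY n) m : (Y m : bimodule B)) x
  = place (V := fun m => KY m) (ract y x : KY n) m.
Proof.
by apply: (@place_map k (fun m => KY m) (fun m => KY m)
  (fun m z => ract (z : (Y m : bimodule B)) x) n y m); exact: ract0.
Qed.

(** Row h of the product x y is a combination of the rows of y, by the
    decomposition of row h of x. *)
Lemma eta_op_l n (x : B) (y : Y n : bimodule B) : eta_op (lact x y) = lact x (eta_op y).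
Proof.
apply: sub_ofP; apply: cochainP => m h s.
rewrite -[RHS]/(lcobar (x : shriek_ring A) (eta_fun y) m h s) -[LHS]/(eta_fun (lact x y) m h s).
have [S uS S0] := rf_supp (x : shriek_ring A) h; rewrite (lcobarE _ _ _ uS S0).
have lt0 j s' : lact_term (x : shriek_ring A) h j s' (0 : KY m) = 0.
  exact: (linear0 (mklinear (@lact_term_linear _ _ _ _ Y x h j m s'))).
case: s => [|i [|j s]]; rewrite /eta_fun /vcochain; last 1 first.
- by rewrite big1.
- by rewrite big1.
case: (boolP (i <= h)%O) => ih; last first.
  by rewrite big1 // => j _; rewrite /lact_term /= (negbTE ih).
rewrite /eta_v lactA [X in lact X y](arr_row ih uS S0) lact_suml place_sum.
apply: eq_bigr => j _; rewrite /lact_term /= ih /=.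
case: (boolP (h <= j)%O) => hj.
  by rewrite (le_trans ih hj) place_lact lactA.
rewrite rfm_upper // dg0 mul0r !lact0.
exact: (linear0 (mklinear (@place_linear k (fun m => KY m) n m))).
Qed.

Lemma eta_op_r n (x : B) (y : Y n : bimodule B) : eta_op (ract y x) = ract (eta_op y) x.
Proof.
apply: sub_ofP; apply: cochainP => m h s.
rewrite -[RHS]/(ract (eta_fun y m h s : (Y m : bimodule B)) x).
rewrite -[LHS]/(eta_fun (ract y x) m h s) /eta_fun /vcochain.
case: s => [|i [|j s]]; rewrite ?ract0 //.
case: ifP => _; last by rewrite ract0.
by rewrite place_ract /eta_v lractA.
Qed.

Definition eta_n n : bimod_mor (Y n : bimodule B) (cobar_bim Y n).
Proof.
exists (mklinear (@eta_op_linear n)).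
- by move=> x y; exact: eta_op_l.
- by move=> y x; exact: eta_op_r.
Defined.

Fact eta_cmd n :
  pcmp (eta_n n : pmor (_ : bimod B) _) (cd Y n) = pcmp (cd (cobar_ob Y) n) (eta_n n.+1).
Proof. apply: bimod_morP => y; apply: sub_ofP; exact/esym/eta_totd. Qed.

Definition eta : chain_map Y (cobar_ob Y) :=
  @ChainMap (bimod B) Y (cobar_ob Y) eta_n eta_cmd.

End Eta.

Lemma eta_natural (k : comPzRingType) (d : Order.disp_t) (C : porderType d)
    (A : presheaf k C) (Y Z : complex (bimod (shriek_alg A))) (f : chain_map Y Z) :
  chain_cmp (eta Z) f = chain_cmp (cobar_map f) (eta Y).
Proof.
apply: chain_mapP => n; apply: bimod_morP => y; apply: sub_ofP.
apply: cochainP => m h s.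
rewrite -[RHS]/(f m (eta_fun y m h s)) -[LHS]/(eta_fun (f n y) m h s) /eta_fun /vcochain.
case: s => [|i [|j s]]; rewrite ?linear0 //.
case: ifP => _; last by rewrite linear0.
rewrite -[eta_v (f n y) h i](bmorl (f n)).
apply: esym; apply: (@place_map k (fun m => Y m : bimodule _) (fun m => Z m : bimodule _)
  (fun m z => f m z) n (eta_v y h i) m); exact: linear0.
Qed.

Section ShriekBimodElements.
Variables (k : comPzRingType) (d : Order.disp_t) (C : porderType d).
Variable A : presheaf k C.
Notation B := (shriek_alg A).
Variable M : pbimodule A.
Notation FM := (shriek_bimodule M).
Notation ext h i y := (@ext_map _ C (pb_ab M) h i y).

Lemma lact_arrE i j (w : FM) g l : (i <= j)%O ->
  (lact (arr A i j : B) w : shriek_mod M) g l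
  = if g == i then ext g j ((w : shriek_mod M) j l) else 0.
Proof.
move=> ij; rewrite [LHS](@shriek_lactE _ _ _ _ M (arr A i j) w g l [:: j]) //.
  rewrite big_seq1 /= eqxx ij !andbT; case: (g == i); rewrite ?lact1 ?lact0; reflexivity.
by move=> t; rewrite inE /= => /negbTE ->; rewrite andbF.
Qed.

Lemma ract_arrE i j (w : FM) g l : (i <= j)%O ->
  (ract w (arr A i j : B) : shriek_mod M) g l
  = if l == j then (w : shriek_mod M) g i else 0.
Proof.
move=> ij; have [s us s0] := rf_supp (w : shriek_mod M) g; pose t := undup (i :: s).
rewrite [LHS](@shriek_ractE _ _ _ _ M w (arr A i j) g l t) ?undup_uniq //; last first.
  by move=> r; rewrite mem_undup inE negb_or => /andP[_ /s0].
have it : i \in t by rewrite mem_undup inE eqxx.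
rewrite (bigD1_seq i) ?undup_uniq //= big1 => [|r ri]; last first.
  by rewrite (negbTE ri) /= ext_map0 ractr0.
rewrite eqxx ij andbT addr0; case: eqP => _; last by rewrite ext_map0 ractr0.
case: (boolP (g <= i)%O) => gi; last by rewrite rfm_upper // ract0.
by rewrite (ext_mapE gi) -[@abT _ _ _ _ _ _ _]/(phi A gi 1) rmorph1 ract1.
Qed.

(** The diagonal matrix with entries T^{ih}(y) for i <= h, where T is the structure
    map of M; the analogue of dg for bimodules. *)
Definition diagm (h : C) (y : M h) : FM := rf_diag (fun i => ext i h y : M i).

Lemma ext_compM g i h (y : M h) : (g <= i)%O -> (i <= h)%O -> ext g i (ext i h y) = ext g h y.
Proof.
move=> gi ih; rewrite (ext_mapE ih) (ext_mapE gi) (ext_mapE (le_trans gi ih)).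
exact: pbT_cmp.
Qed.

Lemma ext_idM h (y : M h) : ext h h y = y.
Proof. by rewrite (ext_mapE (lexx h)); exact: pbT_id. Qed.

Lemma arr_diagm_E g i h (y : M h) a l : (g <= i)%O -> (i <= h)%O ->
  (lact (arr A g i : B) (diagm y) : shriek_mod M) a l
  = if (a == g) && (l == i) then ext a h y else 0.
Proof.
move=> gi ih; rewrite lact_arrE // /= [i == l]eq_sym.
case: (eqVneq a g) => [->|_] //=; case: eqP => _; last exact: (@ext_map0 _ C (pb_ab M) g i).
exact: ext_compM.
Qed.

(** The identity behind tau o F(unit) = eta. *)
Lemma row_decomposition p h (w : FM) (S : seq C) : (p <= h)%O -> uniq S ->
  (forall j, j \notin S -> (w : shriek_mod M) h j = 0) ->
  lact (arr A p h : B) w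
  = \sum_(j <- S) if (h <= j)%O
      then ract (lact (arr A p p : B) (diagm ((w : shriek_mod M) h j))) (arr A p j : B) else 0.
Proof.
move=> ph uS S0; apply: rfmatP => g l; rewrite lact_arrE //.
have -> : (\sum_(j <- S) if (h <= j)%O
      then ract (lact (arr A p p : B) (diagm ((w : shriek_mod M) h j))) (arr A p j : B) else 0 : shriek_mod M) g l
  = \sum_(j <- S) if (g == p) && (l == j) then ext g h ((w : shriek_mod M) h j) else 0.
  rewrite (big_morph (fun m : shriek_mod M => m g l) (id1 := 0) (op1 := +%R)) //.
  apply: eq_bigr => j _; case: (boolP (h <= j)%O) => hj; last first.
    have -> : (w : shriek_mod M) h j = 0 by rewrite rfm_upper.
    by rewrite ext_map0 if_same.
  rewrite ract_arrE ?(le_trans ph hj) // arr_diagm_E // eqxx andbT.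
  by case: (g == p); case: (l == j).
case: (eqVneq g p) => [->|_] /=; last by rewrite big1.
case: (boolP (l \in S)) => ls; last first.
  rewrite S0 // ext_map0 big_seq big1 // => j js.
  by case: eqP ls => // ->; rewrite js.
rewrite (bigD1_seq l) //= eqxx big1 ?addr0 // => j.
by rewrite eq_sym => /negbTE ->.
Qed.

Lemma lact_dg_diagm h (a : A h) (y : M h) :
  lact (dg a : B) (diagm y) = diagm (lact a y).
Proof.
apply: rfmatP => g l; rewrite [LHS]rf_diag_mul /=.
case: eqP => _; last exact: lactr0.
case: (boolP (g <= h)%O) => gh; last by rewrite !ext_mapN // lact0.
by rewrite !(ext_mapE gh); exact/esym/pbTl.
Qed.

Lemma ract_dg_diagm h (a : A h) (y : M h) :
  ract (diagm y) (dg a : B) = diagm (ract y a).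
Proof.
apply: rfmatP => g l; case: (boolP (g <= l)%O) => gl; last by rewrite !rfm_upper.
rewrite [LHS](@rf_mul_diag _ _ _ (ps_ab A) _ _ (@ractD _ _ _ _ M) _ _ g l gl) /=.
case: eqP gl => [<-|_] gl; last exact: ract0.
case: (boolP (g <= h)%O) => gh; last by rewrite !ext_mapN // ract0.
rewrite phi_id !(ext_mapE gh); exact/esym/pbTr.
Qed.

Lemma diagm_linear h : linear (@diagm h).
Proof.
move=> c y z; apply: rfmatP => g l.
rewrite -[RHS]/(c *: (diagm y : shriek_mod M) g l + (diagm z : shriek_mod M) g l) /=.
case: eqP => _; last by rewrite scaler0 addr0.
rewrite ext_mapD; congr (_ + _).
case: (boolP (g <= h)%O) => gh; last by rewrite !ext_mapN // scaler0.
rewrite !(ext_mapE gh) -!lact_sym -[@abT _ _ _ _ _ _ _]/(pbT M gh _) pbTl phi_kscal.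
by [].
Qed.

End ShriekBimodElements.

(** * The unit of the rectification *)

Section Unit.
Variables (k : comPzRingType) (d : Order.disp_t) (C : porderType d).
Variable A : presheaf k C.
Notation B := (shriek_alg A).
Notation FK M := (Kom_ob (shriek A) M).
Notation KF M := (Kom_ob (bimod_forget B) (Kom_ob (shriek A) M)).

Lemma shriek_diagm (M N : pbimodule A) (f : pbimod_mor M N) h (y : M h) :
  shriek_map f (diagm y) = diagm (f h y).
Proof.
apply: rfmatP => g l /=; case: eqP => _; last exact: linear0.
case: (boolP (g <= h)%O) => gh; last by rewrite !ext_mapN // linear0.
by rewrite !(ext_mapE gh); exact: pbmorT.
Qed.

Section Diag.
Variable M : pbimodule A.
Notation FM := (shriek_bimodule M).

Lemma diagm_fix h (y : M h) i : (i <= h)%O ->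
  ract (lact (arr A i i : B) (lact (arr A i i : B) (diagm y))) (arr A i i : B)
  = lact (arr A i i : B) (diagm y).
Proof.
move=> ih; apply: rfmatP => g l.
have aa : (arr A i i : B) * (arr A i i : B) = (arr A i i : B) by exact: arrM.
rewrite lactA aa ract_arrE // !arr_diagm_E // eqxx andbT.
by case: (g == i); case: (l == i).
Qed.

Lemma diagm_edge h (y : M h) p q : (q <= p)%O -> (p <= h)%O ->
  ract (lact (arr A q q : B) (lact (arr A q q : B) (diagm y))) (arr A q p : B)
  = ract (lact (arr A q p : B) (lact (arr A p p : B) (diagm y))) (arr A p p : B).
Proof.
move=> qp ph; apply: rfmatP => g l; have qh := le_trans qp ph.
have aa : (arr A q q : B) * (arr A q q : B) = (arr A q q : B) by exact: arrM.
have bb : (arr A q p : B) * (arr A p p : B) = (arr A q p : B) by exact: arrM.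
have E1 : lact (arr A q q : B) (lact (arr A q q : B) (diagm y))
    = lact (arr A q q : B) (diagm y) by rewrite lactA aa.
have E2 : lact (arr A q p : B) (lact (arr A p p : B) (diagm y))
    = lact (arr A q p : B) (diagm y) by rewrite lactA bb.
rewrite E1 E2 (ract_arrE _ _ _ qp) (ract_arrE _ _ _ (lexx p)).
by rewrite !arr_diagm_E // !eqxx !andbT.
Qed.

Lemma diagm_restr h' h (hh : (h' <= h)%O) (y : M h) i : (i <= h')%O ->
  lact (arr A i i : B) (diagm (pbT M hh y)) = lact (arr A i i : B) (diagm y).
Proof.
move=> ih; have ih' := le_trans ih hh.
apply: rfmatP => g l; rewrite !arr_diagm_E //.
case: (eqVneq g i) => [->|_] //=; case: eqP => _ //.
by rewrite (ext_mapE ih) (ext_mapE ih'); exact: pbT_cmp.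
Qed.

Lemma diagm_l h (a : A h) (y : M h) i :
  lact (arr A i i : B) (diagm (lact a y)) = lact (dg a : B) (lact (arr A i i : B) (diagm y)).
Proof.
have aa : (arr A i i : B) * (dg a : B) = (dg a : B) * (arr A i i : B) by exact: arr_dgmC.
by rewrite -lact_dg_diagm lactA aa -lactA.
Qed.

Lemma diagm_r h (a : A h) (y : M h) i :
  lact (arr A i i : B) (diagm (ract y a)) = ract (lact (arr A i i : B) (diagm y)) (dg a : B).
Proof. by rewrite -ract_dg_diagm lractA. Qed.

End Diag.

Lemma chain_actE b (Y : bimodule B) h p t q u (z : Y) : below_chain h (p :: t) ->
  chain_act b h (p :: t) (q :: u) z
  = ract (lact (arr A (last p t) (last q u) : B) z) (rfac A b q p).
Proof. by rewrite /chain_act => ->. Qed.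

Section Object.
Variable M : complex (pbimod A).

(** The element T^{ih}(y) placed at the entry (i, i). *)
Definition unit_v n h (y : (M n : pbimodule A) h) (_ : unit) (i : C) : KF M n :=
  lact (arr A i i : B) (diagm y).

Lemma unit_v_fix n h (y : (M n : pbimodule A) h) x i : (i <= h)%O ->
  chain_act true h [:: i] [:: i] (unit_v y x i : (FK M n : bimodule B)) = unit_v y x i.
Proof.
move=> ih; have ok : below_chain h [:: i] by rewrite /= ih.
by rewrite chain_actE //; exact: (diagm_fix (M := M n)).
Qed.

(** Both sides are T^{qh}(y) at the entry (q, p). *)
Lemma unit_v_edge n h (y : (M n : pbimodule A) h) x p q : (q <= p)%O -> (p <= h)%O ->
  chain_act true h [:: p; q] [:: q] (unit_v y x q : (FK M n : bimodule B))
  = chain_act true h [:: p; q] [:: p] (unit_v y x p : (FK M n : bimodule B)).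
Proof.
move=> qp ph; have ok : below_chain h [:: p; q] by rewrite /= ph [geC _ _]qp.
by rewrite !chain_actE //; exact: (diagm_edge (M := M n)).
Qed.

Definition unit_fun n h (y : (M n : pbimodule A) h) : cochain unit C (fun m => KF M m) :=
  vcochain (fun _ : unit => h) (unit_v y).

Lemma unit_tot n h (y : (M n : pbimodule A) h) :
  tot_pred (rect_coef (FK M) h) n (unit_fun y).
Proof. by apply: vcochain_tot => *; [exact: unit_v_fix | exact: unit_v_edge]. Qed.

Lemma unit_totd n h (y : (M n.+1 : pbimodule A) h) :
  totd (rect_coef (FK M) h) (unit_fun y) = unit_fun ((cd M n : pbimod_mor _ _) h y).
Proof.
rewrite /unit_fun vcochain_totd => [|*|*]; last 2 first.
- exact: unit_v_fix.
- exact: unit_v_edge.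
congr vcochain; apply: functional_extensionality_dep => x.
apply: functional_extensionality_dep => i.
rewrite /unit_v -shriek_diagm; exact: (bmorl (shriek_map (cd M n))).
Qed.

Definition unit_op n h (y : (M n : pbimodule A) h) : rect_bim (FK M) n h :=
  SubOf (S := tot_sp (rect_coef (FK M) h) n) (unit_tot y).

Fact unit_op_linear n h : linear (@unit_op n h).
Proof.
move=> a u v; apply: sub_ofP; apply: cochainP => m x s.
rewrite -[RHS]/(a *: unit_fun u m x s + unit_fun v m x s).
rewrite -[LHS]/(unit_fun (a *: u + v) m x s) /unit_fun /vcochain.
case: s => [|i [|j s]]; rewrite ?scaler0 ?addr0 //.
case: ifP => _; last by rewrite scaler0 addr0.
by rewrite -place_linear /unit_v diagm_linear lact_linear.
Qed.

Lemma unit_op_l n h (a : A h) (y : (M n : pbimodule A) h) :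
  unit_op (lact a y) = lact a (unit_op y).
Proof.
apply: sub_ofP; apply: cochainP => m x s.
rewrite -[RHS]/(lact (dg a : B) (unit_fun y m x s : (FK M m : bimodule B))).
rewrite -[LHS]/(unit_fun (lact a y) m x s) /unit_fun /vcochain.
case: s => [|i [|j s]]; rewrite ?lactr0 //.
case: ifP => _; last by rewrite lactr0.
rewrite place_lact; apply: (congr1 (fun z => place (V := fun m => KF M m) z m)).
exact: (diagm_l (M := M n)).
Qed.

Lemma unit_op_r n h (a : A h) (y : (M n : pbimodule A) h) :
  unit_op (ract y a) = ract (unit_op y) a.
Proof.
apply: sub_ofP; apply: cochainP => m x s.
rewrite -[RHS]/(ract (unit_fun y m x s : (FK M m : bimodule B)) (dg a : B)).
rewrite -[LHS]/(unit_fun (ract y a) m x s) /unit_fun /vcochain.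
case: s => [|i [|j s]]; rewrite ?ract0 //.
case: ifP => _; last by rewrite ract0.
rewrite place_ract; apply: (congr1 (fun z => place (V := fun m => KF M m) z m)).
exact: (diagm_r (M := M n)).
Qed.

Lemma unit_op_T n h' h (hh : (h' <= h)%O) (y : (M n : pbimodule A) h) :
  unit_op (pbT (M n) hh y) = pbT (rect_pbim (FK M) n) hh (unit_op y).
Proof.
apply: sub_ofP; apply: cochainP => m x s.
rewrite -[RHS]/(if below_chain h' s then unit_fun y m x s else 0).
rewrite -[LHS]/(unit_fun (pbT (M n) hh y) m x s) /unit_fun /vcochain.
case: s => [|i [|j s]]; rewrite ?if_same //= andbT.
case: (boolP (i <= h')%O) => // ih; rewrite (le_trans ih hh).
apply: (congr1 (fun z => place (V := fun m => KF M m) z m)).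
exact: (diagm_restr (M := M n)).
Qed.

Definition unit_n n : pbimod_mor (M n) (rect_pbim (FK M) n).
Proof.
unshelve refine (@PBimodMor _ _ _ A (M n) (rect_pbim (FK M) n) (fun h =>
  @BimodMor _ _ (M n h) (rect_bim (FK M) n h) (mklinear (@unit_op_linear n h)) _ _) _).
- by move=> a y; exact: unit_op_l.
- by move=> y a; exact: unit_op_r.
- by move=> i j ij y; exact: unit_op_T.
Defined.

Fact unit_cmd n :
  pcmp (unit_n n : pmor (_ : pbimod A) _) (cd M n)
  = pcmp (cd (rect_ob (FK M)) n) (unit_n n.+1).
Proof. apply: pbimod_morP => h y; apply: sub_ofP; exact/esym/unit_totd. Qed.

Definition unit_map : chain_map M (rect_ob (FK M)) :=
  @ChainMap (pbimod A) M (rect_ob (FK M)) unit_n unit_cmd.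

Lemma tau_unit : chain_cmp (tau (FK M)) (Kom_map (shriek A) unit_map) = eta (FK M).
Proof.
apply: chain_mapP => n; apply: bimod_morP => w; apply: sub_ofP.
apply: cochainP => m h s; have [S uS S0] := rf_supp (w : shriek_mod (M n)) h.
rewrite -[RHS]/(eta_fun (Y := FK M) (n := n) w m h s).
rewrite -[LHS]/(tau_fun (Y := FK M) (n := n) (shriek_map (unit_n n) w) m h s).
rewrite (@tau_funE _ _ _ _ (FK M) n _ m h s S uS) => [|j /S0 wj]; last first.
  by rewrite -[LHS]/(unit_n n h ((w : shriek_mod _) h j)) wj linear0.
transitivity (\sum_(j <- S) tau_term (Y := FK M) h j s (unit_fun ((w : shriek_mod (M n)) h j) m tt s)).
  by [].
rewrite /unit_fun /eta_fun /vcochain.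
case: s => [|p [|q s]]; first by rewrite big1.
  case: (boolP (p <= h)%O) => ph; last by rewrite big1 // => j _; exact: tau_term0.
  rewrite /eta_v (row_decomposition ph uS S0) place_sum; apply: eq_bigr => j _.
  rewrite /tau_term; case: ifP => _; first exact: place_ract.
  exact/esym/(linear0 (mklinear (@place_linear k (fun m => KF M m) n m))).
by rewrite big1 // => j _; exact: tau_term0.
Qed.

End Object.

Lemma unit_natural (M N : complex (pbimod A)) (f : chain_map M N) :
  chain_cmp (unit_map N) f = chain_cmp (rect_map (Kom_map (shriek A) f)) (unit_map M).
Proof.
apply: chain_mapP => n; apply: pbimod_morP => h y; apply: sub_ofP.
apply: cochainP => m x s.
rewrite -[RHS]/(shriek_map (f m) (unit_fun y m x s)).
rewrite -[LHS]/(unit_fun ((f n : pbimod_mor _ _) h y) m x s) /unit_fun /vcochain.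
case: s => [|i [|j s]]; [exact/esym/linear0 | | exact/esym/linear0].
case: ifP => _; last exact/esym/linear0.
rewrite /unit_v -shriek_diagm -[lact _ (shriek_map _ _)](bmorl (shriek_map (f n))).
apply: esym; apply: (@place_map k (fun m => KF M m) (fun m => KF N m)
  (fun m z => shriek_map (f m) z) n (unit_v y x i) m); exact: linear0.
Qed.

Section ColumnMove.
Variable M : pbimodule A.
Notation FM := (shriek_bimodule M).
Notation ext h i y := (@ext_map _ C (pb_ab M) h i y).

(** In F M all the entries of a row beyond the diagonal are the same module, so
    column h can be renamed p; this inverts right multiplication by phi^{ph}. *)
Definition move_col (h p : C) (z : FM) : FM.
Proof.
exists (fun g l => if (l == p) && (g <= p)%O then (z : shriek_mod M) g h else 0) => [g l|g].
  by case: eqP => [->|_] //= gp; rewrite (negbTE gp).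
apply: sub_finite_set (finite_set1 p) => l /=.
by case: (l =P p) => [-> //|_] /=; rewrite eqxx.
Defined.

Lemma move_col_linear h p : linear (move_col h p).
Proof.
move=> a u v; apply: rfmatP => g l.
rewrite -[RHS]/(a *: (move_col h p u : shriek_mod M) g l + (move_col h p v : shriek_mod M) g l) /=.
by case: ifP => _ //; rewrite scaler0 addr0.
Qed.

Lemma sandwichE a b p q (z : FM) g l : (a <= b)%O -> (p <= q)%O ->
  (ract (lact (arr A a b : B) z) (arr A p q : B) : shriek_mod M) g l
  = if (l == q) && (g == a) then ext g b ((z : shriek_mod M) b p) else 0.
Proof.
move=> ab pq; rewrite ract_arrE // lact_arrE //.
by case: (l == q).
Qed.

Lemma move_col_face h p t q u (z : FM) : below_chain h (p :: t) -> subseq (q :: u) (p :: t) ->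
  chain_act true h (p :: t) (q :: u) (move_col h q z)
  = move_col h p (chain_act true h (h :: p :: t) (h :: q :: u) z).
Proof.
move=> ok rs; have ok' : below_chain h (h :: p :: t) by rewrite /= lexx.
have [okq qp bb] := below_chain_sub ok rs.
rewrite (chain_actE _ _ _ _ ok) (chain_actE _ _ _ _ ok').
rewrite -[last h (p :: t)]/(last p t) -[last h (q :: u)]/(last q u).
apply: rfmatP => g l.
rewrite -[RHS]/(if (l == p) && (g <= p)%O then
  (ract (lact (arr A (last p t) (last q u) : B) z) (arr A h h : B) : shriek_mod M) g h else 0).
rewrite [LHS](sandwichE _ _ _ bb qp) (sandwichE _ _ _ bb (lexx h)) eqxx /=.
case: (eqVneq l p) => //= _; case: (eqVneq g (last p t)) => [->|_]; last by rewrite if_same.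
by rewrite (below_chain_last ok) eqxx (below_chain_last okq).
Qed.

Lemma move_col_id h p t (z : FM) : below_chain h (p :: t) -> chain_act true h (p :: t) (p :: t) z = z ->
  move_col h p (chain_act true h (h :: p :: t) (p :: t) z) = z.
Proof.
move=> ok; have ok' : below_chain h (h :: p :: t) by rewrite /= lexx.
have ph : (p <= h)%O by case/andP: ok.
rewrite (chain_actE _ _ _ _ ok) (chain_actE _ _ _ _ ok') => zE; rewrite -[RHS]zE.
rewrite -[last h (p :: t)]/(last p t); apply: rfmatP => g l.
rewrite -[LHS]/(if (l == p) && (g <= p)%O then
  (ract (lact (arr A (last p t) (last p t) : B) z) (arr A p h : B) : shriek_mod M) g h else 0).
rewrite [RHS](sandwichE _ _ _ (lexx _) (lexx _)) (sandwichE _ _ _ (lexx _) ph) eqxx /=.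
case: (eqVneq l p) => //= _; case: (eqVneq g (last p t)) => [->|_]; last by rewrite if_same.
by rewrite (below_chain_last ok).
Qed.

Lemma move_col_apex h p (z : FM) : (p <= h)%O ->
  move_col h p (chain_act true h [:: h; p] [:: h] z)
  = lact (arr A p p : B) (diagm ((z : shriek_mod M) h h)).
Proof.
move=> ph; have ok : below_chain h [:: h; p] by rewrite /= lexx [geC _ _]ph.
rewrite (chain_actE _ _ _ _ ok) -[last h [:: p]]/p -[last h [::]]/h.
apply: rfmatP => g l; rewrite [RHS]arr_diagm_E //.
rewrite -[LHS]/(if (l == p) && (g <= p)%O then
  (ract (lact (arr A p h : B) z) (arr A h h : B) : shriek_mod M) g h else 0).
rewrite (sandwichE _ _ _ ph (lexx h)) eqxx /=.
case: (eqVneq g p) => [->|_] /=; last by rewrite if_same.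
by rewrite lexx andbT.
Qed.

End ColumnMove.
End Unit.

(** * The unit and the coaugmentation are relative quasi-isomorphisms *)

Section UnitEquivalence.
Variables (k : comPzRingType) (d : Order.disp_t) (C : porderType d).
Variable A : presheaf k C.
Notation B := (shriek_alg A).
Notation FK M := (Kom_ob (shriek A) M).
Notation KF M := (Kom_ob (bimod_forget B) (Kom_ob (shriek A) M)).
Variable M : complex (pbimod A).
Variable h : C.

Definition col_slide (_ : unit) (s : seq C) m (z : KF M m) : KF M m :=
  match s with
  | p :: _ => move_col (M := M m) h p z
  | [::] => z
  end.

Lemma col_slide_linear x s m : linear (@col_slide x s m).
Proof. by case: s => [|p t] //; exact: move_col_linear. Qed.

Lemma col_slide0 x s m : col_slide x s (0 : KF M m) = 0.
Proof. exact: (linear0 (mklinear (@col_slide_linear x s m))). Qed.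

Lemma col_slide_d x s m z : cd (KF M) m @! (col_slide x s z) = col_slide x s (cd (KF M) m @! z).
Proof.
case: s => [|p t] //; apply: rfmatP => g l.
rewrite -[LHS]/((cd M m : pbimod_mor _ _) g (if (l == p) && (g <= p)%O then (z : shriek_mod (M m.+1)) g h else 0)).
rewrite -[RHS]/(if (l == p) && (g <= p)%O then (cd M m : pbimod_mor _ _) g ((z : shriek_mod (M m.+1)) g h) else 0).
by case: ((l == p) && _); rewrite ?linear0.
Qed.

Lemma col_slide_face (x : unit) p t q u m (z : (FK M m : bimodule B)) :
  below_chain h (p :: t) -> subseq (q :: u) (p :: t) ->
  chain_act true h (p :: t) (q :: u) (col_slide x (q :: u) z : (FK M m : bimodule B))
  = col_slide x (p :: t) (chain_act true h (h :: p :: t) (h :: q :: u) z : (FK M m : bimodule B)).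
Proof. exact: move_col_face. Qed.

Lemma col_slide_id (x : unit) p t m (z : (FK M m : bimodule B)) :
  below_chain h (p :: t) -> chain_act true h (p :: t) (p :: t) z = z ->
  col_slide x (p :: t) (chain_act true h (h :: p :: t) (p :: t) z : (FK M m : bimodule B)) = z.
Proof. exact: move_col_id. Qed.

Notation ch := (cone_off (fun _ : unit => h) (Y := FK M) col_slide).
Notation apx := (apex true (fun _ : unit => h) (Y := FK M) col_slide).

(** The value at the chain reduced to h, where the unit puts its argument. *)
Definition unit_retract n (y : rect_car (FK M) n h) : (M n : pbimodule A) h :=
  (sv y n tt [:: h] : shriek_mod (M n)) h h.

Definition unit_homotopy n (y : rect_car (FK M) n h) : rect_car (FK M) n.+1 h :=
  SubOf (S := tot_sp (rect_coef (FK M) h) n.+1)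
    (cone_off_tot (hx := fun _ : unit => h) col_slide_linear col_slide_face (svP y)).

Lemma unit_apex n (y : rect_car (FK M) n h) :
  apx (sv y) = unit_fun (unit_retract y).
Proof.
apply: cochainP => m x s; rewrite /apex /unit_fun /vcochain; case: x.
case: s => [|p [|q s]] //; case: (boolP (p <= h)%O) => // ph.
case: (eqVneq n m) => [<-|nm].
  by rewrite place_same; exact: (move_col_apex (M := M n)).
rewrite place_neq //.
have -> : sv y m tt [:: h] = 0.
  by have [_ gy _] := svP y; rewrite gy //= addn1 eqSS eq_sym.
by rewrite chain_act0; exact: col_slide0.
Qed.

Lemma unit_contract n (y : rect_car (FK M) n h) :
  totd (rect_coef (FK M) h) (ch (sv y)) + ch (totd (rect_coef (FK M) h) (sv y))
    + unit_fun (unit_retract y) = sv y.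
Proof.
have [By _ _] := svP y.
rewrite -unit_apex.
rewrite (cone_homotopy (hx := fun _ : unit => h) col_slide_linear col_slide_d col_slide_face col_slide_id By).
exact: subrK.
Qed.

Lemma unit_retract_linear n : linear (@unit_retract n).
Proof. by []. Qed.

Lemma unit_homotopy_linear n : linear (@unit_homotopy n).
Proof.
move=> a u v; apply: sub_ofP.
apply: etrans (congr1 ch (sv_linear a u v)) _.
apply: etrans (cone_off_linear _ col_slide_linear _ _ _) _.
exact: esym (sv_linear a (unit_homotopy u) (unit_homotopy v)).
Qed.

Lemma cone_off_vcochain n (v : unit -> C -> KF M n) : ch (vcochain (fun=> h) v) = 0.
Proof.
apply: cochainP => m x [|p t] //.
by rewrite /cone_off /vcochain; case: t => [|q t]; rewrite col_slide0 scaler0.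
Qed.

Lemma unit_contractible :
  contractible (cone (Kom_map (pbimod_at A h) (unit_map M))).
Proof.
apply: (@sdr_contractible k (Kom_ob (pbimod_at A h) M)
  (Kom_ob (pbimod_at A h) (rect_ob (FK M))) _ unit_retract unit_homotopy).
- exact: unit_retract_linear.
- exact: unit_homotopy_linear.
- move=> n y.
  rewrite -[LHS]/((totd (rect_coef (FK M) h) (sv y) n tt [:: h] : shriek_mod (M n)) h h).
  have -> : totd (rect_coef (FK M) h) (sv y) n tt [:: h]
      = cd (KF M) n @! (sv y n.+1 tt [:: h]).
    rewrite /totd (_ : delta _ _ _ _ _ = 0) ?scaler0 ?addr0 //; exact: subr0.
  by [].
- move=> n y.
  rewrite -[LHS]/((unit_fun y n tt [:: h] : shriek_mod (M n)) h h).
  rewrite /unit_fun /vcochain lexx place_same.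
  by rewrite [LHS]arr_diagm_E // !eqxx; exact: ext_idM.
- by move=> n y; apply: sub_ofP; exact: cone_off_vcochain.
- move=> y; apply: sub_ofP; rewrite -[RHS]unit_contract.
  have [_ _ ->] := svP y => //.
  by rewrite (cone_off0 _ col_slide_linear) addr0.
- by move=> n y; apply: sub_ofP; exact: unit_contract.
Qed.

End UnitEquivalence.

Section EtaEquivalence.
Variables (k : comPzRingType) (d : Order.disp_t) (C : porderType d).
Variable A : presheaf k C.
Notation B := (shriek_alg A).
Notation FK M := (Kom_ob (shriek A) M).
Notation KF M := (Kom_ob (bimod_forget B) (Kom_ob (shriek A) M)).
Variable M : complex (pbimod A).

(** In the cobar complex only the bottom of a chain matters, and it does not
    change when the apex is added. *)
Definition id_slide (_ : C) (_ : seq C) m (z : KF M m) : KF M m := z.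

Lemma id_slide_linear x s m : linear (@id_slide x s m).
Proof. by []. Qed.

Lemma id_slide_d x s m z : cd (KF M) m @! (id_slide x s z) = id_slide x s (cd (KF M) m @! z).
Proof. by []. Qed.

Lemma id_slide_face (x : C) p t q u m (z : (FK M m : bimodule B)) :
  below_chain x (p :: t) -> subseq (q :: u) (p :: t) ->
  chain_act false x (p :: t) (q :: u) (id_slide x (q :: u) z : (FK M m : bimodule B))
  = id_slide x (p :: t) (chain_act false x (x :: p :: t) (x :: q :: u) z : (FK M m : bimodule B)).
Proof.
move=> ok _; have ok' : below_chain x (x :: p :: t) by rewrite /= lexx.
by rewrite /id_slide (chain_actE _ _ _ _ ok) (chain_actE _ _ _ _ ok').
Qed.

Lemma id_slide_id (x : C) p t m (z : (FK M m : bimodule B)) :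
  below_chain x (p :: t) -> chain_act false x (p :: t) (p :: t) z = z ->
  id_slide x (p :: t) (chain_act false x (x :: p :: t) (p :: t) z : (FK M m : bimodule B)) = z.
Proof.
move=> ok; have ok' : below_chain x (x :: p :: t) by rewrite /= lexx.
by rewrite /id_slide (chain_actE _ _ _ _ ok) (chain_actE _ _ _ _ ok').
Qed.

Notation ch := (cone_off (fun x : C => x) (Y := FK M) id_slide).
Notation apx := (apex false (fun x : C => x) (Y := FK M) id_slide).

(** Row x of the result is row x of the value at the chain reduced to x.  Each of
    its rows is a row of a matrix of F M, hence finite, which would fail for the
    values of a general complex of A!-bimodules. *)
Definition top_rows n (c : cochain C C (fun m => KF M m)) : shriek_mod (M n).
Proof.
pose z (x : C) : shriek_mod (M n) := c n x [:: x].
exists (fun x l => z x x l) => [x l xl|x]; first exact: rfm_upper.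
exact: rfm_finite.
Defined.

Lemma top_rowsE n c x l :
  top_rows n c x l = (c n x [:: x] : shriek_mod (M n)) x l.
Proof. by []. Qed.

Lemma top_rows_linear n : linear (@top_rows n).
Proof. by move=> a u v; apply: rfmatP => x l. Qed.

Definition eta_retract n (y : cobar_car (FK M) n) : FK M n : bimodule B :=
  top_rows n (sv y).

Definition eta_homotopy n (y : cobar_car (FK M) n) : cobar_car (FK M) n.+1 :=
  SubOf (S := tot_sp (cobar_coef (FK M)) n.+1)
    (cone_off_tot (hx := fun x : C => x) id_slide_linear id_slide_face (svP y)).

Lemma eta_apex n (y : cobar_car (FK M) n) :
  apx (sv y) = eta_fun (eta_retract y).
Proof.
apply: cochainP => m x s; rewrite /apex /eta_fun /vcochain.
case: s => [|p [|q s]] //; case: (boolP (p <= x)%O) => // px.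
have ok : below_chain x [:: x; p] by rewrite /= lexx [geC _ _]px.
rewrite /id_slide (chain_actE _ _ _ _ ok) ract1 -[last x [:: p]]/p -[last x [::]]/x.
case: (eqVneq n m) => [<-|nm].
  by rewrite place_same /eta_v; apply: rfmatP => g l; rewrite !lact_arrE.
rewrite place_neq //.
have -> : sv y m x [:: x] = 0; last exact: lactr0.
by have [_ gy _] := svP y; rewrite gy //= addn1 eqSS eq_sym.
Qed.

Lemma eta_contract n (y : cobar_car (FK M) n) :
  totd (cobar_coef (FK M)) (ch (sv y)) + ch (totd (cobar_coef (FK M)) (sv y))
    + eta_fun (eta_retract y) = sv y.
Proof.
have [By _ _] := svP y.
rewrite -eta_apex.
rewrite (cone_homotopy (hx := fun x : C => x) id_slide_linear id_slide_d id_slide_face id_slide_id By).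
exact: subrK.
Qed.

Lemma eta_retract_linear n : linear (@eta_retract n).
Proof.
move=> a u v; apply: etrans (congr1 (@top_rows n) (sv_linear a u v)) _.
exact: top_rows_linear.
Qed.

Lemma totd_apex n (c : cochain C C (fun m => KF M m)) x :
  totd (cobar_coef (FK M)) c n x [:: x] = cd (KF M) n @! (c n.+1 x [:: x]).
Proof.
rewrite /totd (_ : delta _ _ _ _ _ = 0) ?scaler0 ?addr0 //; exact: subr0.
Qed.

Lemma eta_homotopy_linear n : linear (@eta_homotopy n).
Proof.
move=> a u v; apply: sub_ofP.
apply: etrans (congr1 ch (sv_linear a u v)) _.
apply: etrans (cone_off_linear _ id_slide_linear _ _ _) _.
exact: esym (sv_linear a (eta_homotopy u) (eta_homotopy v)).
Qed.

Lemma eta_contractible :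
  contractible (cone (Kom_map (bimod_forget B) (eta (FK M)))).
Proof.
apply: (@sdr_contractible k (KF M)
  (Kom_ob (bimod_forget B) (cobar_ob (FK M))) _ eta_retract eta_homotopy).
- exact: eta_retract_linear.
- exact: eta_homotopy_linear.
- move=> n y; apply: rfmatP => x l.
  apply: etrans (top_rowsE _ _ _ _) _.
  exact: (congr1 (fun w : shriek_mod (M n) => w x l) (totd_apex n (sv y) x)).
- move=> n y; apply: rfmatP => x l.
  rewrite -[LHS]/((eta_fun (Y := FK M) y n x [:: x] : shriek_mod (M n)) x l).
  rewrite /eta_fun /vcochain lexx place_same /eta_v.
  by rewrite [LHS]lact_arrE // eqxx; exact: ext_idM.
- move=> n y; apply: sub_ofP; apply: cochainP => m x [|p t] //.
  by rewrite [LHS]/(ch _ m x _) /cone_off /eta_op /= /eta_fun /vcochain; case: t => [|q t]; exact: scaler0.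
- move=> y; apply: sub_ofP; rewrite -[RHS]eta_contract.
  have [_ _ ->] := svP y => //.
  by rewrite (cone_off0 _ id_slide_linear) addr0.
- by move=> n y; apply: sub_ofP; exact: eta_contract.
Qed.

End EtaEquivalence.

(** * The comparison theorem *)

Section HomotopyCategory.
Variables (k : comPzRingType) (d : Order.disp_t) (C : porderType d).
Variable A : presheaf k C.
Notation B := (shriek_alg A).
Notation KA := (homotopy_cat (pbimod A)).
Notation KB := (homotopy_cat (bimod B)).
Notation clA := (qcls (homotopy_congr (pbimod A))).
Notation clB := (qcls (homotopy_congr (bimod B))).
Notation FK := (homotopy_functor (shriek A)).

Lemma shriek_KE (M N : complex (pbimod A)) (f : chain_map M N) :
  fmor FK (clA f : @mor KA M N) = clB (Kom_map (shriek A) f).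
Proof.
exact: (@qfmorE _ _ (homotopy_congr _) (homotopy_congr _) (Kom_functor (shriek A))
  (@Kom_map_homotopic _ _ (shriek A)) M N f).
Qed.

Definition unit_K (M : KA) : mor M (rect_K A (FK M)) := clA (unit_map M).
Definition eta_K (Y : KB) : mor Y (cobar_K A Y) := clB (eta Y).
Definition tau_K (Y : KB) : mor (FK (rect_K A Y)) (cobar_K A Y) := clB (tau Y).

Lemma unit_KN (M N : KA) (f : mor M N) :
  cmp (unit_K N) f = cmp (fmor (rect_K A) (fmor FK f)) (unit_K M).
Proof.
elim/qmor_ind: f => f.
rewrite [fmor FK _]shriek_KE [fmor (rect_K A) _]rect_KE.
rewrite [LHS]qcmpE [RHS]qcmpE; congr qcls; exact: unit_natural.
Qed.

Lemma eta_KN (Y Z : KB) (f : mor Y Z) :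
  cmp (eta_K Z) f = cmp (fmor (cobar_K A) f) (eta_K Y).
Proof.
elim/qmor_ind: f => f; rewrite [fmor (cobar_K A) _]cobar_KE.
rewrite [LHS]qcmpE [RHS]qcmpE; congr qcls; exact: eta_natural.
Qed.

Lemma tau_KN (Y Z : KB) (f : mor Y Z) :
  cmp (tau_K Z) (fmor FK (fmor (rect_K A) f)) = cmp (fmor (cobar_K A) f) (tau_K Y).
Proof.
elim/qmor_ind: f => f.
rewrite [fmor (cobar_K A) _]cobar_KE [fmor (rect_K A) _]rect_KE [fmor FK _]shriek_KE.
rewrite [LHS]qcmpE [RHS]qcmpE; congr qcls; exact: tau_natural.
Qed.

Lemma tau_unit_K (M : KA) : cmp (tau_K (FK M)) (fmor FK (unit_K M)) = eta_K (FK M).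
Proof.
rewrite [fmor FK _]shriek_KE [LHS]qcmpE; congr qcls; exact: tau_unit.
Qed.

Lemma unit_K_Sigma (M : KA) : Sigma_pbimod (unit_K M).
Proof. by exists (unit_map M) => // h; exact: unit_contractible. Qed.

Lemma eta_K_Sigma (M : KA) : Sigma_bimod (eta_K (FK M)).
Proof. by exists (eta (Kom_ob (shriek A) M)) => //; exact: eta_contractible. Qed.

End HomotopyCategory.

Theorem theorem4p1 (k : comPzRingType) (d : Order.disp_t) (C : porderType d)
    (A : presheaf k C) (M N : Dk_pbimod A) :
  bijective (fun f : mor M N => fmor (Dk_shriek A) f).
Proof.
exact: (loc_fully_faithful (@shriek_Sigma k d C A) (@rect_K_Sigma k d C A)
  (@cobar_K_Sigma k d C A) (@unit_KN k d C A) (@eta_KN k d C A) (@tau_KN k d C A)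
  (@unit_K_Sigma k d C A) (@eta_K_Sigma k d C A) (@tau_unit_K k d C A)).
Qed.
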